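(* Let $0\le k_1<k_2$ be fixed integers, let $w_2\in(0,\infty)$, and let $\mathcal P$ be a probability distribution on $\mathbb R$ that is centered, has unit variance and has bounded support. Let $\mathbb P_\ell$ ($\ell=1,2$) be the law of the $N\times N$ rank-$k_\ell$ spiked Gaussian Wigner matrix $Y$ with signal-to-noise ratio $\lambda>0$ and prior $\mathcal P$, let $\mathcal L(Y;k_1,k_2)=\frac{d\mathbb P_2}{d\mathbb P_1}(Y)$ be the likelihood ratio, and let $$\operatorname{err}^*(k_1,k_2)=\mathbb P_2(\mathcal L(Y;k_1,k_2)\le1)+\mathbb P_1(\mathcal L(Y;k_1,k_2)>1)$$ be the error of the likelihood ratio test. Then there exists $\lambda_0\equiv\lambda_0(k_1,k_2,\mathcal P)\in(0,1]$ such that for $\lambda<\lambda_0$ $$\lim_{N\to\infty}\operatorname{err}^*(k_1,k_2)=\operatorname{erfc}\left(\frac{k_2-k_1}{4}\sqrt{-\log(1-\lambda)+\Big(\frac{2}{w_2}-1\Big)\lambda}\right),$$ where $\operatorname{erfc}(x)=\frac{2}{\sqrt\pi}\int_x^\infty e^{-t^2}\,dt$.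
   Context: The rank-$k$ spiked Gaussian Wigner matrix with signal-to-noise ratio $\lambda$ and prior $\mathcal P$ is the $N\times N$ matrix $Y=\sqrt{\lambda/N}\,X^*X^{*T}+W$, where $X^*$ is an $N\times k$ matrix with i.i.d. entries of law $\mathcal P$ (for $k=0$, $Y=W$), and $W$, independent of $X^*$, is a real symmetric matrix whose entries $W_{ij}$, $i\le j$, are independent centered Gaussians with variance $1$ for $i<j$ and variance $w_2$ for $i=j$. The likelihood ratio test accepts $\boldsymbol H_1:k=k_1$ if $\mathcal L(Y;k_1,k_2)\le1$ and accepts $\boldsymbol H_2:k=k_2$ if $\mathcal L(Y;k_1,k_2)>1$; its error is the sum of its Type-I and Type-II errors. *)

(* Defs.v *)
From HB Require Import structures.
From mathcomp Require Import all_boot all_order all_algebra.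
From mathcomp Require Import all_classical all_reals all_analysis.

Set Implicit Arguments.
Unset Strict Implicit.
Unset Printing Implicit Defensive.

Import Order.TTheory GRing.Theory Num.Theory.
Import numFieldNormedType.Exports.

Local Open Scope classical_set_scope.
Local Open Scope ring_scope.

Definition mx_measure_display : measure_display -> measure_display.
Proof. exact. Qed.

Section measurable_matrix.
Context {d : measure_display} {T : measurableType d}.
Variables m n : nat.

Definition mx_entry (ij : 'I_m * 'I_n) (A : 'M[T]_(m, n)) : T := A ij.1 ij.2.

(* the product sigma-algebra, i.e. the one generated by the entries *)
Definition mx_measurable : set (set 'M[T]_(m, n)) :=
  <<s \bigcup_(ij in [set: 'I_m * 'I_n])
        preimage_set_system setT (mx_entry ij) measurable >>.

Let mx_measurable0 : mx_measurable set0.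
Proof. exact: sigma_algebra0. Qed.

Let mx_measurableC A : mx_measurable A -> mx_measurable (~` A).
Proof. exact: sigma_algebraC. Qed.

Let mx_measurable_bigcup (F : (set 'M[T]_(m, n))^nat) :
  (forall i, mx_measurable (F i)) -> mx_measurable (\bigcup_i F i).
Proof. exact: sigma_algebra_bigcup. Qed.

HB.instance Definition _ := @isMeasurable.Build (mx_measure_display d)
  'M[T]_(m, n) mx_measurable mx_measurable0 mx_measurableC mx_measurable_bigcup.

End measurable_matrix.

Section independence.
Local Open Scope ereal_scope.
Context {d d1 d2 : measure_display} {R : realType}.
Context {Omega : measurableType d} (P : probability Omega R).

Definition mutually_independent (I : finType) (T : measurableType d1)
    (D : {set I}) (X : I -> Omega -> T) : Prop :=
  forall (J : {set I}) (A : I -> set T), J \subset D ->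
    (forall i, measurable (A i)) ->
    P (\bigcap_(i in [set` J]) (X i @^-1` A i)) =
    \big[mule/1]_(i in J) P (X i @^-1` A i).

Definition independent_RV (T1 : measurableType d1) (T2 : measurableType d2)
    (X : Omega -> T1) (Y : Omega -> T2) : Prop :=
  forall (A : set T1) (B : set T2), measurable A -> measurable B ->
    P (X @^-1` A `&` Y @^-1` B) = P (X @^-1` A) * P (Y @^-1` B).

Definition has_law (T : measurableType d1) (X : Omega -> T)
    (mu : set T -> \bar R) : Prop :=
  forall A : set T, measurable A -> pushforward P X A = mu A.

End independence.

Section model.
Context {R : realType}.

Definition support_of (mu : probability R R) : set R :=
  [set x | forall U : set R, open U -> U x -> (0 < mu U)%E].

Definition iid_entries (d : measure_display) (Omega : measurableType d)
    (P : probability Omega R) (N k : nat) (X : Omega -> 'M[R]_(N, k))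
    (prior : probability R R) : Prop :=
  mutually_independent P [set: 'I_N * 'I_k]%SET
    (fun ij omega => X omega ij.1 ij.2) /\
  (forall i j, has_law P (fun omega => X omega i j) prior).

(* normal_prob takes the standard deviation, not the variance *)
Definition gaussian_wigner (d : measure_display) (Omega : measurableType d)
    (P : probability Omega R) (N : nat) (w2 : R)
    (W : Omega -> 'M[R]_N) : Prop :=
  [/\ forall omega, (W omega)^T = W omega,
      mutually_independent P [set ij : 'I_N * 'I_N | (ij.1 <= ij.2)%N]%SET
        (fun ij omega => W omega ij.1 ij.2),
      forall i j : 'I_N, (i < j)%N ->
        has_law P (fun omega => W omega i j) (normal_prob 0 1) &
      forall i : 'I_N,
        has_law P (fun omega => W omega i i) (normal_prob 0 (Num.sqrt w2))].

Definition spiked_mx (N k : nat) (lambda : R) (X : 'M[R]_(N, k))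
    (W : 'M[R]_N) : 'M[R]_N :=
  Num.sqrt (lambda / N%:R) *: (X *m X^T) + W.

(* for k = 0 the product is an empty sum, so Y = W *)
Definition spiked_wigner_law (N k : nat) (lambda w2 : R)
    (prior : probability R R) (mu : probability 'M[R]_N R) : Prop :=
  exists (d : measure_display) (Omega : measurableType d)
    (P : probability Omega R)
    (X : {RV P >-> 'M[R]_(N, k)}) (W : {RV P >-> 'M[R]_N}),
  [/\ iid_entries P X prior,
      gaussian_wigner P w2 W,
      independent_RV P X W &
      has_law P (fun omega => spiked_mx lambda (X omega) (W omega)) mu].

End model.

Section likelihood_ratio_test.
Local Open Scope ereal_scope.
Local Open Scope charge_scope.
Context {d : measure_display} {T : measurableType d} {R : realType}.
Variables P1 P2 : probability T R.

(* Radon_Nikodym is constantly -oo when P2 is not dominated by P1; the laws of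
   two spiked Wigner matrices of the same size are mutually absolutely
   continuous, so this case does not occur below. *)
Definition likelihood_ratio : T -> \bar R :=
  'd (charge_of_finite_measure P2) '/d P1.

Definition lrt_err : \bar R :=
  P2 [set y | likelihood_ratio y <= 1] + P1 [set y | 1 < likelihood_ratio y].

End likelihood_ratio_test.

Definition erfc {R : realType} (x : R) : R :=
  2 / Num.sqrt pi * \int[lebesgue_measure]_(t in `[x, +oo[) expR (- t ^+ 2).

(* Main.v *)
(** Let [mu0] be the law of [W] and [L_k] the density of the rank-[k] law with
    respect to [mu0], so that the error of the test is [E min(L_k1, L_k2)] under
    [mu0].  By the Cameron-Martin formula every product of such densities
    averages to [E exp(sum of overlaps)] over independent replicas of the spike,
    and a Hubbard-Stratonovich linearization turns this into a product over the
    rows, whose limit is explicit when [lambda] is small.  Comparing second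
    moments gives [L_k - c_k L_1^k -> 0] in [L^2], with [c_k = exp(-k(k-1)V/2)]
    and [V = -ln(1-lambda)/2 + lambda(1/w_2-1/2)].

    Low-degree moments do not determine the limit law of [L_1], and high moments
    are out of reach for fixed [lambda].  Instead the rank-one spike is revealed
    in [M] blocks of rows: the densities of the truncated spikes form a
    martingale, and a Lindeberg replacement of each multiplicative increment by
    an independent log-normal factor, which needs four moments only, shows that
    the Laplace transform of [L_1] converges to that of [exp(sqrt V g - V/2)]
    with [g] standard Gaussian.  Bernstein polynomials in [exp(-L_1)] pass from
    Laplace transforms to [E min(c_k1 L_1^k1, c_k2 L_1^k2)], and the limit is a
    Gaussian tail probability. *)
Require Import Defs.
From HB Require Import structures.
From mathcomp Require Import all_boot all_order all_algebra.
From mathcomp Require Import all_classical all_reals all_analysis.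
From mathcomp Require Import measurable_realfun normal_distribution.
From mathcomp Require Import ring lra.

Set Implicit Arguments.
Unset Strict Implicit.
Unset Printing Implicit Defensive.

Import Order.TTheory GRing.Theory Num.Theory.
Import numFieldNormedType.Exports.

Local Open Scope classical_set_scope.
Local Open Scope ring_scope.

(** * Laws of random matrices *)

(** Every expectation that occurs involves at most [kmax = maxn 4 (k2 + k2)] independent spikes:
    four for the Lindeberg error, [2 * k2] for the comparison in L^2. After linearization,
    exponential moments of the overlaps of K spikes are dominated by a Gaussian integral that is
    finite when 4 lam K^2 B^4 < 1, where B bounds the prior; hence lambda0 = 1 / (4 kmax^2 B^4),
    free of w2. The constant c_k is forced by E L_1^k -> exp(k(k-1)V/2): it gives c_k L_1^k limiting
    mean 1. The blocks make four moments sufficient: an increment of variance of order 1/M costs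
    O(M^(-3/2)), so M of them cost O(M^(-1/2)). Conditional expectations are never formed. Tilting
    the noise by the likelihood ratio of a spike is the same as shifting it by that spike, and the
    ratio of a truncated spike does not feel shifts in the remaining rows. In the limit, c_k L_1^k
    is the density of N(k sqrt V, 1) relative to N(0, 1): the test separates two unit Gaussians at
    distance (k2 - k1) sqrt V. *)

Section matrix_measurability.
Context {R : realType} {m n : nat}.
Implicit Types (B : 'I_m -> 'I_n -> set R).

Lemma measurable_mx_entry i j : measurable_fun setT (fun A : 'M[R]_(m, n) => A i j).
Proof.
move=> _ Y mY; rewrite setTI; apply: sub_sigma_algebra.
by exists (i, j) => //; exists Y => //; rewrite setTI.
Qed.

Lemma measurable_mxP d (T : measurableType d) (f : T -> 'M[R]_(m, n)) :
  (forall i j, measurable_fun setT (fun x => f x i j)) -> measurable_fun setT f.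
Proof.
move=> mf; apply: (measurability (\bigcup_(ij in [set: 'I_m * 'I_n])
  preimage_set_system setT (@mx_entry _ R m n ij) measurable)) => //.
move=> _ [_ [[i j] _ [Y mY <-]] <-]; rewrite !setTI.
by have := mf i j measurableT Y mY; rewrite setTI.
Qed.

Definition rect B : set 'M[R]_(m, n) := [set A | forall i j, B i j (A i j)].

Lemma measurable_rect B : (forall i j, measurable (B i j)) -> measurable (rect B).
Proof.
move=> mB.
rewrite (_ : rect B = \bigcap_(ij in [set: 'I_m * 'I_n])
    ((fun A : 'M[R]_(m, n) => A ij.1 ij.2) @^-1` B ij.1 ij.2)); last first.
  by apply/seteqP; split=> A h; [move=> ij _; exact: h|move=> i j; exact: (h (i, j))].
apply: fin_bigcap_measurable; first exact: finite_finset.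
move=> [i j] _.
by have := @measurable_mx_entry i j measurableT _ (mB i j); rewrite setTI.
Qed.

Lemma rectI B1 B2 : rect B1 `&` rect B2 = rect (fun i j => B1 i j `&` B2 i j).
Proof.
apply/seteqP; split=> A /=; first by move=> [h1 h2] i j; split.
by move=> h; split=> i j; have [] := h i j.
Qed.

Lemma rect_setT : rect (fun _ _ => setT) = setT.
Proof. by apply/seteqP; split. Qed.

(** Rectangles are stable under intersection and generate the product sigma-algebra, so the
    uniqueness theorem for finite measures applies. *)
Lemma mx_measure_unique (mu1 mu2 : {measure set 'M[R]_(m, n) -> \bar R}) :
  (mu1 setT < +oo)%E ->
  (forall B, (forall i j, measurable (B i j)) -> mu1 (rect B) = mu2 (rect B)) ->
  forall A, measurable A -> mu1 A = mu2 A.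
Proof.
move=> mu1oo mu12 A mA.
pose G : set (set 'M[R]_(m, n)) :=
  [set X | exists B, (forall i j, measurable (B i j)) /\ X = rect B].
apply: (measure_unique G (fun=> setT)) => //.
- apply/seteqP; split.
    apply: smallest_sub; first exact: smallest_sigma_algebra.
    move=> _ [[i j] _ [Y mY <-]]; rewrite setTI; apply: sub_sigma_algebra.
    exists (fun i' j' => if (i', j') == (i, j) then Y else setT); split.
      by move=> i' j'; case: ifP.
    apply/seteqP; split=> X /=.
      by move=> h i' j'; case: eqP => // -[-> ->].
    by move=> /(_ i j); rewrite eqxx.
  apply: smallest_sub; first exact: sigma_algebra_measurable.
  by move=> X [B [mB ->]]; exact: measurable_rect.
- move=> X Y [B1 [mB1 ->]] [B2 [mB2 ->]]; rewrite rectI.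
  by eexists; split; last reflexivity; move=> i j; exact: measurableI.
- by move=> i; exists (fun _ _ => setT); split=> //; rewrite rect_setT.
- by rewrite bigcup_const//; exists 0%N.
- by move=> X [B [mB ->]]; exact: mu12.
Qed.

End matrix_measurability.
Arguments rect {R m n} B.
Arguments measurable_mx_entry {R m n} i j.

Section image_law.
Context {d d' : measure_display} {T : measurableType d} {T' : measurableType d'}.
Context {R : realType} (P : probability T R) (g : T -> T').
Hypothesis mg : measurable_fun setT g.

Let mg_mixin := isMeasurableFun.Build _ _ _ _ g mg.
Let mg_pack : {mfun T >-> T'} := HB.pack g mg_mixin.

Definition image_law : probability T' R := distribution P mg_pack.

Lemma image_lawE A : image_law A = P (g @^-1` A).
Proof. by []. Qed.

Lemma integral_image_law (f : T' -> \bar R) :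
  measurable_fun [set: T'] f -> (forall y, 0 <= f y)%E ->
  (\int[image_law]_y f y = \int[P]_x f (g x))%E.
Proof. by move=> mf f0; rewrite ge0_integral_distribution. Qed.

End image_law.

Section mx_transfer.
Context {R : realType} {m n : nat} {d : measure_display} {T : measurableType d}.
Variables (P : probability T R) (mu : probability 'M[R]_(m, n) R).
Variables (g : T -> 'M[R]_(m, n)) (mg : measurable_fun setT g).
Hypothesis Pg : forall B, (forall i j, measurable (B i j)) ->
  P (g @^-1` rect B) = mu (rect B).

Lemma mx_transferE A : measurable A -> mu A = P (g @^-1` A).
Proof.
move=> mA; rewrite -(image_lawE P mg); apply: mx_measure_unique => //.
  by rewrite (@le_lt_trans _ _ 1%E) ?ltry//; exact: probability_le1.
by move=> B mB; symmetry; exact: Pg.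
Qed.

(** Resampling a block of entries, concatenating columns and clipping entries all go through this
    lemma, which leaves only a computation on rectangles each time. *)
Lemma mx_transfer (f : 'M[R]_(m, n) -> \bar R) :
  measurable_fun setT f -> (forall A, 0 <= f A)%E ->
  (\int[mu]_A f A = \int[P]_x f (g x))%E.
Proof.
move=> mf f0; rewrite -(integral_image_law P mg)//.
by apply: eq_measure_integral => A mA _; exact: mx_transferE.
Qed.

End mx_transfer.

Section integral_density.
Local Open Scope ereal_scope.
Context {d : measure_display} {T : measurableType d} {R : realType}.
Variables (mu nu : {measure set T -> \bar R}) (h : T -> R).
Hypotheses (mh : measurable_fun setT h) (h0 : forall x, (0 <= h x)%R).
Hypothesis nuE : forall A, measurable A -> nu A = \int[mu]_(x in A) (h x)%:E.

Import HBNNSimple.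

Let mhE : measurable_fun setT (fun x => (h x)%:E).
Proof. exact/measurable_EFinP. Qed.
Let integral_density_nnsfun (g : {nnsfun T >-> R}) :
  \int[nu]_x (g x)%:E = \int[mu]_x ((g x)%:E * (h x)%:E).
Proof.
have mr r : measurable_fun setT (fun x => (r * \1_(g @^-1` [set r]) x)%:E).
  by apply/measurable_EFinP; exact: measurable_funM.
have gE x : (g x)%:E = \sum_(r \in range g) (r * \1_(g @^-1` [set r]) x)%:E.
  by rewrite fsumEFin// -fimfunE.
under eq_integral do rewrite gE.
under [RHS]eq_integral => x _.
  rewrite gE ge0_mule_fsuml; last by move=> r; exact: nnfun_muleindic_ge0.
  over.
rewrite ge0_integral_fsum//; last by move=> n x _; exact: nnfun_muleindic_ge0.
rewrite ge0_integral_fsum//; last 2 first.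
- by move=> r; exact: emeasurable_funM.
- by move=> r x _; rewrite mule_ge0 ?lee_fin// -lee_fin; exact: nnfun_muleindic_ge0.
apply: eq_fsbigr => r /[!inE] -[t _ <-].
have mA : measurable (g @^-1` [set g t]) by [].
under eq_integral do rewrite EFinM.
under [RHS]eq_integral do rewrite EFinM -muleA.
rewrite !ge0_integralZl//.
- rewrite integral_indic// setIT nuE//; congr (_ * _).
  rewrite integral_mkcond; apply: eq_integral => x _.
  by rewrite muleC epatch_indic.
- by apply: emeasurable_funM => //; exact/measurable_EFinP.
- by move=> x _; rewrite mule_ge0 ?lee_fin.
- by rewrite lee_fin.
- exact/measurable_EFinP.
- by rewrite lee_fin.
Qed.

Lemma ge0_integral_density (f : T -> \bar R) :
  measurable_fun setT f -> (forall x, 0 <= f x) ->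
  \int[nu]_x f x = \int[mu]_x (f x * (h x)%:E).
Proof.
move=> mf f0; pose g := nnsfun_approx measurableT mf.
have gf x : (g n x)%:E @[n --> \oo] --> f x by exact: cvg_nnsfun_approx.
have nd x : {homo (fun n => g n x) : a b / (a <= b)%N >-> (a <= b)%R}.
  by move=> a b ab; exact/lefP/nd_nnsfun_approx.
transitivity (limn (fun n => \int[nu]_x (g n x)%:E)).
  rewrite -monotone_convergence//; last 3 first.
  - by move=> n; exact/measurable_EFinP.
  - by move=> n x _; rewrite lee_fin.
  - by move=> x _ a b ab; rewrite lee_fin; exact: nd.
  by apply: eq_integral => x _; apply/esym/cvg_lim => //; exact: gf.
under eq_fun do rewrite integral_density_nnsfun.
rewrite -monotone_convergence//.
- apply: eq_integral => x _; apply/cvg_lim => //.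
  by apply: cvgeZr => //; exact: gf.
- by move=> n; apply: emeasurable_funM => //; exact/measurable_EFinP.
- by move=> n x _; rewrite mule_ge0 ?lee_fin.
- by move=> x _ a b ab; rewrite lee_wpmul2r ?lee_fin//; exact: nd.
Qed.

End integral_density.

Lemma emeasurable_prod d (T : measurableType d) (R : realType) (I : Type)
    (s : seq I) (P : pred I) (h : I -> T -> \bar R) :
  (forall i, P i -> measurable_fun setT (h i)) ->
  measurable_fun setT (fun x => \big[mule/1%E]_(i <- s | P i) h i x).
Proof.
move=> mh; elim: s => [|i s IH].
  by under eq_fun do rewrite big_nil; exact: measurable_cst.
under eq_fun do rewrite big_cons; have [Pi|//] := boolP (P i).
by apply: emeasurable_funM => //; exact: mh.
Qed.

Lemma integral_prob_cst d (T : measurableType d) (R : realType)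
    (P : probability T R) (c : \bar R) : (\int[P]_x c = c)%E.
Proof.
rewrite integral_cst//; apply: etrans (mule1 c); congr mule.
exact: probability_setT.
Qed.

Lemma measurable_sum_cond d (T : measurableType d) (R : realType) (I : Type)
    (s : seq I) (P : pred I) (h : I -> T -> R) :
  (forall i, P i -> measurable_fun setT (h i)) ->
  measurable_fun setT (fun x => \sum_(i <- s | P i) h i x).
Proof.
move=> mh; under eq_fun do rewrite big_mkcond; apply: measurable_sum => i.
by have [Pi|_] := boolP (P i); [exact: mh|exact: measurable_cst].
Qed.

(** * Shifts of Gaussian laws *)

Section lebesgue_affine.
Context {R : realType}.
Notation mu := (@lebesgue_measure R).

(** By uniqueness, Lebesgue measure is [a] times its pushforward under the affine map, which only
    has to be checked on half-open intervals. *)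
Lemma ge0_integral_lebesgue_affine (a t : R) (f : R -> \bar R) : 0 < a ->
  measurable_fun [set: R] f -> (forall x, 0 <= f x)%E ->
  (\int[mu]_x f (a * x + t)%R = (a^-1)%:E * \int[mu]_x f x)%E.
Proof.
move=> a0 mf f0.
pose g (x : measurableTypeR R) : measurableTypeR R := a * (x : R) + t.
have mg : measurable_fun [set: measurableTypeR R] g.
  by apply: (@measurable_funD _ R _ setT (fun x => a * x) (cst t)) => //; exact: measurable_funM.
pose nu := mscale (NngNum (ltW a0)) (measure_function_pushforward__canonical__measure_function_Measure mu mg).
have gX (X : set R) : measurable X -> mu X = nu X.
  move=> mX; apply: lebesgue_measure_unique => // _ [[u v] _ <-].
  rewrite /nu/= /mscale/= /pushforward.
  have -> : g @^-1` `]u, v] = `](u - t) / a, (v - t) / a]%classic.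
    by apply/seteqP; split => x /=; rewrite !in_itv/= /g ltr_pdivrMr// ler_pdivlMr// (mulrC x);
      move=> /andP[h1 h2]; apply/andP; split; lra.
  rewrite !lebesgue_measure_itv/= !lte_fin ltr_pM2r ?invr_gt0// ltrD2r.
  case: ifPn => _; last by rewrite mule0.
  by rewrite -!EFinB -EFinM; congr EFin; field; rewrite gt_eqF.
have -> : (\int[mu]_x f x = \int[nu]_x f x)%E.
  by apply: eq_measure_integral => A mA _; exact: gX.
rewrite /nu ge0_integral_mscale//.
rewrite muleA -EFinM mulVf ?gt_eqF// mul1e.
by rewrite ge0_integral_pushforward.
Qed.

Lemma ge0_integral_lebesgue_shift (t : R) (f : R -> \bar R) :
  measurable_fun [set: R] f -> (forall x, 0 <= f x)%E ->
  (\int[mu]_x f (x + t)%R = \int[mu]_x f x)%E.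
Proof.
move=> mf f0; rewrite -[RHS]mul1e -[X in (X%:E * _)%E]invr1.
rewrite -(@ge0_integral_lebesgue_affine 1 t)//.
by under [RHS]eq_integral do rewrite mul1r.
Qed.

End lebesgue_affine.

Section gaussian_law.
Context {R : realType}.
Implicit Types (s t a : R) (f : R -> \bar R).
Notation mu := (@lebesgue_measure R).

Let idTR : measurableTypeR R -> R := idfun.
Let midTR : measurable_fun setT idTR := @measurable_id _ _ setT.

(** Retypes the normal law, which lives on [measurableTypeR R], as a probability on [R]. The
    parameter is the standard deviation. *)
Definition gauss s : probability R R := image_law (normal_prob 0 s) midTR.

#[local] Arguments gauss : simpl never.
Lemma integral_gauss s f : s != 0 -> measurable_fun setT f ->
  (forall x, 0 <= f x)%E ->
  (\int[gauss s]_x f x = \int[mu]_x (f x * (normal_pdf 0 s x)%:E))%E.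
Proof.
move=> s0 mf f0; rewrite integral_image_law//=.
apply: (ge0_integral_density (mu := mu)) => //; first exact: measurable_normal_pdf.
by move=> x; exact: normal_pdf_ge0.
Qed.

Lemma normal_pdf0E s x : s != 0 ->
  normal_pdf 0 s x = normal_peak s * expR (- x ^+ 2 / (s ^+ 2 *+ 2)).
Proof. by move=> s0; rewrite normal_pdfE// /normal_fun subr0. Qed.

(** Cameron-Martin in dimension one: the weight is the ratio of the densities of N(t, s^2) and N(0,
    s^2), and Lebesgue measure is invariant under translation by [t]. *)
Lemma gauss_shift s t f : s != 0 -> measurable_fun [set: R] f ->
  (forall x, 0 <= f x)%E ->
  (\int[gauss s]_x (f x * (expR (t * x / s ^+ 2 - t ^+ 2 / (2 * s ^+ 2)))%:E) =
   \int[gauss s]_x f (x + t)%R)%E.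
Proof.
move=> s0 mf f0.
have mft : measurable_fun [set: R] (fun x => f (x + t)).
  by apply: measurableT_comp => //; exact: measurable_funD.
rewrite !integral_gauss//; last 2 first.
- apply: emeasurable_funM => //; apply/measurable_EFinP; apply: measurableT_comp => //.
  by apply: measurable_funB => //; apply: measurable_funM => //; exact: measurable_funM.
- by move=> x; rewrite mule_ge0// lee_fin expR_ge0.
rewrite -(ge0_integral_lebesgue_shift t); last 2 first.
- apply: emeasurable_funM; last by apply/measurable_EFinP; exact: measurable_normal_pdf.
  apply: emeasurable_funM => //; apply/measurable_EFinP; apply: measurableT_comp => //.
  by apply: measurable_funB => //; apply: measurable_funM => //; exact: measurable_funM.
- move=> x; apply: mule_ge0; last by rewrite lee_fin normal_pdf_ge0.
  by rewrite mule_ge0// lee_fin expR_ge0.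
apply: eq_integral => x _; rewrite -muleA -EFinM; congr (_ * _%:E)%E.
rewrite !normal_pdf0E// mulrCA -expRD; congr (_ * expR _).
by field.
Qed.

Lemma integral_gauss_expR s t : s != 0 ->
  (\int[gauss s]_x (expR (t * x / s ^+ 2 - t ^+ 2 / (2 * s ^+ 2)))%:E = 1)%E.
Proof.
move=> s0; have := @gauss_shift s t (cst 1%E) s0 (measurable_cst _) (fun=> lee01).
under eq_integral do rewrite mul1e.
by move=> ->; rewrite integral_cst// mul1e; exact: probability_setT.
Qed.

(** The exponents merge into -(1 - a) x^2 / 2, which a dilation by sqrt(1 - a) turns back into the
    standard one. *)
Lemma integral_gauss_sqr a : a < 1 ->
  (\int[gauss 1]_x (expR (a * x ^+ 2 / 2))%:E = ((Num.sqrt (1 - a))^-1)%:E)%E.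
Proof.
move=> a1; have b0 : 0 < Num.sqrt (1 - a) by rewrite sqrtr_gt0; lra.
have mE : measurable_fun [set: R] (fun x : R => (expR (a * x ^+ 2 / 2))%:E).
  by apply/measurable_EFinP; apply: measurableT_comp => //; apply: measurable_funM => //; exact: measurable_funM.
rewrite integral_gauss ?oner_neq0//.
pose g (x : R) := (normal_pdf 0 1 x)%:E.
transitivity (\int[mu]_x g (Num.sqrt (1 - a) * x + 0)%R)%E.
  apply: eq_integral => x _; rewrite /g addr0 !normal_pdf0E ?oner_neq0// -EFinM.
  rewrite mulrCA -expRD exprMn sqr_sqrtr ?expr1n; last lra.
  by congr (_ * expR _)%:E; field.
rewrite ge0_integral_lebesgue_affine//.
- by rewrite integral_normal_pdf mule1.
- by apply/measurable_EFinP; exact: measurable_normal_pdf.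
- by move=> x; rewrite lee_fin normal_pdf_ge0.
Qed.

End gaussian_law.

Arguments gauss : simpl never.

(** * Matrices with i.i.d. entries and independence of blocks *)

Section iid_matrix.
Context {R : realType} {m n : nat} (prior : probability R R).
Implicit Types (mu : probability 'M[R]_(m, n) R) (A : 'M[R]_(m, n)).
Implicit Types (D : pred ('I_m * 'I_n)) (B : 'I_m -> 'I_n -> set R).

Definition iid_law mu := forall B, (forall i j, measurable (B i j)) ->
  mu (rect B) = \big[mule/1%E]_(ij : 'I_m * 'I_n) prior (B ij.1 ij.2).

Lemma iid_law_unique mu1 mu2 : iid_law mu1 -> iid_law mu2 ->
  forall E, measurable E -> mu1 E = mu2 E.
Proof.
move=> h1 h2; apply: mx_measure_unique; last by move=> B mB; exact: etrans (h1 _ mB) (esym (h2 _ mB)).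
by rewrite (@le_lt_trans _ _ 1%E) ?ltry//; exact: probability_le1.
Qed.

Definition mix_mx D A A' : 'M[R]_(m, n) :=
  \matrix_(i, j) if D (i, j) then A' i j else A i j.

Definition depends_on D d (T : measurableType d) (f : 'M[R]_(m, n) -> T) :=
  forall A A', (forall i j, D (i, j) -> A i j = A' i j) -> f A = f A'.

Lemma measurable_mix_mx D :
  measurable_fun setT (fun AA : 'M[R]_(m, n) * 'M[R]_(m, n) => mix_mx D AA.1 AA.2).
Proof.
apply: measurable_mxP => i j; under eq_fun do rewrite mxE.
by have [_|_] := boolP (D (i, j)); apply: measurableT_comp (measurable_mx_entry i j) _.
Qed.

Variables (mu : probability 'M[R]_(m, n) R) (hmu : iid_law mu).

(** An i.i.d. matrix keeps its law when the block [D] is replaced by that of an independent copy.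
    This turns independence of functions of disjoint blocks into an instance of Fubini. *)
Lemma integral_mix_mx D (f : 'M[R]_(m, n) -> \bar R) :
  measurable_fun setT f -> (forall A, 0 <= f A)%E ->
  (\int[mu]_A f A = \int[mu]_A \int[mu]_A' f (mix_mx D A A'))%E.
Proof.
move=> mf f0.
rewrite (@mx_transfer _ _ _ _ _ (mu \x mu)%E mu _ (measurable_mix_mx D))//.
  rewrite fubini_tonelli1//; apply: measurableT_comp => //.
  exact: measurable_mix_mx.
move=> B mB.
have -> : (fun AA : 'M[R]_(m, n) * 'M[R]_(m, n) => mix_mx D AA.1 AA.2) @^-1` rect B =
    rect (fun i j => if D (i, j) then setT else B i j) `*`
    rect (fun i j => if D (i, j) then B i j else setT).
  apply/seteqP; split=> -[A A']/=.
    by move=> h; split=> i j; have := h i j; rewrite mxE; case: ifP.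
  by move=> [h h'] i j; have := h i j; have := h' i j; rewrite mxE; case: ifP.
set B1 := (fun i j => _); set B2 := (fun i j => _).
have mB1 i j : measurable (B1 i j) by rewrite /B1; case: ifP.
have mB2 i j : measurable (B2 i j) by rewrite /B2; case: ifP.
transitivity (mu (rect B1) * mu (rect B2))%E.
  by apply: product_measure1E; exact: measurable_rect.
transitivity (\big[mule/1%E]_(ij : 'I_m * 'I_n) prior (B ij.1 ij.2)); last exact/esym/hmu.
rewrite (hmu mB1) (hmu mB2) /B1 /B2.
rewrite -big_split/=; apply: eq_bigr => -[i j] _ /=.
by case: ifP => _; rewrite probability_setT ?mule1 ?mul1e.
Qed.

Lemma iid_indep D (f g : 'M[R]_(m, n) -> \bar R) :
  measurable_fun setT f -> measurable_fun setT g ->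
  (forall A, 0 <= f A)%E -> (forall A, 0 <= g A)%E ->
  depends_on (predC D) f -> depends_on D g ->
  (\int[mu]_A (f A * g A) = (\int[mu]_A f A) * (\int[mu]_A g A))%E.
Proof.
move=> mf mg f0 g0 hf hg.
rewrite (integral_mix_mx D); last 2 first.
- exact: emeasurable_funM.
- by move=> A; exact: mule_ge0.
under eq_integral => A _.
  under eq_integral => A' _.
    rewrite (hf (mix_mx D A A') A); last by move=> i j /=; rewrite mxE => /negbTE ->.
    rewrite (hg (mix_mx D A A') A'); last by move=> i j /=; rewrite mxE => ->.
    over.
  rewrite ge0_integralZl//.
  over.
by rewrite ge0_integralZr//; exact: integral_ge0.
Qed.

Lemma iid_blocks (J : eqType) (D : J -> pred ('I_m * 'I_n)) (r : seq J)
    (f : J -> 'M[R]_(m, n) -> \bar R) : uniq r ->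
  (forall j, measurable_fun setT (f j)) -> (forall j A, 0 <= f j A)%E ->
  (forall j, depends_on (D j) (f j)) ->
  (forall j j' p, j != j' -> D j p -> ~~ D j' p) ->
  (\int[mu]_A \big[mule/1]_(j <- r) f j A = \big[mule/1]_(j <- r) \int[mu]_A f j A)%E.
Proof.
move=> ur mf f0 hf hD; elim: r ur => [_|j r IH /= /andP[jr ur]].
  under eq_integral do rewrite big_nil.
  by rewrite big_nil integral_cst// mul1e; exact: probability_setT.
under eq_integral do rewrite big_cons.
rewrite big_cons -IH// muleC -(@iid_indep (D j))//.
- by apply: eq_integral => A _; rewrite muleC.
- exact: emeasurable_prod.
- by move=> A; apply: prode_ge0 => i _; exact: f0.
- move=> A A' AA'; rewrite big_seq [RHS]big_seq; apply: eq_bigr => i ir.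
  apply: hf => a b Dab; apply: AA'; apply: (hD i) => //.
  by apply: contraNneq jr => <-.
Qed.

End iid_matrix.

Definition upper {n} (p : 'I_n * 'I_n) := (p.1 <= p.2)%N.
Definition supper {n} (p : 'I_n * 'I_n) := (p.1 < p.2)%N.

(** * Gaussian symmetric matrices and the Cameron-Martin formula *)

Section wigner.
Context {R : realType} {N : nat} (w2 : R).
Hypothesis w20 : 0 < w2.
Implicit Types (A S : 'M[R]_N) (i j : 'I_N) (p q : 'I_N * 'I_N).
Implicit Types (f : 'M[R]_N -> \bar R) (B : 'I_N -> 'I_N -> set R).

Definition sdev i j : R := if i == j then Num.sqrt w2 else 1.

Lemma sdev_gt0 i j : 0 < sdev i j.
Proof. by rewrite /sdev; case: ifP => _ //; rewrite sqrtr_gt0. Qed.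

(** By symmetry the sides of a rectangle at [p] and at its mirror image constrain the same entry,
    whence the intersection. *)
Definition wigner_law (mu : probability 'M[R]_N R) :=
  forall B, (forall i j, measurable (B i j)) ->
  mu (rect B) =
  \big[mule/1%E]_(p | upper p) gauss (sdev p.1 p.2) (B p.1 p.2 `&` B p.2 p.1).

Lemma wigner_law_unique mu1 mu2 : wigner_law mu1 -> wigner_law mu2 ->
  forall E, measurable E -> mu1 E = mu2 E.
Proof.
move=> h1 h2; apply: mx_measure_unique.
  by rewrite (@le_lt_trans _ _ 1%E) ?ltry//; exact: probability_le1.
by move=> B mB; exact: etrans (h1 _ mB) (esym (h2 _ mB)).
Qed.

Definition sym_pos p q := (q == p) || (q == (p.2, p.1)).

Definition put p A (y : R) : 'M[R]_N :=
  \matrix_(a, b) if sym_pos p (a, b) then y else A a b.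

Definition bump p (t : R) : 'M[R]_N :=
  \matrix_(a, b) if sym_pos p (a, b) then t else 0.

Lemma sym_pos_upper p q : upper p -> upper q -> sym_pos p q -> q = p.
Proof.
case: p q => [a b] [c d]; rewrite /upper/= /sym_pos => ab cd /orP[/eqP//|/eqP /= cdba].
case: cdba cd => -> -> ba.
have ab' : a = b by apply/val_inj/eqP; rewrite /= eqn_leq ab.
by rewrite ab'.
Qed.

Lemma putD p A y t : put p A (y + t) = put p A y + bump p t.
Proof. by apply/matrixP => a b; rewrite !mxE; case: ifP; rewrite ?addr0. Qed.

Lemma measurable_put p :
  measurable_fun setT (fun Ay : 'M[R]_N * R => put p Ay.1 Ay.2).
Proof.
apply: measurable_mxP => i j; under eq_fun do rewrite mxE.
have [_|_] := boolP (sym_pos p (i, j)); first exact: measurable_snd.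
exact: measurableT_comp (measurable_mx_entry i j) _.
Qed.

Lemma measurable_mx_shift S : measurable_fun setT (fun A => A + S).
Proof.
apply: measurable_mxP => i j; under eq_fun do rewrite mxE.
by apply: measurable_funD => //; exact: measurable_mx_entry.
Qed.

Variables (mu : probability 'M[R]_N R) (hmu : wigner_law mu).

(** Redrawing one entry together with its mirror image preserves the law. This isolates a single
    Gaussian variable, to which the one-dimensional shift applies. *)
Lemma integral_put p f : upper p ->
  measurable_fun setT f -> (forall A, 0 <= f A)%E ->
  (\int[mu]_A f A =
   \int[mu]_A \int[gauss (sdev p.1 p.2)]_y f (put p A y))%E.
Proof.
move=> up mf f0.
rewrite (@mx_transfer _ _ _ _ _ (mu \x gauss (sdev p.1 p.2))%E mu _ (measurable_put p))//.
  rewrite fubini_tonelli1//; apply: measurableT_comp => //.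
  exact: measurable_put.
move=> B mB.
pose B1 i j := if sym_pos p (i, j) then setT else B i j.
pose B2 := B p.1 p.2 `&` B p.2 p.1.
have mB1 i j : measurable (B1 i j) by rewrite /B1; case: ifP.
have mB2 : measurable B2 by exact: measurableI.
have -> : (fun Ay : 'M[R]_N * R => put p Ay.1 Ay.2) @^-1` rect B = rect B1 `*` B2.
  apply/seteqP; split=> -[A y]/=.
    move=> h; split; first by move=> i j; have := h i j; rewrite mxE /B1; case: ifP.
    have := h p.1 p.2; have := h p.2 p.1; rewrite !mxE /sym_pos.
    by rewrite -surjective_pairing !eqxx orbT/=.
  move=> [h [y1 y2]] i j; have := h i j; rewrite mxE /B1.
  case: ifP => // /orP[/eqP ijp|/eqP[-> ->]]// _.
  by have [-> ->] : i = p.1 /\ j = p.2 by rewrite -ijp.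
transitivity (mu (rect B1) * gauss (sdev p.1 p.2) B2)%E.
  by apply: product_measure1E => //; exact: measurable_rect.
transitivity (\big[mule/1%E]_(p | upper p) gauss (sdev p.1 p.2) (B p.1 p.2 `&` B p.2 p.1));
  last exact/esym/hmu.
rewrite (hmu mB1) (bigD1 p)//= [RHS](bigD1 p)//=.
have pp : sym_pos p p by rewrite /sym_pos eqxx.
have pp' : sym_pos p (p.2, p.1) by rewrite /sym_pos eqxx orbT.
rewrite {1 2}/B1 -surjective_pairing pp pp' setIT probability_setT mul1e muleC.
congr mule; apply: eq_bigr => -[a b] /andP[/= ub qp].
have h : sym_pos p (a, b) = false.
  by apply/negP => /(sym_pos_upper up ub) /eqP; rewrite (negbTE qp).
have h' : sym_pos p (b, a) = false.
  apply: contraFF h => /orP[/eqP <-|/eqP[-> ->]].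
    by rewrite /sym_pos eqxx orbT.
  by rewrite -surjective_pairing /sym_pos eqxx.
by rewrite /B1 h h'.
Qed.

Lemma wigner_shift1 p t f : upper p ->
  measurable_fun setT f -> (forall A, 0 <= f A)%E ->
  (\int[mu]_A (f A * (expR (t * A p.1 p.2 / sdev p.1 p.2 ^+ 2
                            - t ^+ 2 / (2 * sdev p.1 p.2 ^+ 2)))%:E) =
   \int[mu]_A f (A + bump p t)%R)%E.
Proof.
move=> up mf f0.
rewrite (integral_put up); last 2 first.
- apply: emeasurable_funM => //; apply/measurable_EFinP; apply: measurableT_comp => //.
  by apply: measurable_funB => //; apply: measurable_funM => //; apply: measurable_funM => //;
    exact: measurable_mx_entry.
- by move=> A; rewrite mule_ge0// lee_fin expR_ge0.
rewrite [RHS](integral_put up)//; last first.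
  by apply: measurableT_comp => //; exact: measurable_mx_shift.
apply: eq_integral => A _.
under eq_integral => y _ do rewrite mxE /sym_pos -surjective_pairing eqxx/=.
rewrite (@gauss_shift _ _ t (fun y => f (put p A y))); first last.
- by [].
- apply: measurableT_comp => //.
  apply: measurable_mxP => i j; under eq_fun do rewrite mxE.
  by have [_|_] := boolP (sym_pos p (i, j)); [exact: measurable_id|exact: measurable_cst].
- by rewrite gt_eqF// sdev_gt0.
by apply: eq_integral => y _; rewrite putD.
Qed.

(** Inner product of the Cameron-Martin space of the noise: one term per independent entry, divided
    by its variance. *)
Definition mxip S A : R :=
  \sum_(p : 'I_N * 'I_N | upper p) S p.1 p.2 * A p.1 p.2 / sdev p.1 p.2 ^+ 2.

Lemma measurable_mxip S : measurable_fun setT (mxip S).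
Proof.
rewrite /mxip; under eq_fun do rewrite big_mkcond.
apply: measurable_sum => p; case: (upper p) => //.
by apply: measurable_funM => //; apply: measurable_funM => //; exact: measurable_mx_entry.
Qed.

Let shift_seq S (r : seq ('I_N * 'I_N)) : uniq r -> all upper r -> forall f,
  measurable_fun setT f -> (forall A, 0 <= f A)%E ->
  (\int[mu]_A (f A * (expR (\sum_(p <- r) (S p.1 p.2 * A p.1 p.2 / sdev p.1 p.2 ^+ 2
                            - S p.1 p.2 ^+ 2 / (2 * sdev p.1 p.2 ^+ 2))))%:E) =
   \int[mu]_A f (A + \sum_(p <- r) bump p (S p.1 p.2))%R)%E.
Proof.
elim: r => [_ _ f mf f0|p r IH /= /andP[pr ur] /andP[up allr] f mf f0].
  under eq_integral do rewrite big_nil expR0 mule1.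
  by under [RHS]eq_integral do rewrite big_nil addr0.
under eq_integral do rewrite big_cons expRD EFinM muleCA muleC.
have mexp : measurable_fun setT (fun A : 'M[R]_N => expR (\sum_(q <- r) (S q.1 q.2 * A q.1 q.2 / sdev q.1 q.2 ^+ 2
                            - S q.1 q.2 ^+ 2 / (2 * sdev q.1 q.2 ^+ 2)))).
  apply: measurableT_comp => //; apply: measurable_sum => q.
  apply: measurable_funB => //; apply: measurable_funM => //; apply: measurable_funM => //.
  exact: measurable_mx_entry.
rewrite (@wigner_shift1 p (S p.1 p.2) (fun A => f A * (expR (\sum_(q <- r) (S q.1 q.2 * A q.1 q.2 / sdev q.1 q.2 ^+ 2
                            - S q.1 q.2 ^+ 2 / (2 * sdev q.1 q.2 ^+ 2))))%:E)%E)//; last 2 first.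
- by apply: emeasurable_funM => //; exact/measurable_EFinP.
- by move=> A; rewrite mule_ge0// lee_fin expR_ge0.
under [RHS]eq_integral do rewrite big_cons addrA addrAC.
have mfb : measurable_fun setT (fun A => f (A + bump p (S p.1 p.2))%R).
  by apply: measurableT_comp => //; exact: measurable_mx_shift.
apply: etrans (IH ur allr _ mfb (fun A => f0 _)).
apply: eq_integral => A _; congr (_ * (expR _)%:E)%E.
(* A bump at [p] does not touch the entries listed in [r], which lie in the upper triangle and
   differ from [p]. *)
rewrite big_seq [RHS]big_seq; apply: eq_bigr => q qr.
rewrite !mxE -surjective_pairing; case: ifP; rewrite ?addr0//.
move=> /(sym_pos_upper up (allP allr _ qr)) qp.
by move: pr; rewrite -qp qr.
Qed.

Lemma sum_bump S : S^T = S -> \sum_(p | upper p) bump p (S p.1 p.2) = S.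
Proof.
move=> /matrixP sS; apply/matrixP => a b; rewrite summxE.
have [p [up pab Sp]] : exists p, [/\ upper p, sym_pos p (a, b) & S p.1 p.2 = S a b].
  have [ab|ba] := leqP a b.
    by exists (a, b); split => //; rewrite /sym_pos eqxx.
  exists (b, a); split => //=; first exact: ltnW.
    by rewrite /sym_pos eqxx orbT.
  by rewrite -sS mxE.
rewrite (bigD1 p)//= mxE pab Sp big1 ?addr0// => q /andP[uq qp].
rewrite mxE; case: ifP => // qab.
suff : q = p by move=> /eqP; rewrite (negbTE qp).
apply: sym_pos_upper => //; move: pab qab; rewrite /sym_pos.
case: (p) (q) => [p1 p2] [q1 q2] /= /orP[]/eqP[-> ->] /orP[]/eqP[-> ->]; rewrite ?eqxx ?orbT//.
Qed.

(** The upper positions are shifted one after the other; since [S] is symmetric, the bumps add up to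
    [S] and the one-dimensional weights to the exponential. *)
Lemma wigner_shift S f : S^T = S ->
  measurable_fun setT f -> (forall A, 0 <= f A)%E ->
  (\int[mu]_A (f A * (expR (mxip S A - mxip S S / 2))%:E) =
   \int[mu]_A f (A + S)%R)%E.
Proof.
move=> sS mf f0.
pose r := [seq p <- index_enum _ | @upper N p].
have := @shift_seq S r _ _ f mf f0.
rewrite filter_uniq ?index_enum_uniq// filter_all => /(_ isT isT).
rewrite /r.
under eq_integral do rewrite big_filter sumrB.
under [X in _ = X -> _]eq_integral do rewrite big_filter sum_bump//.
move=> <-; apply: eq_integral => A _; congr (_ * (expR _)%:E)%E.
rewrite /mxip; congr (_ - _); rewrite mulr_suml; apply: eq_bigr => p _.
by field; rewrite gt_eqF// sdev_gt0.
Qed.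
Lemma wigner_indep (F : 'I_N * 'I_N -> R -> \bar R) :
  (forall p, measurable_fun setT (F p)) -> (forall p y, 0 <= F p y)%E ->
  (\int[mu]_A \big[mule/1]_(p | supper p) F p (A p.1 p.2) =
   \big[mule/1]_(p | supper p) \int[gauss 1]_y F p y)%E.
Proof.
move=> mF F0; rewrite -big_filter.
under eq_integral do rewrite -big_filter.
set r := [seq p <- index_enum _ | supper p].
have ur : uniq r by rewrite filter_uniq// index_enum_uniq.
have : all supper r by rewrite filter_all.
elim: r ur => [_ _|p r IH /= /andP[pr ur] /andP[lp allr]].
  under eq_integral do rewrite big_nil.
  by rewrite big_nil integral_cst// mul1e; exact: probability_setT.
have mprod : measurable_fun setT (fun A : 'M[R]_N => \big[mule/1%E]_(q <- r) F q (A q.1 q.2)).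
  apply: emeasurable_prod => q _; apply: measurableT_comp (mF q) _.
  exact: measurable_mx_entry.
have prod0 (A : 'M[R]_N) : (0 <= \big[mule/1%E]_(q <- r) F q (A q.1 q.2))%E.
  by apply: prode_ge0 => q _; exact: F0.
have up : upper p by exact: ltnW.
under eq_integral do rewrite big_cons.
rewrite big_cons -IH// (integral_put up); last 2 first.
- apply: emeasurable_funM => //; apply: measurableT_comp (mF p) _.
  exact: measurable_mx_entry.
- by move=> A; exact: mule_ge0.
have sd : sdev p.1 p.2 = 1 by rewrite /sdev; case: eqP => // h; move: lp; rewrite /supper h ltnn.
rewrite sd.
transitivity (\int[mu]_A ((\int[gauss 1]_y F p y) * \big[mule/1]_(q <- r) F q (A q.1 q.2)))%E.
  apply: eq_integral => A _.
  rewrite -ge0_integralZr//; apply: eq_integral => y _.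
  rewrite mxE -surjective_pairing /sym_pos eqxx/=; congr mule.
  rewrite big_seq [RHS]big_seq; apply: eq_bigr => q qr.
  rewrite mxE -surjective_pairing; case: ifP => //.
  move=> /(sym_pos_upper up (ltnW (allP allr _ qr))) qp.
  by move: pr; rewrite -qp qr.
by rewrite ge0_integralZl//; exact: integral_ge0.
Qed.

End wigner.

(** * Spiked Wigner laws and likelihood ratios *)

Section model_laws.
Context {R : realType}.

Lemma iid_entries_law (d : measure_display) (Omega : measurableType d)
    (P : probability Omega R) (N k : nat) (X : {RV P >-> 'M[R]_(N, k)})
    (prior : probability R R) :
  iid_entries P X prior -> iid_law prior (distribution P X).
Proof.
move=> [Xind Xlaw] B mB.
have := Xind [set: 'I_N * 'I_k]%SET (fun ij => B ij.1 ij.2).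
move=> /(_ (subxx _) (fun ij => mB ij.1 ij.2)) h.
transitivity (P (X @^-1` rect B)) => //.
rewrite (_ : X @^-1` rect B = \bigcap_(i in [set` [set: 'I_N * 'I_k]%SET])
    ((fun omega => X omega i.1 i.2) @^-1` B i.1 i.2)); last first.
  apply/seteqP; split=> w /=; first by move=> hw i _; exact: hw.
  by move=> hw i j; apply: (hw (i, j)); rewrite /= inE.
rewrite h; under eq_bigl do rewrite inE.
by apply: eq_bigr => -[i j] _; exact: Xlaw.
Qed.

Lemma gaussian_wigner_law (d : measure_display) (Omega : measurableType d)
    (P : probability Omega R) (N : nat) (w2 : R) (W : {RV P >-> 'M[R]_N}) :
  gaussian_wigner P w2 W -> wigner_law w2 (distribution P W).
Proof.
move=> [Wsym Wind Wod Wd] B mB.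
have := Wind [set ij : 'I_N * 'I_N | (ij.1 <= ij.2)%N]%SET
  (fun ij => B ij.1 ij.2 `&` B ij.2 ij.1).
move=> /(_ (subxx _) (fun ij => measurableI _ _ (mB ij.1 ij.2) (mB ij.2 ij.1))) h.
transitivity (P (W @^-1` rect B)) => //.
rewrite (_ : W @^-1` rect B = \bigcap_(i in [set` [set ij : 'I_N * 'I_N | (ij.1 <= ij.2)%N]%SET])
    ((fun omega => W omega i.1 i.2) @^-1` (B i.1 i.2 `&` B i.2 i.1))); last first.
  have sW w i j : W w i j = W w j i by rewrite -{1}(Wsym w) mxE.
  apply/seteqP; split=> w /=.
    by move=> hw [i j] _ /=; split; [exact: hw|rewrite sW; exact: hw].
  move=> hw i j; have [ij|ji] := leqP i j.
    by have [] := hw (i, j); rewrite /= ?inE.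
  by have [] := hw (j, i); rewrite /= ?inE ?(ltnW ji)//= => _; rewrite sW.
rewrite h; under eq_bigl do rewrite inE.
apply: eq_bigr => -[i j] /= ij; rewrite /sdev /=.
have mBB := measurableI _ _ (mB i j) (mB j i).
have [eij|nij] := eqVneq i j; first by subst j; exact: (Wd i _ mBB).
by apply: (Wod i j _ _ mBB); rewrite ltn_neqAle nij.
Qed.

Lemma measurable_spiked_mx (N k : nat) (lambda : R) :
  measurable_fun setT (fun XW : 'M[R]_(N, k) * 'M[R]_N => spiked_mx lambda XW.1 XW.2).
Proof.
apply: measurable_mxP => i j; rewrite /spiked_mx; under eq_fun do rewrite !mxE.
apply: measurable_funD; last first.
  by apply: measurableT_comp (measurable_mx_entry i j) _; exact: measurable_snd.
apply: measurable_funM => //; apply: measurable_sum => l; under eq_fun do rewrite mxE.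
by apply: measurable_funM;
  apply: measurableT_comp (measurable_mx_entry _ _) _; exact: measurable_fst.
Qed.

(** Independence makes the joint law of the factor and the noise a product measure, so the sample
    space can be discarded for good in favour of two laws on matrices. *)
Lemma spiked_wigner_lawP (N k : nat) (lambda w2 : R) (prior : probability R R)
    (mu : probability 'M[R]_N R) :
  spiked_wigner_law k lambda w2 prior mu ->
  exists (muX : probability 'M[R]_(N, k) R) (mu0 : probability 'M[R]_N R),
  [/\ iid_law prior muX, wigner_law w2 mu0 &
    forall f : 'M[R]_N -> \bar R, measurable_fun setT f -> (forall A, 0 <= f A)%E ->
    (\int[mu]_A f A = \int[muX]_X \int[mu0]_W f (spiked_mx lambda X W))%E].
Proof.
case=> [dO] [Om] [P] [X] [W] [Xiid Wgauss XW Ylaw].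
exists (distribution P X), (distribution P W); split.
- exact: iid_entries_law.
- exact: gaussian_wigner_law.
move=> f mf f0.
pose XWp w := (X w, W w).
have mXW : measurable_fun setT XWp by apply/measurable_fun_pairP; split; exact: measurable_funPT.
pose S (xw : 'M[R]_(N, k) * 'M[R]_N) := spiked_mx lambda xw.1 xw.2.
have mS : measurable_fun setT S by exact: measurable_spiked_mx.
have mY : measurable_fun setT (fun w => spiked_mx lambda (X w) (W w)).
  exact: (measurableT_comp mS mXW).
transitivity (\int[P]_w f (spiked_mx lambda (X w) (W w)))%E.
  rewrite -(integral_image_law P mY mf f0); apply: eq_measure_integral => A mA _.
  exact: esym (Ylaw A mA).
have mfS : measurable_fun setT (fun xw => f (S xw)) by exact: measurableT_comp.
rewrite -(@fubini_tonelli1 _ _ _ _ _ (distribution P X) (distribution P W) (fun xw => f (S xw)))//.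
rewrite -(integral_image_law P mXW (f := fun xw => f (S xw)))//.
apply/esym/eq_measure_integral => A mA _.
apply: product_measure_unique => // B C mB mC.
Qed.

End model_laws.

(** * Replacing the prior by a bounded variable *)

Section prior.
Context {R : realType} (prior : probability R R).
Hypothesis prior_bounded : bounded_set (support_of prior).

(** A point outside the support has a null neighbourhood, hence lies in a null interval with
    rational endpoints, and there are countably many of these. *)
Lemma prior_bound : exists2 B : R, 1 <= B & prior [set x | `|x| <= B] = 1%E.
Proof.
have [M [Mreal HM]] := prior_bounded.
pose B := Num.max 1 (M + 1).
have hB x : support_of prior x -> `|x| <= B.
  by apply: (HM B); rewrite /B lt_max; apply/orP; right; rewrite ltrDl.
exists B; first by rewrite /B le_max lexx.
have mB : measurable [set x : R | `|x| <= B].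
  rewrite (_ : [set x : R | _] = `[- B, B]%classic); first exact: measurable_itv.
  by apply/seteqP; split=> x /=; rewrite in_itv/= ler_norml.
pose J (ab : rat * rat) : set R := `](ratr ab.1), (ratr ab.2)[%classic.
(* Enumerates the null rational intervals; all other indices give the empty set. *)
pose F n : set R := if unpickle n is Some ab then
  (if prior (J ab) == 0%E then J ab else set0) else set0.
have F0 n : prior.-negligible (F n).
  rewrite /F; case: unpickle => [ab|]; last exact: negligible_set0.
  case: eqP => [ab0|_]; last exact: negligible_set0.
  by exists (J ab); split => //; exact: measurable_itv.
have := negligible_bigcup F0.
have sub : ~` [set x : R | `|x| <= B] `<=` \bigcup_n F n.
  move=> x /= /negP nx.
  have : ~ support_of prior x by move=> /hB; exact/negP.
  move=> /existsNP[U /not_implyP[oU /not_implyP[Ux /negP]]].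
  rewrite -leNgt => U0.
  have /nbhs_ballP[e /= e0 eU] : nbhs x U by exact: open_nbhs_nbhs.
  have xle : x - e < x by lra.
  have ltx : x < x + e by lra.
  have [a] := rat_in_itvoo xle.
  have [b] := rat_in_itvoo ltx.
  rewrite !in_itv/= => /andP[xb bx] /andP[xa ax].
  exists (pickle (a, b)); [exact: Logic.I|rewrite /F pickleK].
  have Jab0 : prior (J (a, b)) = 0%E.
    apply/eqP; rewrite eq_le measure_ge0 andbT (le_trans _ U0)//.
    apply: le_measure; rewrite ?inE//; first exact: measurable_itv.
      exact: open_measurable.
    move=> y; rewrite /J/= in_itv/= => /andP[ay yb]; apply: eU.
    by rewrite /ball/= ltr_norml; apply/andP; split; lra.
  by rewrite Jab0 eqxx /J/= in_itv/= ax xb.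
move=> /(negligibleS sub) nS.
have h : prior (~` [set x : R | `|x| <= B]) = 0%E by apply/negligibleP => //; exact: measurableC.
have := probability_setC prior mB; rewrite h => /esym/eqP.
by rewrite sube_eq ?fin_num_measure// add0e => /eqP.
Qed.

End prior.

Section clipping.
Context {R : realType} (prior : probability R R).

Definition clip (B x : R) : R := Num.max (- B) (Num.min B x).

Lemma measurable_clip B : measurable_fun setT (clip B).
Proof.
by apply: measurable_maxr => //; apply: measurable_minr.
Qed.

Lemma clip_le B x : 0 <= B -> `|clip B x| <= B.
Proof.
move=> B0; rewrite /clip ler_norml le_max lexx/= ge_max ge_min lexx/= andbT; lra.
Qed.

Lemma clip_id B x : `|x| <= B -> clip B x = x.
Proof. by rewrite /clip ler_norml => /andP[h1 h2]; rewrite (min_idPr h2) (max_idPr h1). Qed.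

(** The support only controls the prior almost surely. Passing to [q], bounded everywhere, makes
    every later integrand over the spikes bounded, while the first two moments are kept. *)
Lemma prior_clip :
  ('E_prior[fun x : R => x] = 0)%E -> ('V_prior[fun x : R => x] = 1)%E ->
  bounded_set (support_of prior) ->
  exists (B : R) (q : R -> R), [/\ 1 <= B,
    [/\ measurable_fun setT q, (forall x, `|q x| <= B) &
        {ae prior, forall x, q x = x}],
    (\int[prior]_x (q x)%:E = 0)%E & (\int[prior]_x (q x ^+ 2)%:E = 1)%E].
Proof.
move=> E0 V1 /prior_bound [B B1 pB].
have B0 : 0 <= B by exact: le_trans B1.
have mB : measurable [set x : R | `|x| <= B].
  rewrite (_ : [set x : R | _] = `[- B, B]%classic); first exact: measurable_itv.
  by apply/seteqP; split=> x /=; rewrite in_itv/= ler_norml.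
have clip_ae : {ae prior, forall x, clip B x = x}.
  exists (~` [set x : R | `|x| <= B]); split; first exact: measurableC.
    by rewrite [LHS]probability_setC// pB subee.
  by apply: subsetC => x /=; exact: clip_id.
have mq := measurable_clip B.
exists B, (clip B); split => //.
- by split => // x; exact: clip_le.
- rewrite -E0 unlock; apply: ae_eq_integral => //; first exact/measurable_EFinP.
  by apply: filterS clip_ae => x h _; rewrite h.
- rewrite -V1 /variance unlock E0 unlock; apply: ae_eq_integral => //.
  + by apply/measurable_EFinP; exact: measurable_funX.
  + by apply/measurable_EFinP; apply: measurable_funM; apply: measurable_funB => //.
  + by apply: filterS clip_ae => x h _; rewrite h /= fctE /= subr0 expr2.
Qed.

End clipping.

(** * The error of the likelihood ratio test as an integrated minimum *)

Section neyman_pearson.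
Local Open Scope ereal_scope.
Context {d : measure_display} {T : measurableType d} {R : realType}.
Variables (P0 P1 P2 : probability T R) (l1 l2 : T -> R).
Hypotheses (ml1 : measurable_fun setT l1) (ml2 : measurable_fun setT l2).
Hypotheses (l1_gt0 : forall x, (0 < l1 x)%R) (l2_ge0 : forall x, (0 <= l2 x)%R).
Hypothesis P1E : forall A, measurable A -> P1 A = \int[P0]_(x in A) (l1 x)%:E.
Hypothesis P2E : forall A, measurable A -> P2 A = \int[P0]_(x in A) (l2 x)%:E.

Let ml1E : measurable_fun setT (fun x => (l1 x)%:E).
Proof. exact/measurable_EFinP. Qed.

Let ml2E : measurable_fun setT (fun x => (l2 x)%:E).
Proof. exact/measurable_EFinP. Qed.
(** Since [l1] is positive, a [P1]-null set is already [P0]-null. *)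
Let dom0 A : measurable A -> P1 A = 0 -> P2 A = 0.
Proof.
move=> mA P1A0.
have : \int[P0]_(x in A) `|(l1 x)%:E| = 0.
  rewrite -P1A0 P1E//; apply: eq_integral => x _.
  by rewrite gee0_abs// lee_fin ltW.
move=> /(ae_eq_integral_abs _ mA (measurable_funTS ml1E)) h.
rewrite P2E//; apply: null_set_integral => //.
  exact: measurable_funTS.
apply/negligibleP => //; apply: negligibleS h => x Ax /= /(_ Ax) [] /eqP.
by rewrite gt_eqF.
Qed.

Let dom : (charge_of_finite_measure P2) `<< P1.
Proof.
apply/null_content_dominatesP => A mA P1A0.
exact: dom0.
Qed.

Let f := likelihood_ratio P1 P2.

Let mf : measurable_fun setT f.
Proof. exact: measurable_int (Radon_Nikodym_integrable dom). Qed.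

Let fE A : measurable A -> P2 A = \int[P1]_(x in A) f x.
Proof. by move=> mA; rewrite /f /likelihood_ratio -Radon_Nikodym_integral. Qed.

Let mE : measurable [set y | f y <= 1].
Proof. by rewrite -[X in measurable X]setTI; exact: emeasurable_fun_infty_c. Qed.

Let fint A : measurable A -> P1.-integrable A f.
Proof.
by move=> mA; apply: integrableS (Radon_Nikodym_integrable dom).
Qed.

Let le_acc A : measurable A -> A `<=` [set y | f y <= 1] -> P2 A <= P1 A.
Proof.
move=> mA Af; rewrite fE// -[leRHS]mul1e -integral_cst//.
apply: le_integral => //; first exact: fint.
  by apply/finite_measure_integrable_cst.
by move=> x /[!inE] /Af.
Qed.

Let le_rej A : measurable A -> A `<=` [set y | 1 < f y] -> P1 A <= P2 A.
Proof.
move=> mA Af; rewrite fE// -[leLHS]mul1e -integral_cst//.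
apply: le_integral => //; last 2 first.
- exact: fint.
- by move=> x /[!inE] /Af/ltW.
by apply/finite_measure_integrable_cst.
Qed.

(** The Radon-Nikodym derivative is never identified with [l2 / l1]. Any acceptance region has error
    at least the integrated minimum, the region [l2 <= l1] attains it, and the region of the test
    does no worse than that one. *)
Lemma lrt_err_min : lrt_err P1 P2 = \int[P0]_x (Num.min (l1 x) (l2 x))%:E.
Proof.
set E := [set y | f y <= 1].
have EC : [set y | 1 < f y] = ~` E.
  by apply/seteqP; split=> x /=; rewrite ltNge => /negP.
have -> : lrt_err P1 P2 = P2 E + P1 (~` E) by rewrite -EC.
have min0 x : (0 <= Num.min (l1 x) (l2 x))%R by rewrite le_min l2_ge0 ltW.
have mmin : measurable_fun setT (fun x => (Num.min (l1 x) (l2 x))%:E).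
  by apply/measurable_EFinP; exact: measurable_minr.
have splitE B : measurable B -> \int[P0]_x (Num.min (l1 x) (l2 x))%:E =
    \int[P0]_(x in B) (Num.min (l1 x) (l2 x))%:E +
    \int[P0]_(x in ~` B) (Num.min (l1 x) (l2 x))%:E.
  move=> mB; rewrite -ge0_integral_setU ?setUv//; first exact: measurableC.
    by move=> x _; rewrite lee_fin.
  by apply/disj_setPS => x [].
apply/eqP; rewrite eq_le; apply/andP; split; last first.
  have lmin l : measurable_fun setT (fun x => (l x)%:E) ->
      (forall x, (Num.min (l1 x) (l2 x) <= l x)%R) -> (forall x, (0 <= l x)%R) ->
      forall B, measurable B ->
      \int[P0]_(x in B) (Num.min (l1 x) (l2 x))%:E <= \int[P0]_(x in B) (l x)%:E.
    move=> ml minl l0 B mB; apply: ge0_le_integral => //;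
      do ?[exact: measurable_funTS | by move=> x _; rewrite lee_fin].
  rewrite (splitE E)// leeD// ?P2E// ?P1E//; do ?exact: measurableC; apply: lmin => //;
    do ?[exact: measurableC | by move=> x; rewrite ge_min lexx ?orbT | by move=> x; rewrite ltW].
(* The region that attains the integrated minimum. *)
pose A := [set x | (l2 x <= l1 x)%R].
have mA : measurable A.
  rewrite -[A]setTI; exact: (measurable_fun_ler ml2 ml1 measurableT (Y := [set true])).
have -> : \int[P0]_x (Num.min (l1 x) (l2 x))%:E = P2 A + P1 (~` A).
  rewrite (splitE A)// P2E// P1E; last exact: measurableC.
  congr (_ + _); apply: eq_integral => x; rewrite inE.
    by move=> Ax; rewrite (min_idPr Ax).
  by move=> /negP; rewrite -ltNge => /ltW h; rewrite (min_idPl h).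
have cut (P : probability T R) B C : measurable B -> measurable C ->
    P B = P (B `&` C) + P (B `&` ~` C).
  move=> mB mC; rewrite -measureU//; last 3 first.
  - exact: measurableI.
  - by apply: measurableI => //; exact: measurableC.
  - by rewrite setIACA setICr setI0.
  by rewrite -setIUr setUv setIT.
have mEC := measurableC mE; have mAC := measurableC mA.
rewrite (cut P2 E A)// (cut P1 (~` E) A)// (cut P2 A E)// (cut P1 (~` A) E)//.
(* The two errors differ only where the regions disagree; there the choice made by [E] is the
   cheaper one, by the sign of [f - 1]. *)
have h1 : P2 (E `&` ~` A) <= P1 (E `&` ~` A).
  by apply: le_acc => [|x []//]; exact: measurableI.
have h2 : P1 (~` E `&` A) <= P2 (~` E `&` A).
  by apply: le_rej => [|x []]; [exact: measurableI|rewrite -EC].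
apply: le_trans (leeD (leeD (lexx _) h1) (leeD h2 (lexx _))) _.
by rewrite addeACA (setIC A E) (setIC A (~` E)) (setIC (~` A) E) (setIC (~` A) (~` E)).
Qed.

End neyman_pearson.

Section mxip_theory.
Context {R : realType} {N : nat} (w2 : R).
Hypothesis w20 : 0 < w2.
Implicit Types A B : 'M[R]_N.

Lemma mxipC A B : mxip w2 A B = mxip w2 B A.
Proof. by apply: eq_bigr => p _; rewrite (mulrC (A _ _)). Qed.

Lemma mxipDl A A' B : mxip w2 (A + A') B = mxip w2 A B + mxip w2 A' B.
Proof. by rewrite /mxip -big_split/=; apply: eq_bigr => p _; rewrite mxE !mulrDl. Qed.

Lemma mxipDr A B B' : mxip w2 A (B + B') = mxip w2 A B + mxip w2 A B'.
Proof. by rewrite mxipC mxipDl !(mxipC _ A). Qed.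

Lemma mxip0l B : mxip w2 0 B = 0.
Proof. by rewrite /mxip big1// => p _; rewrite mxE !mul0r. Qed.

Lemma mxip_suml (I : Type) (r : seq I) (F : I -> 'M[R]_N) B :
  mxip w2 (\sum_(i <- r) F i) B = \sum_(i <- r) mxip w2 (F i) B.
Proof.
by elim/big_rec2: _ => [|i y1 y2 _ <-]; [exact: mxip0l|rewrite mxipDl].
Qed.

Lemma sdev2V_ge0 (i j : 'I_N) : 0 <= (sdev w2 i j ^+ 2)^-1.
Proof. by rewrite invr_ge0 exprn_ge0// ltW// sdev_gt0. Qed.

Lemma mxip_bound A B (b : R) : (forall i j, `|A i j| <= b) ->
  `|mxip w2 A B| <= \sum_(p : 'I_N * 'I_N | upper p) b * `|B p.1 p.2| / sdev w2 p.1 p.2 ^+ 2.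
Proof.
move=> Ab; apply: le_trans (ler_norm_sum _ _ _) _; apply: ler_sum => p _.
rewrite 2!normrM; apply: ler_pM => //.
  by rewrite ler_wpM2r.
by rewrite ger0_norm// sdev2V_ge0.
Qed.

Lemma measurable_mxip2 d (T : measurableType d) (f g : T -> 'M[R]_N) :
  measurable_fun setT f -> measurable_fun setT g ->
  measurable_fun setT (fun x => mxip w2 (f x) (g x)).
Proof.
move=> mf mg; rewrite /mxip; under eq_fun do rewrite big_mkcond.
apply: measurable_sum => p; case: (upper p) => //.
apply: measurable_funM => //; apply: measurable_funM.
  exact: measurableT_comp (measurable_mx_entry _ _) mf.
exact: measurableT_comp (measurable_mx_entry _ _) mg.
Qed.

End mxip_theory.

(** * Averaged likelihood ratios and their products *)

Section likelihood.
Context {R : realType} {N : nat} (w2 : R).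
Hypothesis w20 : 0 < w2.
Context {d : measure_display} {T : measurableType d}.
Local Notation mxip := (mxip w2).
Implicit Types (S : T -> 'M[R]_N) (C : T -> R) (w : 'M[R]_N).

(** Boundedness keeps [lexp] between two positive constants for each fixed [w], which settles
    integrability over [x] and positivity of the average. *)
Definition regular S C := [/\ measurable_fun setT S,
  (forall x, (S x)^T = S x), (exists b : R, forall x i j, `|S x i j| <= b),
  measurable_fun setT C & exists c : R, forall x, `|C x| <= c].

Definition lexp S C x w : R := expR (mxip (S x) w - mxip (S x) (S x) / 2 + C x).

(** Average over [x ~ nu] of the likelihood ratio of [W + S x] with respect to
    [W], weighted by [expR (C x)] *)
Definition lik (nu : probability T R) S C w : R := \int[nu]_x lexp S C x w.

Variables (nu : probability T R) (S : T -> 'M[R]_N) (C : T -> R).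
Hypothesis SC : regular S C.

Lemma measurable_lexp : measurable_fun setT (fun xw : T * 'M[R]_N => lexp S C xw.1 xw.2).
Proof.
case: SC => mS _ _ mC _; apply: measurableT_comp => //.
have mS1 : measurable_fun setT (fun xw : T * 'M[R]_N => S xw.1) by exact: measurableT_comp.
apply: measurable_funD; last exact: measurableT_comp.
apply: measurable_funB; first exact: measurable_mxip2.
by apply: measurable_funM => //; exact: measurable_mxip2.
Qed.

Lemma measurable_lexpl w : measurable_fun setT (fun x => lexp S C x w).
Proof. exact: measurableT_comp measurable_lexp (pair2_measurable w). Qed.

Lemma lexp_bound w : exists c, forall x, expR (- c) <= lexp S C x w <= expR c.
Proof.
case: SC => _ _ [b Sb] _ [c Cc].
pose K w' : R := \sum_(p : 'I_N * 'I_N | upper p) b * `|w' p.1 p.2| / sdev w2 p.1 p.2 ^+ 2.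
pose K' : R := \sum_(p : 'I_N * 'I_N | upper p) b * `|b| / sdev w2 p.1 p.2 ^+ 2.
exists (K w + K' / 2 + c) => x; rewrite !ler_expR -ler_norml.
apply: le_trans (ler_normD _ _) _; apply: lerD => //.
apply: le_trans (ler_normB _ _) _; apply: lerD; first by apply: mxip_bound => // i j; exact: Sb.
rewrite normrM [X in _ * X]ger0_norm ?invr_ge0// ler_wpM2r ?invr_ge0//.
apply: le_trans (mxip_bound w20 _ (Sb x)) _.
apply: ler_sum => p _; rewrite ler_wpM2r ?sdev2V_ge0//.
have b0 : 0 <= b by apply: le_trans (Sb x p.1 p.2).
by rewrite ler_wpM2l// (ger0_norm b0).
Qed.

Lemma lexp_integrable w : nu.-integrable setT (fun x => (lexp S C x w)%:E).
Proof.
have [c hc] := lexp_bound w.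
apply: (@le_integrable _ _ _ _ _ measurableT _ (cst (expR c)%:E)).
- by apply/measurable_EFinP; exact: measurable_lexpl.
- move=> x _ /=; rewrite lee_fin !ger0_norm ?expR_ge0//.
  by have /andP[] := hc x.
- exact: finite_measure_integrable_cst.
Qed.

Lemma likE w : ((lik nu S C w)%:E = \int[nu]_x (lexp S C x w)%:E)%E.
Proof. by rewrite /lik fineK//; apply: integrable_fin_num => //; exact: lexp_integrable. Qed.

Lemma lik_gt0 w : 0 < lik nu S C w.
Proof.
have [c hc] := lexp_bound w.
apply: (@lt_le_trans _ _ (expR (- c))); first exact: expR_gt0.
rewrite -lee_fin likE.
have -> : (expR (- c))%:E = (\int[nu]_x (expR (- c))%:E)%E.
  by rewrite integral_prob_cst.
apply: ge0_le_integral => //.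
- by apply/measurable_EFinP; exact: measurable_lexpl.
- by move=> x _; rewrite lee_fin; have /andP[] := hc x.
Qed.

Lemma lik_ge0 w : 0 <= lik nu S C w. Proof. exact/ltW/lik_gt0. Qed.

Lemma measurable_lik : measurable_fun setT (lik nu S C).
Proof.
apply/measurable_EFinP; rewrite (_ : EFin \o _ = fun w => (\int[nu]_x (lexp S C x w)%:E)%E).
  apply: (@measurable_fun_fubini_tonelli_G _ _ _ _ _ nu (fun xw => (lexp S C xw.1 xw.2)%:E)) => //.
  - by apply/measurable_EFinP; exact: measurable_lexp.
  - by move=> x; rewrite lee_fin expR_ge0.
by apply/funext => w /=; rewrite likE.
Qed.

(** For fixed [x], [lexp] is [expR (C x)] times the Cameron-Martin weight of the shift by [S x];
    Fubini averages over [x]. *)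
Lemma integral_lik (mu0 : probability 'M[R]_N R) (f : 'M[R]_N -> \bar R) :
  wigner_law w2 mu0 -> measurable_fun setT f -> (forall w, 0 <= f w)%E ->
  (\int[mu0]_w (f w * (lik nu S C w)%:E) =
   \int[nu]_x ((expR (C x))%:E * \int[mu0]_w f (w + S x)%R))%E.
Proof.
move=> hmu mf f0; have [mS sS _ _ _] := SC.
transitivity (\int[mu0]_w \int[nu]_x (f w * (lexp S C x w)%:E))%E.
  apply: eq_integral => w _; rewrite likE ge0_integralZl//.
  - by apply/measurable_EFinP; exact: measurable_lexpl.
  - by move=> x _; rewrite lee_fin expR_ge0.
rewrite -(@fubini_tonelli _ _ _ _ _ nu mu0 (fun xw => f xw.2 * (lexp S C xw.1 xw.2)%:E)%E); last 2 first.
- apply: emeasurable_funM; first exact: measurableT_comp.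
  by apply/measurable_EFinP; exact: measurable_lexp.
- by move=> x; rewrite mule_ge0// lee_fin expR_ge0.
apply: eq_integral => x _ /=.
rewrite -(wigner_shift w20 hmu)// -ge0_integralZl//; last 2 first.
- apply: emeasurable_funM => //; apply/measurable_EFinP; apply: measurableT_comp => //.
  by apply: measurable_funB => //; exact: measurable_mxip.
- by move=> w _; rewrite mule_ge0// lee_fin expR_ge0.
by apply: eq_integral => w _; rewrite muleCA -EFinM /lexp expRD mulrC.
Qed.

Lemma integral_lik1 (mu0 : probability 'M[R]_N R) : wigner_law w2 mu0 ->
  (\int[mu0]_w (lik nu S C w)%:E = \int[nu]_x (expR (C x))%:E)%E.
Proof.
move=> hmu; have := @integral_lik mu0 (cst 1%E) hmu (measurable_cst _) (fun=> lee01).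
under eq_integral do rewrite mul1e.
move=> ->; apply: eq_integral => x _.
by rewrite integral_prob_cst mule1.
Qed.

End likelihood.

Section likelihood_product.
Context {R : realType} {N : nat} (w2 : R).
Hypothesis w20 : 0 < w2.
Context {d d' : measure_display} {T : measurableType d} {T' : measurableType d'}.
Variables (nu : probability T R) (S : T -> 'M[R]_N) (C : T -> R).
Variables (nu' : probability T' R) (S' : T' -> 'M[R]_N) (C' : T' -> R).
Hypotheses (SC : regular S C) (SC' : regular S' C').

Definition prodS (xx : T * T') : 'M[R]_N := S xx.1 + S' xx.2.
Definition prodC (xx : T * T') : R := C xx.1 + C' xx.2 + mxip w2 (S xx.1) (S' xx.2).

Lemma regular_prod : regular prodS prodC.
Proof.
case: SC => mS sS [b Sb] mC [c Cc]; case: SC' => mS' sS' [b' Sb'] mC' [c' Cc'].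
have mS1 : measurable_fun setT (fun xx : T * T' => S xx.1) by exact: measurableT_comp.
have mS2 : measurable_fun setT (fun xx : T * T' => S' xx.2) by exact: measurableT_comp.
split.
- apply: measurable_mxP => i j; under eq_fun do rewrite mxE.
  by apply: measurable_funD; apply: measurableT_comp (measurable_mx_entry i j) _.
- by move=> x; rewrite /prodS linearD/= sS sS'.
- exists (b + b') => x i j; rewrite mxE; apply: le_trans (ler_normD _ _) _.
  exact: lerD.
- apply: measurable_funD; last exact: measurable_mxip2.
  by apply: measurable_funD; exact: measurableT_comp.
- exists (c + c' + \sum_(p : 'I_N * 'I_N | upper p) b * `|b'| / sdev w2 p.1 p.2 ^+ 2) => x.
  apply: le_trans (ler_normD _ _) _; apply: lerD.
    by apply: le_trans (ler_normD _ _) _; exact: lerD.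
  apply: le_trans (mxip_bound w20 _ (Sb x.1)) _.
  apply: ler_sum => p _; rewrite ler_wpM2r ?sdev2V_ge0//.
  rewrite ler_wpM2l//; first by apply: le_trans (Sb x.1 p.1 p.2).
  by apply: le_trans (ler_norm _); exact: Sb'.
Qed.

(** Completing the square: <S,w> - |S|^2/2 + <S',w> - |S'|^2/2 equals <S+S',w> - |S+S'|^2/2 +
    <S,S'>. The cross term goes into the weight, and this is why weights [C] are carried along at
    all. *)
Lemma likM w : lik w2 nu S C w * lik w2 nu' S' C' w = lik w2 (nu \x nu')%E prodS prodC w.
Proof.
apply: EFin_inj; rewrite EFinM !likE//; last exact: regular_prod.
rewrite fubini_tonelli1//; last 2 first.
- by apply/measurable_EFinP; exact: measurable_lexpl regular_prod _.
- by move=> x; rewrite lee_fin expR_ge0.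
rewrite -(likE w20 _ SC' w) -ge0_integralZr//; last 3 first.
- by apply/measurable_EFinP; exact: measurable_lexpl.
- by move=> x _; rewrite lee_fin expR_ge0.
- by rewrite lee_fin lik_ge0.
apply: eq_integral => x _; rewrite likE// /fubini_F -ge0_integralZl//; last 3 first.
- by apply/measurable_EFinP; exact: measurable_lexpl.
- by move=> y _; rewrite lee_fin expR_ge0.
- by rewrite lee_fin expR_ge0.
apply: eq_integral => y _; rewrite -EFinM /lexp -expRD; congr (expR _)%:E.
rewrite /prodS /prodC/= !mxipDl !mxipDr (mxipC _ (S' y) (S x)); by field.
Qed.

End likelihood_product.

(** * Moments of averaged likelihood ratios *)

Section exponential_estimates.
Context {R : realType}.
Implicit Types x t a b : R.

Lemma expR_le_inv x : x < 1 -> expR x <= (1 - x)^-1.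
Proof.
move=> x1; rewrite -[leLHS]invrK -expRN lef_pV2 ?posrE ?expR_gt0 ?subr_gt0//.
exact: expR_ge1Dx.
Qed.

Lemma expR_le_quad x : x <= 1 / 2 -> expR x <= 1 + x + 2 * x ^+ 2.
Proof.
move=> x2; apply: le_trans (expR_le_inv _) _; first lra.
rewrite -[leLHS]mul1r ler_pdivrMr; last lra.
have : 0 <= x ^+ 2 * (1 - 2 * x) by rewrite mulr_ge0 ?sqr_ge0//; lra.
nra.
Qed.

(** Plays the role of Hoeffding's lemma: the linear term integrates to [0]. *)
Lemma expR_le_linD x : expR x <= x + expR (2 * x ^+ 2).
Proof.
have [x2|x2] := leP x (1 / 2).
  apply: le_trans (expR_le_quad x2) _.
  by have := expR_ge1Dx (2 * x ^+ 2); lra.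
apply: (@le_trans _ _ (expR (2 * x ^+ 2))); last by lra.
by rewrite ler_expR; nra.
Qed.

Lemma expR_abs1 x : `|x| <= 1 / 2 -> `|expR x - 1 - x| <= 2 * x ^+ 2.
Proof.
rewrite ler_norml => /andP[_ /expR_le_quad h].
by have h1 := expR_ge1Dx x; rewrite ger0_norm; lra.
Qed.

(** The derivative of the remainder is the remainder of order one, so the mean value theorem reduces
    this to [expR_abs1]. *)
Lemma expR_abs2 x : `|x| <= 1 / 2 -> `|expR x - 1 - x - x ^+ 2 / 2| <= 2 * `|x| ^+ 3.
Proof.
move=> hx.
pose f y : R := expR y - 1 - y - y ^+ 2 / 2.
pose f' y : R := expR y - 1 - y.
have df (y : R) : is_derive y (1 : R) f (f' y).
  apply: is_derive_eq; rewrite /f' /GRing.scale/=; by field.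
have cf y z : {within `[y, z], continuous f}.
  by apply: derivable_within_continuous => u _; apply: ex_derive.
have main c : `|c| <= `|x| -> `|f' c * x| <= 2 * `|x| ^+ 3.
  move=> cx; rewrite normrM exprSr mulrA ler_wpM2r//.
  apply: le_trans (expR_abs1 (le_trans cx hx)) _.
  by rewrite ler_pM2l// -(real_normK (num_real c)) ler_sqr ?nnegrE.
have f0 : f 0 = 0 by rewrite /f expR0 expr2 mul0r mul0r !subr0 subrr.
have [x0|x0|<-] := ltgtP 0 x; last first.
- by rewrite expR0 normr0 subrr subr0 !expr0n/= mul0r subr0 normr0 mulr0.
- have [c + h] := MVT x0 (fun y _ => df y) (cf _ _).
  rewrite in_itv/= => /andP[c1 c2]; move: h; rewrite f0 sub0r => h; rewrite -/(f x).
  have -> : f x = f' c * x by rewrite -[f x]opprK h sub0r mulrN opprK.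
  by apply: main; rewrite !ltr0_norm//; lra.
- have [c + h] := MVT x0 (fun y _ => df y) (cf _ _).
  rewrite in_itv/= => /andP[c1 c2]; move: h; rewrite f0 !subr0 => h; rewrite -/(f x) h.
  by apply: main; rewrite !gtr0_norm//; lra.
Qed.

(** The exponent is at most 2 A dl in size, so its cubic remainder is at most 2 (2 A dl)^3 = 16 (A
    dl)^3; the remaining 2 absorbs the terms of its square that have order 3 and 4 in [dl]. *)
Lemma expR_two_scale (A dl a b : R) : 1 <= A -> 0 <= dl -> dl * A <= 1 / 4 ->
  `|a| <= A -> `|b| <= A ->
  `|expR (dl * a + dl ^+ 2 * b) - (1 + dl * a + dl ^+ 2 * (b + a ^+ 2 / 2))|
  <= 18 * (A * dl) ^+ 3.
Proof.
move=> A1 d0 dA aA bA; set t := dl * a + dl ^+ 2 * b.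
have A0 : 0 <= A by lra.
have dle : dl <= 1 / 4 by nra.
have tA : `|t| <= 2 * (A * dl).
  apply: le_trans (ler_normD _ _) _; rewrite !normrM (ger0_norm d0) -expr2.
  have h1 : dl * `|a| <= dl * A by rewrite ler_wpM2l.
  have h2 : dl ^+ 2 * `|b| <= dl ^+ 2 * A by rewrite ler_wpM2l ?sqr_ge0.
  have : dl ^+ 2 * A <= dl * A by rewrite expr2 -mulrA ler_piMl ?mulr_ge0//; lra.
  lra.
have t2 : `|t| <= 1 / 2 by lra.
have -> : expR t - (1 + dl * a + dl ^+ 2 * (b + a ^+ 2 / 2)) =
    (expR t - 1 - t - t ^+ 2 / 2) + (dl ^+ 3 * (a * b) + dl ^+ 4 * (b ^+ 2) / 2).
  by rewrite /t; field.
apply: le_trans (ler_normD _ _) _.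
have h1 : `|expR t - 1 - t - t ^+ 2 / 2| <= 16 * (A * dl) ^+ 3.
  apply: le_trans (expR_abs2 t2) _.
  have -> : 16 * (A * dl) ^+ 3 = 2 * (2 * (A * dl)) ^+ 3 by rewrite exprMn; ring.
  rewrite ler_pM2l// lerXn2r ?nnegrE//.
  by rewrite !mulr_ge0.
have ab : `|a * b| <= A ^+ 2 by rewrite normrM expr2 ler_pM.
have bb : b ^+ 2 <= A ^+ 2 by rewrite -(real_normK (num_real b)) lerXn2r ?nnegrE.
have A23 : A ^+ 2 <= A ^+ 3 by rewrite exprS ler_peMl ?sqr_ge0.
have d3 : 0 <= dl ^+ 3 by rewrite exprn_ge0.
have d4 : 0 <= dl ^+ 4 by rewrite exprn_ge0.
have d43 : dl ^+ 4 <= dl ^+ 3 by rewrite exprS ler_piMl//; lra.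
have h2 : `|dl ^+ 3 * (a * b) + dl ^+ 4 * b ^+ 2 / 2| <= 2 * (A * dl) ^+ 3.
  apply: le_trans (ler_normD _ _) _.
  rewrite (normrM (dl ^+ 3)) (ger0_norm d3) [X in _ + X]ger0_norm; last first.
    by apply: divr_ge0 => //; apply: mulr_ge0 => //; exact: sqr_ge0.
  have e1 : dl ^+ 3 * `|a * b| <= dl ^+ 3 * A ^+ 3 by rewrite ler_wpM2l//; lra.
  have e2 : dl ^+ 4 * b ^+ 2 <= dl ^+ 3 * A ^+ 3.
    by apply: ler_pM => //; [exact: sqr_ge0|lra].
  have e3 : 0 <= dl ^+ 3 * A ^+ 3 by rewrite mulr_ge0 ?exprn_ge0.
  by rewrite exprMn (mulrC (A ^+ 3)); lra.
lra.
Qed.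

(** Both exponentials are at most 1, so no upper bound on [b] is needed. For |b| >= 1/2 each term is
    bounded separately: 2 + |b| + b^2/2 <= (16 + 4 + 1) |b|^3. *)
Lemma expRN_taylor a b : 0 <= a -> 0 <= a + b ->
  `|expR (- (a + b)) - expR (- a) * (1 - b + b ^+ 2 / 2)| <= 21 * `|b| ^+ 3.
Proof.
move=> a0 ab0.
have ea1 : expR (- a) <= 1 by rewrite -expR0 ler_expR oppr_le0.
have ea0 := expR_ge0 (- a).
have [b2|b2] := leP `|b| (1 / 2).
  rewrite opprD expRD -mulrBr normrM (ger0_norm ea0).
  have := @expR_abs2 (- b); rewrite normrN sqrrN => /(_ b2).
  have -> : expR (- b) - 1 - - b - b ^+ 2 / 2 = expR (- b) - (1 - b + b ^+ 2 / 2) by ring.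
  move=> h; apply: (@le_trans _ _ (1 * (2 * `|b| ^+ 3))).
    by rewrite ler_pM.
  by have := exprn_ge0 3 (normr_ge0 b); lra.
set n : R := `|b|; have n0 : 0 <= n by exact: normr_ge0.
have hn : 1 / 2 <= n by exact: ltW.
have pown k : (1 / 2) ^+ k <= n ^+ k by apply: lerXn2r => //; rewrite nnegrE; lra.
have bn : b ^+ 2 = n ^+ 2 by rewrite -(real_normK (num_real b)).
have e1 : 1 <= 8 * n ^+ 3.
  by have := pown 3; lra.
have e2 : n <= 4 * n ^+ 3.
  by have := ler_wpM2l n0 (pown 2); rewrite (exprS n 2); lra.
have e3 : n ^+ 2 <= 2 * n ^+ 3.
  by have := ler_wpM2l (sqr_ge0 n) hn; rewrite -exprSr; lra.
have E1 : expR (- (a + b)) <= 1 by rewrite -expR0 ler_expR oppr_le0.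
have E0 := expR_ge0 (- (a + b)).
have P : `|1 - b + b ^+ 2 / 2| <= 1 + n + n ^+ 2 / 2.
  rewrite bn; apply: le_trans (ler_normD _ _) _; rewrite (ger0_norm (_ : 0 <= n ^+ 2 / 2)).
    by rewrite lerD2r; apply: le_trans (ler_normB _ _) _; rewrite normr1.
  by rewrite divr_ge0 ?sqr_ge0.
apply: le_trans (ler_normB _ _) _; rewrite normrM (ger0_norm ea0) (ger0_norm E0).
have : expR (- a) * `|1 - b + b ^+ 2 / 2| <= 1 * (1 + n + n ^+ 2 / 2) by rewrite ler_pM.
lra.
Qed.

End exponential_estimates.

Section products.
Context {R : realType}.

(** Telescoping: the factors are exchanged one at a time, and each of the others costs at most
    [m]. *)
Lemma prod_diff_le (I : Type) (r : seq I) (a b : I -> R) (m : R) : 1 <= m ->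
  (forall i, 0 <= a i <= m) -> (forall i, 0 <= b i <= m) ->
  `|\prod_(i <- r) a i - \prod_(i <- r) b i| <=
  m ^+ size r * \sum_(i <- r) `|a i - b i|.
Proof.
move=> m1 ha hb; have m0 : 0 <= m by lra.
have prodm (c : I -> R) s : (forall i, 0 <= c i <= m) -> 0 <= \prod_(i <- s) c i <= m ^+ size s.
  move=> hc; elim: s => [|i s /andP[IH1 IH2]]; first by rewrite big_nil ler01 lexx.
  rewrite big_cons; have /andP[c0 cm] := hc i.
  by rewrite mulr_ge0//= exprS ler_pM.
elim: r => [|i r IH]; first by rewrite !big_nil subrr normr0 mulr0.
rewrite !big_cons.
have -> : a i * \prod_(j <- r) a j - b i * \prod_(j <- r) b j =
   a i * (\prod_(j <- r) a j - \prod_(j <- r) b j) + (a i - b i) * \prod_(j <- r) b j by ring.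
apply: le_trans (ler_normD _ _) _; rewrite !normrM mulrDr addrC /=.
have /andP[a0 am] := ha i; have /andP[p0 pm] := prodm b r hb.
apply: lerD.
  rewrite (ger0_norm p0) mulrC ler_wpM2r//.
  by apply: le_trans pm _; rewrite exprS ler_peMl ?exprn_ge0.
by rewrite (ger0_norm a0) exprS -mulrA ler_pM.
Qed.

End products.

Section bounded_integrals.
Context {d : measure_display} {T : measurableType d} {R : realType}.
Variable P : probability T R.
Implicit Types f g : T -> R.

Lemma bounded_integrable f (c : R) : measurable_fun setT f ->
  (forall x, `|f x| <= c) -> P.-integrable setT (EFin \o f).
Proof.
move=> mf fc; apply: (@le_integrable _ _ _ _ _ measurableT _ (cst c%:E)).
- exact/measurable_EFinP.
- move=> x _ /=; rewrite lee_fin [leRHS]ger0_norm; first exact: fc.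
  by apply: le_trans (fc x).
- exact: finite_measure_integrable_cst.
Qed.

Lemma integrable_cstR (c : R) : P.-integrable setT (EFin \o (fun=> c)).
Proof. exact: finite_measure_integrable_cst. Qed.

Lemma integrableDR f g : P.-integrable setT (EFin \o f) ->
  P.-integrable setT (EFin \o g) -> P.-integrable setT (EFin \o (fun x => f x + g x)).
Proof. by move=> intf intg; have := integrableD measurableT intf intg. Qed.

Lemma integrableBR f g : P.-integrable setT (EFin \o f) ->
  P.-integrable setT (EFin \o g) -> P.-integrable setT (EFin \o (fun x => f x - g x)).
Proof. by move=> intf intg; have := integrableB measurableT intf intg. Qed.

Lemma integrableZlR (c : R) f : P.-integrable setT (EFin \o f) ->
  P.-integrable setT (EFin \o (fun x => c * f x)).
Proof. by move=> intf; have := integrableZl measurableT c intf. Qed.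

Lemma EFin_Rintegral f : P.-integrable setT (EFin \o f) ->
  ((\int[P]_x f x)%:E = \int[P]_x (f x)%:E)%E.
Proof. by move=> intf; rewrite /Rintegral fineK//; exact: integrable_fin_num. Qed.

Lemma Rintegral_prob_cst (c : R) : \int[P]_x c = c.
Proof. by rewrite /Rintegral integral_prob_cst. Qed.

Lemma Rintegral_addc f (c : R) : P.-integrable setT (EFin \o f) ->
  \int[P]_x (f x + c) = \int[P]_x f x + c.
Proof.
move=> intf; rewrite RintegralD//; last exact: finite_measure_integrable_cst.
by rewrite Rintegral_prob_cst.
Qed.

Lemma integrable_sumR (I : Type) (r : seq I) (Q : pred I) (f : I -> T -> R) :
  (forall i, Q i -> P.-integrable setT (EFin \o f i)) ->
  P.-integrable setT (EFin \o (fun x => \sum_(i <- r | Q i) f i x)).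
Proof.
move=> intf; elim: r => [|i r IH].
  rewrite (_ : _ \o _ = cst 0%E); first exact: finite_measure_integrable_cst.
  by apply/funext => x /=; rewrite big_nil.
rewrite (_ : _ \o _ = fun x => if Q i then ((f i x)%:E + (\sum_(j <- r | Q j) f j x)%:E)%E
   else (\sum_(j <- r | Q j) f j x)%:E); last first.
  by apply/funext => x /=; rewrite big_cons; case: ifP.
by have [Qi|//] := boolP (Q i); apply: integrableD => //; exact: intf.
Qed.

Lemma Rintegral_sum (I : Type) (r : seq I) (Q : pred I) (f : I -> T -> R) :
  (forall i, Q i -> P.-integrable setT (EFin \o f i)) ->
  \int[P]_x (\sum_(i <- r | Q i) f i x) = \sum_(i <- r | Q i) \int[P]_x f i x.
Proof.
move=> intf; elim: r => [|i r IH].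
  by under eq_Rintegral do rewrite big_nil; rewrite Rintegral_prob_cst big_nil.
under eq_Rintegral do rewrite big_cons.
rewrite big_cons -IH; have [Qi|//] := boolP (Q i).
by rewrite RintegralD//; [exact: intf|exact: integrable_sumR].
Qed.

End bounded_integrals.

(** Adding the bound [c] makes [f] nonnegative, which reduces the claim to the extended-real
    version. *)
Lemma Rintegral_transfer d d' (T : measurableType d) (T' : measurableType d')
    (R : realType) (P : probability T R) (P' : probability T' R) (g : T' -> T)
    (f : T -> R) (c : R) :
  measurable_fun setT g ->
  (forall h : T -> \bar R, measurable_fun setT h -> (forall x, 0 <= h x)%E ->
    (\int[P]_x h x = \int[P']_x h (g x))%E) ->
  measurable_fun setT f -> (forall x, `|f x| <= c) ->
  \int[P]_x f x = \int[P']_x f (g x).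
Proof.
move=> mg h mf fc.
have mfg : measurable_fun setT (fun x => f (g x)) by exact: measurableT_comp.
apply: (@addIr _ c); rewrite -!Rintegral_addc; last 2 first.
- exact: bounded_integrable (fun x => fc (g x)).
- exact: bounded_integrable fc.
congr fine; apply: (h (fun x => (f x + c)%:E)).
  by apply/measurable_EFinP; exact: measurable_funD.
by move=> x; rewrite lee_fin; have := fc x; rewrite ler_norml => /andP[]; lra.
Qed.

Section iid_real.
Context {R : realType} {m n : nat} (prior : probability R R).
Variables (mu : probability 'M[R]_(m, n) R) (hmu : iid_law prior mu).

Lemma iid_indepR (D : pred ('I_m * 'I_n)) (f g : 'M[R]_(m, n) -> R) (c : R) :
  measurable_fun setT f -> measurable_fun setT g ->
  (forall A, `|f A| <= c) -> (forall A, `|g A| <= c) ->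
  depends_on (predC D) f -> depends_on D g ->
  \int[mu]_A (f A * g A) = (\int[mu]_A f A) * (\int[mu]_A g A).
Proof.
move=> mf mg fc gc hf hg.
have c0 : 0 <= c by apply: le_trans (fc 0).
have intf := bounded_integrable mu mf fc.
have intg := bounded_integrable mu mg gc.
have mfg : measurable_fun setT (fun A => f A * g A) by exact: measurable_funM.
have fgc A : `|f A * g A| <= c * c by rewrite normrM ler_pM.
have intfg := bounded_integrable mu mfg fgc.
(* Independence is stated for nonnegative functions, so both factors are raised by their bound and
   the product is expanded afterwards. *)
pose F A : R := f A + c; pose G A : R := g A + c.
have F0 A : 0 <= F A by rewrite /F; have := fc A; rewrite ler_norml => /andP[]; lra.
have G0 A : 0 <= G A by rewrite /G; have := gc A; rewrite ler_norml => /andP[]; lra.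
have mF : measurable_fun setT F by exact: measurable_funD.
have mG : measurable_fun setT G by exact: measurable_funD.
have F2 A : `|F A| <= 2 * c.
  by apply: le_trans (ler_normD _ _) _; rewrite (ger0_norm c0); have := fc A; lra.
have G2 A : `|G A| <= 2 * c.
  by apply: le_trans (ler_normD _ _) _; rewrite (ger0_norm c0); have := gc A; lra.
have intF := bounded_integrable mu mF F2.
have intG := bounded_integrable mu mG G2.
have mFG : measurable_fun setT (fun A => F A * G A) by exact: measurable_funM.
have intFG : mu.-integrable setT (EFin \o (fun A => F A * G A)).
  by apply: (bounded_integrable mu mFG (c := 2 * c * (2 * c))) => A; rewrite normrM ler_pM.
have E : \int[mu]_A (F A * G A) = (\int[mu]_A F A) * (\int[mu]_A G A).
  apply: EFin_inj; rewrite EFinM !EFin_Rintegral//.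
  under eq_integral do rewrite EFinM.
  apply: (iid_indep hmu (D := D)) => //.
  - exact/measurable_EFinP.
  - exact/measurable_EFinP.
  - by move=> A A' AA'; rewrite /F (hf _ _ AA').
  - by move=> A A' AA'; rewrite /G (hg _ _ AA').
have E1 : \int[mu]_A (F A * G A) =
    \int[mu]_A (f A * g A) + c * \int[mu]_A f A + c * \int[mu]_A g A + c * c.
  rewrite -!RintegralZl//.
  have i1 : mu.-integrable setT (EFin \o (fun A => c * f A)).
    by apply: (bounded_integrable mu (c := c * c)) => [|A]; [exact: measurable_funM|rewrite normrM (ger0_norm c0) ler_wpM2l].
  have i2 : mu.-integrable setT (EFin \o (fun A => c * g A)).
    by apply: (bounded_integrable mu (c := c * c)) => [|A]; [exact: measurable_funM|rewrite normrM (ger0_norm c0) ler_wpM2l].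
  have i12 : mu.-integrable setT (EFin \o (fun A => f A * g A + c * f A)).
    by have := integrableD measurableT intfg i1.
  have i3 : mu.-integrable setT (EFin \o (fun A => f A * g A + c * f A + c * g A)).
    by have := integrableD measurableT i12 i2.
  rewrite -!RintegralD// -Rintegral_addc//; congr fine; apply: eq_integral => A _.
  by congr EFin; rewrite /F /G; ring.
move: E; rewrite E1 !Rintegral_addc//; lra.
Qed.

Lemma iid_entry i j (h : R -> \bar R) : measurable_fun setT h -> (forall x, 0 <= h x)%E ->
  (\int[prior]_x h x = \int[mu]_A h (A i j))%E.
Proof.
move=> mh h0; rewrite -(integral_image_law mu (measurable_mx_entry i j))//.
apply: eq_measure_integral => E mE _; apply/esym.
pose B i' j' := if (i', j') == (i, j) then E else setT.
have mB i' j' : measurable (B i' j') by rewrite /B; case: ifP.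
transitivity (mu (rect B)).
  congr (mu _); apply/seteqP; split=> A /=.
    by move=> EA i' j'; rewrite /B; case: eqP => // -[-> ->].
  by move=> /(_ i j); rewrite /B eqxx.
rewrite hmu// (bigD1 (i, j))//= {1}/B eqxx big1 ?mule1// => -[i' j'] /= ij.
by rewrite /B (negbTE ij) probability_setT.
Qed.

Variables (q : R -> R) (B : R).
Hypotheses (B1 : 1 <= B) (mq : measurable_fun setT q) (qB : forall x, `|q x| <= B).
Hypothesis q1 : (\int[prior]_x (q x)%:E = 0)%E.
Hypothesis q2 : (\int[prior]_x (q x ^+ 2)%:E = 1)%E.

Lemma measurable_qentry i j : measurable_fun setT (fun A : 'M[R]_(m, n) => q (A i j)).
Proof. exact: measurableT_comp mq (measurable_mx_entry i j). Qed.

Lemma iid_q1 i j : \int[mu]_A q (A i j) = 0.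
Proof.
rewrite -(@Rintegral_transfer _ _ _ _ _ prior mu (fun A : 'M[R]_(m, n) => A i j) q B)//.
- by rewrite /Rintegral q1.
- exact: measurable_mx_entry.
- by move=> h mh h0; exact: iid_entry.
Qed.

Lemma iid_q2 i j : \int[mu]_A (q (A i j) ^+ 2) = 1.
Proof.
rewrite -(@Rintegral_transfer _ _ _ _ _ prior mu (fun A : 'M[R]_(m, n) => A i j) (fun x => q x ^+ 2) (B ^+ 2))//.
- by rewrite /Rintegral q2.
- exact: measurable_mx_entry.
- by move=> h mh h0; exact: iid_entry.
- exact: measurable_funX.
- by move=> x; rewrite normrX; apply: lerXn2r; [rewrite nnegrE|rewrite nnegrE (le_trans ler01 B1)|exact: qB].
Qed.

Definition qpair (A : 'M[R]_(m, n)) s (p : 'I_n * 'I_n) : R := q (A s p.1) * q (A s p.2).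

Lemma measurable_qpair s p : measurable_fun setT (fun A => qpair A s p).
Proof. by apply: measurable_funM; exact: measurable_qentry. Qed.

Lemma qpair_le A s p : `|qpair A s p| <= B ^+ 2.
Proof. by rewrite normrM expr2 ler_pM. Qed.

Lemma iid_qpair1 s (p : 'I_n * 'I_n) : supper p -> \int[mu]_A qpair A s p = 0.
Proof.
move=> lp; rewrite (@iid_indepR (pred1 (s, p.2)) _ _ B)//.
- by rewrite iid_q1 mul0r.
- exact: measurable_qentry.
- exact: measurable_qentry.
- move=> A A' h; congr q; apply: h => /=; rewrite xpair_eqE eqxx/=.
  by apply: contraTneq lp => pp; rewrite /supper pp ltnn.
- by move=> A A' h; congr q; apply: h => /=.
Qed.

Let iid_isolated s (e f k l : 'I_n) : e != f -> e != k -> e != l ->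
  \int[mu]_A (q (A s e) * (q (A s f) * (q (A s k) * q (A s l)))) = 0.
Proof.
move=> ef ek el.
have B0 : 0 <= B := le_trans ler01 B1.
rewrite (@iid_indepR (predC1 (s, e)) _ _ (B * (B * B)))//.
- by rewrite iid_q1 mul0r.
- exact: measurable_qentry.
- by do 2?[apply: measurable_funM; first exact: measurable_qentry]; exact: measurable_qentry.
- move=> A; apply: le_trans (qB _) _; rewrite ler_peMr//.
  by rewrite mulr_ege1.
- by move=> A; rewrite !normrM !ler_pM// mulr_ge0.
- by move=> A A' h; congr q; apply: h => /=; rewrite negbK.
- by move=> A A' h; rewrite !h //= xpair_eqE eqxx/= eq_sym.
Qed.

(** Products over pairs of distinct replicas are orthonormal: if the pairs differ, some index occurs
    exactly once among the four and its centered factor splits off. *)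
Lemma iid_qpair2 s (p r : 'I_n * 'I_n) : supper p -> supper r ->
  \int[mu]_A (qpair A s p * qpair A s r) = (p == r)%:R.
Proof.
have B0 : 0 <= B := le_trans ler01 B1.
move=> lp lr; have [<-|pr] := eqVneq p r.
  transitivity (\int[mu]_A (q (A s p.1) ^+ 2 * q (A s p.2) ^+ 2)).
    by congr fine; apply: eq_integral => A _; congr EFin; rewrite /qpair; ring.
  have qq x : `|q x ^+ 2| <= B ^+ 2 by rewrite normrX; apply: lerXn2r; [rewrite nnegrE|rewrite nnegrE (le_trans ler01 B1)|exact: qB].
  rewrite (@iid_indepR (pred1 (s, p.2)) _ _ (B ^+ 2))//.
  - by rewrite !iid_q2 mulr1.
  - by apply: measurable_funX; exact: measurable_qentry.
  - by apply: measurable_funX; exact: measurable_qentry.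
  - move=> A A' h; congr (q _ ^+ 2); apply: h => /=; rewrite xpair_eqE eqxx/=.
    by apply: contraTneq lp => pp; rewrite /supper pp ltnn.
  - by move=> A A' h; congr (q _ ^+ 2); apply: h => /=.
suff : \int[mu]_A (qpair A s p * qpair A s r) = 0 by [].
case: p r lp lr pr => [i j] [k l]; rewrite /supper/= => ij kl; rewrite xpair_eqE negb_and.
have nij : i != j by apply: contraTneq ij => ->; rewrite ltnn.
have [ik|ik] := eqVneq i k.
  subst k => /= jl; rewrite -(@iid_isolated s j i i l)//; last 2 first.
  - by rewrite eq_sym.
  - by rewrite eq_sym.
  by congr fine; apply: eq_integral => A _; congr EFin; rewrite /qpair/=; ring.
have [il|il] := eqVneq i l.
  subst l => _.
  have jk : j != k by apply: contraTneq (ltn_trans kl ij) => ->; rewrite ltnn.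
  rewrite -(@iid_isolated s j i k i)//; last 2 first.
  - by rewrite eq_sym.
  - by rewrite eq_sym.
  by congr fine; apply: eq_integral => A _; congr EFin; rewrite /qpair/=; ring.
move=> _; rewrite -(@iid_isolated s i j k l)//.
by congr fine; apply: eq_integral => A _; congr EFin; rewrite /qpair/=; ring.
Qed.

End iid_real.

Section upper_sums.
Context {V : nmodType} {n : nat}.
Implicit Types F : 'I_n * 'I_n -> V.

Lemma sum_upper F :
  \sum_(p | upper p) F p = \sum_i F (i, i) + \sum_(p | supper p) F p.
Proof.
rewrite (bigID (fun p : 'I_n * 'I_n => p.1 == p.2))/=; congr (_ + _).
  rewrite (reindex_onto (fun i => (i, i)) (fun p : 'I_n * 'I_n => p.1))/=.
    by apply: eq_bigl => i; rewrite /upper /= leqnn !eqxx.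
  by case=> [i j] /= /andP[_ /eqP ->].
apply: eq_bigl => -[i j]; rewrite /upper /supper/=.
by rewrite ltn_neqAle andbC.
Qed.

Lemma sum_pair_supper F :
  \sum_(p : 'I_n * 'I_n) F p =
  \sum_i F (i, i) + \sum_(p | supper p) (F p + F (p.2, p.1)).
Proof.
rewrite (bigID upper)/= sum_upper -addrA; congr (_ + _).
rewrite big_split/=; congr (_ + _).
rewrite (reindex_onto (fun p : 'I_n * 'I_n => (p.2, p.1)) (fun p : 'I_n * 'I_n => (p.2, p.1)))/=; last by case.
by apply: eq_bigl => -[i j]; rewrite /upper /supper/= eqxx andbT ltnNge.
Qed.

End upper_sums.

(** * Overlaps of truncated spikes *)

Section overlap.
Context {R : realType} (lam w2 : R).
Hypothesis w20 : 0 < w2.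

Definition spike {N} (n : nat) (x : 'I_N -> R) : 'M[R]_N :=
  \matrix_(a, b) if (a < n)%N && (b < n)%N
                 then Num.sqrt (lam / N%:R) * x a * x b else 0.

Definition overlap {N} n (x y : 'I_N -> R) : R := mxip w2 (spike n x) (spike n y).

Lemma spike_sym N n (x : 'I_N -> R) : (spike n x)^T = spike n x.
Proof. by apply/matrixP => a b; rewrite !mxE andbC mulrAC. Qed.

(** Truncation is a projection, so only the rows common to both spikes contribute. *)
Lemma mxip_spike N n n' (x y : 'I_N -> R) :
  mxip w2 (spike n x) (spike n' y) = overlap (minn n n') x y.
Proof.
apply: eq_bigr => p _; congr (_ / _); rewrite !mxE !leq_min.
by case: (p.1 < n)%N; case: (p.1 < n')%N; case: (p.2 < n)%N; case: (p.2 < n')%N;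
  rewrite /= ?mul0r ?mulr0.
Qed.

Hypothesis lam0 : 0 <= lam.

(** The upper triangle carries half of the squared sum, with the diagonal counted half; giving the
    diagonal its weight [1 / w2] instead produces the correction [1 / w2 - 1 / 2]. *)
Lemma overlapE N n (x y : 'I_N -> R) :
  overlap n x y = lam / N%:R * ((\sum_(a < N | (a < n)%N) x a * y a) ^+ 2 / 2
    + (w2^-1 - 2^-1) * \sum_(a < N | (a < n)%N) (x a * y a) ^+ 2).
Proof.
pose z (a : 'I_N) : R := if (a < n)%N then x a * y a else 0.
have sz (k : nat) : \sum_(a < N | (a < n)%N) (x a * y a) ^+ k.+1 = \sum_a z a ^+ k.+1.
  rewrite big_mkcond; apply: eq_bigr => a _; rewrite /z; case: ifP => // _.
  by rewrite expr0n.
have := sz 0%N; under eq_bigr do rewrite expr1.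
under [in RHS]eq_bigr do rewrite expr1.
move=> ->; rewrite sz.
have s2 : Num.sqrt (lam / N%:R) ^+ 2 = lam / N%:R by rewrite sqr_sqrtr// divr_ge0.
transitivity (\sum_(p : 'I_N * 'I_N | upper p) lam / N%:R * (z p.1 * z p.2 / sdev w2 p.1 p.2 ^+ 2)).
  apply: eq_bigr => p _; rewrite -s2 /z !mxE.
  by case: (p.1 < n)%N; case: (p.2 < n)%N => /=; ring.
rewrite -mulr_sumr; congr (_ * _); rewrite sum_upper.
have -> : \sum_(p : 'I_N * 'I_N | supper p) z p.1 * z p.2 / sdev w2 p.1 p.2 ^+ 2 =
    \sum_(p : 'I_N * 'I_N | supper p) z p.1 * z p.2.
  apply: eq_bigr => p sp; rewrite /sdev; case: eqP => [e|_]; last by rewrite expr1n divr1.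
  by move: sp; rewrite /supper e ltnn.
have -> : \sum_i z (i, i).1 * z (i, i).2 / sdev w2 (i, i).1 (i, i).2 ^+ 2 =
    w2^-1 * \sum_i z i ^+ 2.
  rewrite mulr_sumr; apply: eq_bigr => i _ /=.
  by rewrite /sdev eqxx sqr_sqrtr ?ltW// mulrC expr2.
have -> : (\sum_a z a) ^+ 2 = \sum_i z i ^+ 2 + 2 * \sum_(p : 'I_N * 'I_N | supper p) z p.1 * z p.2.
  rewrite expr2 big_distrlr/= (pair_bigA _ (fun i j => z i * z j))/= sum_pair_supper/=.
  rewrite mulr_sumr; by congr (_ + _); apply: eq_bigr => p _; ring.
by field; rewrite gt_eqF.
Qed.

End overlap.

Section ereal_products.
Context {R : realType} {I : Type}.

Lemma prod_EFin (r : seq I) (P : pred I) (f : I -> R) :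
  (\big[mule/1]_(i <- r | P i) (f i)%:E = (\prod_(i <- r | P i) f i)%:E)%E.
Proof. by elim/big_rec2: _ => // i x y _ ->; rewrite EFinM. Qed.

Lemma expR_sumP (r : seq I) (P : pred I) (f : I -> R) :
  expR (\sum_(i <- r | P i) f i) = \prod_(i <- r | P i) expR (f i).
Proof. by elim/big_rec2: _ => [|i x y _ <-]; rewrite ?expR0// expRD. Qed.

End ereal_products.

(** Linearizes the squared overlaps, using a Wigner matrix as a supply of
    independent standard Gaussian variables. *)
Lemma hubbard_stratonovich (R : realType) (K : nat) (w2 : R)
    (G : probability 'M[R]_K R) (al : 'I_K * 'I_K -> R) :
  0 < w2 -> wigner_law w2 G ->
  ((expR (\sum_(p | supper p) al p ^+ 2 / 2))%:E =
   \int[G]_w (expR (\sum_(p | supper p) al p * w p.1 p.2))%:E)%E.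
Proof.
move=> w20 hG.
pose F (p : 'I_K * 'I_K) (y : R) := (expR (al p * y - al p ^+ 2 / 2))%:E.
have mF p : measurable_fun setT (F p).
  by apply/measurable_EFinP; apply: measurableT_comp => //; apply: measurable_funB => //; exact: measurable_funM.
have F0 p y : (0 <= F p y)%E by rewrite lee_fin expR_ge0.
have := wigner_indep hG mF F0.
rewrite [X in _ = X -> _]big1; last first.
  move=> p _; have := @integral_gauss_expR R 1 (al p) (oner_neq0 _).
  by rewrite expr1n mulr1; under eq_integral do rewrite divr1.
move=> h; rewrite -[LHS]mule1 -h -ge0_integralZl//; last 2 first.
- by apply: emeasurable_prod => p _; apply: measurableT_comp (mF p) (measurable_mx_entry _ _).
- by move=> w _; exact: prode_ge0.
apply: eq_integral => w _; rewrite /F prod_EFin -EFinM -expR_sumP -expRD -big_split/=.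
by congr (expR _)%:E; apply: eq_bigr => p _; rewrite addrC subrK.
Qed.

Section site_average.
Context {R : realType} {m K : nat} (prior : probability R R).
Variables (mu : probability 'M[R]_(m, K) R) (hmu : iid_law prior mu).
Variables (q : R -> R) (B : R).
Hypotheses (B1 : 1 <= B) (mq : measurable_fun setT q) (qB : forall x, `|q x| <= B).
Hypothesis q1 : (\int[prior]_x (q x)%:E = 0)%E.
Hypothesis q2 : (\int[prior]_x (q x ^+ 2)%:E = 1)%E.
Implicit Types (D : pred ('I_K * 'I_K)) (w : 'M[R]_K) (X : 'M[R]_(m, K)) (s : 'I_m).

(** Here [D] will select the pairs of replicas whose overlap extends to row [s], and [w] is the
    auxiliary Gaussian matrix of the linearization. *)
Definition linU D w s X : R := \sum_(p | supper p && D p) w p.1 p.2 * qpair q X s p.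
Definition sqrU D s X : R := \sum_(p | supper p && D p) qpair q X s p ^+ 2.

Let B0 : 0 <= B := le_trans ler01 B1.

Definition wsum w : R := \sum_(p | supper p) `|w p.1 p.2|.
Definition wsq w : R := \sum_(p | supper p) w p.1 p.2 ^+ 2.

Lemma measurable_linU D w s : measurable_fun setT (linU D w s).
Proof.
rewrite /linU; under eq_fun do rewrite big_mkcond; apply: measurable_sum => p.
by case: (_ && _) => //; apply: measurable_funM => //; exact: measurable_qpair.
Qed.

Lemma measurable_sqrU D s : measurable_fun setT (sqrU D s).
Proof.
rewrite /sqrU; under eq_fun do rewrite big_mkcond; apply: measurable_sum => p.
by case: (_ && _) => //; apply: measurable_funX; exact: measurable_qpair.
Qed.

Lemma linU_le D w s X : `|linU D w s X| <= B ^+ 2 * wsum w.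
Proof.
apply: le_trans (ler_norm_sum _ _ _) _; rewrite mulr_sumr.
rewrite big_mkcondr/=; apply: ler_sum => p _; case: (D p); last by rewrite mulr_ge0 ?sqr_ge0.
by rewrite normrM mulrC ler_wpM2r//; exact: qpair_le.
Qed.

Lemma wsum_sqr w : wsum w ^+ 2 <= (K ^ 2)%:R * wsq w.
Proof.
have h (I : finType) (a : I -> R) : (\sum_i a i) ^+ 2 <= #|I|%:R * \sum_i a i ^+ 2.
  (* The Cauchy-Schwarz inequality in the form of a sum of squares. *)
  have dbl : \sum_i \sum_j (a i - a j) ^+ 2 =
      2 * (#|I|%:R * \sum_i a i ^+ 2) - 2 * (\sum_i a i) ^+ 2.
    transitivity (\sum_i (#|I|%:R * a i ^+ 2 + \sum_j a j ^+ 2 - 2 * (a i * \sum_j a j))).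
      apply: eq_bigr => i _.
      transitivity (\sum_j (a i ^+ 2 + a j ^+ 2 - 2 * (a i * a j))).
        by apply: eq_bigr => j _; ring.
      by rewrite sumrB big_split/= sumr_const mulr_natl -!mulr_sumr.
    by rewrite sumrB big_split/= -!mulr_sumr -mulr_suml sumr_const -mulr_natl; ring.
  have : 0 <= \sum_i \sum_j (a i - a j) ^+ 2.
    by apply: sumr_ge0 => i _; apply: sumr_ge0 => j _; exact: sqr_ge0.
  by rewrite dbl => h1; lra.
have := h _ (fun p : 'I_K * 'I_K => if supper p then `|w p.1 p.2| else 0).
rewrite card_prod card_ord mulnn -big_mkcond => /le_trans; apply.
rewrite ler_wpM2l// [leRHS]big_mkcond; apply: ler_sum => p _.
by case: ifP => _; rewrite ?expr0n// real_normK ?num_real.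
Qed.

Lemma sqrU_ge0 D s X : 0 <= sqrU D s X.
Proof. by apply: sumr_ge0 => p _; exact: sqr_ge0. Qed.

Lemma sqrU_le D s X : sqrU D s X <= (K ^ 2)%:R * B ^+ 4.
Proof.
apply: (@le_trans _ _ (\sum_(p : 'I_K * 'I_K) B ^+ 4)); last first.
  by rewrite sumr_const card_prod card_ord mulnn mulr_natl.
rewrite /sqrU big_mkcond; apply: ler_sum => p _; case: ifP => _; last by rewrite exprn_ge0.
rewrite -(real_normK (num_real _)) (_ : B ^+ 4 = (B ^+ 2) ^+ 2); last by rewrite -exprM.
by apply: lerXn2r; [rewrite nnegrE|rewrite nnegrE sqr_ge0|exact: qpair_le].
Qed.
Let int_qpair s p : mu.-integrable setT (EFin \o (fun X => qpair q X s p)).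
Proof.
by apply: (bounded_integrable mu (c := B ^+ 2)) => [|X]; [exact: measurable_qpair|exact: qpair_le].
Qed.

Let int_qpair2 s p r : mu.-integrable setT (EFin \o (fun X => qpair q X s p * qpair q X s r)).
Proof.
apply: (bounded_integrable mu (c := B ^+ 2 * B ^+ 2)) => [|X].
  by apply: measurable_funM; exact: measurable_qpair.
by rewrite normrM ler_pM// qpair_le.
Qed.

Lemma Rintegral_linU D w s : \int[mu]_X linU D w s X = 0.
Proof.
rewrite /linU Rintegral_sum; last first.
  move=> p _; apply: (bounded_integrable mu (c := `|w p.1 p.2| * B ^+ 2)) => [|X].
    by apply: measurable_funM => //; exact: measurable_qpair.
  by rewrite normrM ler_wpM2l// qpair_le.
apply: big1 => p /andP[sp _]; rewrite RintegralZl//.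
by rewrite (iid_qpair1 hmu mq qB q1)// mulr0.
Qed.

Lemma Rintegral_sqrU D s : \int[mu]_X sqrU D s X = \sum_(p | supper p && D p) 1.
Proof.
rewrite /sqrU Rintegral_sum; last by move=> p _; exact: int_qpair2.
by apply: eq_bigr => p /andP[sp _]; rewrite (iid_qpair2 hmu B1 mq qB q1 q2)// eqxx.
Qed.

Lemma Rintegral_linU2 D w s :
  \int[mu]_X (linU D w s X ^+ 2) = \sum_(p | supper p && D p) w p.1 p.2 ^+ 2.
Proof.
have -> : (fun X => linU D w s X ^+ 2) = (fun X => \sum_(p | supper p && D p)
    \sum_(r | supper r && D r) w p.1 p.2 * w r.1 r.2 * (qpair q X s p * qpair q X s r)).
  apply/funext => X; rewrite expr2 /linU big_distrlr/=; apply: eq_bigr => p _.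
  by apply: eq_bigr => r _; rewrite mulrACA.
have int2 p r : mu.-integrable setT (EFin \o
    (fun X => w p.1 p.2 * w r.1 r.2 * (qpair q X s p * qpair q X s r))).
  by have := integrableZl measurableT (w p.1 p.2 * w r.1 r.2) (int_qpair2 s p r).
rewrite Rintegral_sum; last by move=> p _; apply: integrable_sumR => r _; exact: int2.
apply: eq_bigr => p Pp; rewrite Rintegral_sum; last by move=> r _; exact: int2.
rewrite (bigD1 p)//= big1 ?addr0.
  rewrite RintegralZl// (iid_qpair2 hmu B1 mq qB q1 q2) ?eqxx ?mulr1 ?expr2//; by case/andP: Pp.
move=> r /andP[/andP[sr _] rp]; rewrite RintegralZl//.
rewrite (iid_qpair2 hmu B1 mq qB q1 q2)//; last by case/andP: Pp.
by rewrite eq_sym (negbTE rp) mulr0.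
Qed.

(** The factor contributed by row [s] after linearization of the overlaps *)
Definition site D (al be : R) w s X : R := expR (al * linU D w s X + be * sqrU D s X).

Lemma measurable_site D al be w s : measurable_fun setT (site D al be w s).
Proof.
apply: measurableT_comp => //; apply: measurable_funD; apply: measurable_funM => //.
- exact: measurable_linU.
- exact: measurable_sqrU.
Qed.

Let be_le D be s X : `|be * sqrU D s X| <= `|be| * ((K ^ 2)%:R * B ^+ 4).
Proof. by rewrite normrM (ger0_norm (sqrU_ge0 _ _ _)) ler_wpM2l// sqrU_le. Qed.

Lemma integrable_site D (al be : R) w s : mu.-integrable setT (EFin \o site D al be w s).
Proof.
apply: (bounded_integrable mu (c := expR (`|al| * (B ^+ 2 * wsum w) + `|be| * ((K ^ 2)%:R * B ^+ 4)))).
  exact: measurable_site.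
move=> X; rewrite ger0_norm ?expR_ge0// ler_expR lerD//.
  by apply: le_trans (ler_norm _) _; rewrite normrM ler_wpM2l// linU_le.
by apply: le_trans (ler_norm _) _.
Qed.

(** Sub-Gaussian bound valid for every [w]: by [expR_le_linD] the linear part contributes its mean,
    which is zero, plus an exponential of its square, and the square is bounded through
    [wsum_sqr]. *)
Lemma site_le D (al be : R) w s : \int[mu]_X site D al be w s X <=
  expR (`|be| * ((K ^ 2)%:R * B ^+ 4) + 2 * al ^+ 2 * (B ^+ 4 * ((K ^ 2)%:R * wsq w))).
Proof.
set b := `|be| * _; set a := 2 * _ * _.
have intl : mu.-integrable setT (EFin \o (fun X => al * linU D w s X)).
  apply: (bounded_integrable mu (c := `|al| * (B ^+ 2 * wsum w))) => [|X].
    by apply: measurable_funM => //; exact: measurable_linU.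
  by rewrite normrM ler_wpM2l// linU_le.
have intlin : mu.-integrable setT (EFin \o linU D w s).
  by apply: (bounded_integrable mu (c := B ^+ 2 * wsum w)) => [|X]; [exact: measurable_linU|exact: linU_le].
have intla : mu.-integrable setT (EFin \o (fun X => al * linU D w s X + expR a)).
  by have := integrableD measurableT intl (finite_measure_integrable_cst mu (expR a) measurableT).
have intr : mu.-integrable setT (EFin \o (fun X => expR b * (al * linU D w s X + expR a))).
  by have := integrableZl measurableT (expR b) intla.
apply: (@le_trans _ _ (\int[mu]_X (expR b * (al * linU D w s X + expR a)))).
  apply: le_Rintegral => //; first exact: integrable_site.
  move=> X _; rewrite /site addrC expRD; apply: ler_pM; rewrite ?expR_ge0//.
    by rewrite ler_expR; apply: le_trans (ler_norm _) _.
  apply: le_trans (expR_le_linD _) _; rewrite lerD2l ler_expR /a -mulrA ler_pM2l// exprMn ler_wpM2l ?sqr_ge0//.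
  apply: (@le_trans _ _ ((B ^+ 2 * wsum w) ^+ 2)).
    rewrite -(real_normK (num_real (linU _ _ _ _))); apply: lerXn2r; rewrite ?nnegrE//.
      by rewrite mulr_ge0 ?sqr_ge0// sumr_ge0.
    exact: linU_le.
  rewrite exprMn -exprM ler_wpM2l ?exprn_ge0//; exact: wsum_sqr.
rewrite RintegralZl// Rintegral_addc// RintegralZl// Rintegral_linU mulr0 add0r.
by rewrite -expRD.
Qed.

Lemma site_ge0 D al be w s : 0 <= \int[mu]_X site D al be w s X.
Proof. by apply: Rintegral_ge0 => X _; exact: expR_ge0. Qed.

(** The terms of order [dl] integrate to zero and those of order [dl ^+ 2] are second moments of the
    orthonormal [qpair]; the rest is bounded by [expR_two_scale]. *)
Lemma site_expansion D (al be : R) w s (A dl : R) : 1 <= A -> 0 <= dl -> dl * A <= 1 / 4 ->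
  `|al| * (B ^+ 2 * wsum w) <= A -> `|be| * ((K ^ 2)%:R * B ^+ 4) <= A ->
  `|\int[mu]_X site D (dl * al) (dl ^+ 2 * be) w s X -
    (1 + dl ^+ 2 * \sum_(p | supper p && D p) (be + al ^+ 2 * w p.1 p.2 ^+ 2 / 2))|
  <= 18 * (A * dl) ^+ 3.
Proof.
move=> A1 d0 dA hal hbe.
pose a X := al * linU D w s X; pose b X := be * sqrU D s X.
have aA X : `|a X| <= A.
  by apply: le_trans hal; rewrite normrM ler_wpM2l// linU_le.
have bA X : `|b X| <= A by apply: le_trans hbe; exact: be_le.
have ma : measurable_fun setT a by apply: measurable_funM => //; exact: measurable_linU.
have mb : measurable_fun setT b by apply: measurable_funM => //; exact: measurable_sqrU.
have inta := bounded_integrable mu ma aA.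
have intb := bounded_integrable mu mb bA.
have ma2 : measurable_fun setT (fun X => a X ^+ 2) by exact: measurable_funX.
have a2A X : `|a X ^+ 2| <= A ^+ 2.
  by rewrite normrX; apply: lerXn2r; rewrite ?nnegrE//; lra.
have inta2 := bounded_integrable mu ma2 a2A.
have inta22 : mu.-integrable setT (EFin \o (fun X => a X ^+ 2 / 2)).
  by have := integrableZr measurableT 2^-1 inta2.
have intba : mu.-integrable setT (EFin \o (fun X => b X + a X ^+ 2 / 2)).
  by have := integrableD measurableT intb inta22.
have intdba : mu.-integrable setT (EFin \o (fun X => dl ^+ 2 * (b X + a X ^+ 2 / 2))).
  by have := integrableZl measurableT (dl ^+ 2) intba.
have intda : mu.-integrable setT (EFin \o (fun X => dl * a X)).
  by have := integrableZl measurableT dl inta.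
have int1 : mu.-integrable setT (EFin \o (fun X => dl * a X + 1)).
  by have := integrableD measurableT intda (finite_measure_integrable_cst mu 1 measurableT).
have intM : mu.-integrable setT (EFin \o (fun X => dl * a X + 1 + dl ^+ 2 * (b X + a X ^+ 2 / 2))).
  by have := integrableD measurableT int1 intdba.
have E : \int[mu]_X (dl * a X + 1 + dl ^+ 2 * (b X + a X ^+ 2 / 2)) =
    1 + dl ^+ 2 * \sum_(p | supper p && D p) (be + al ^+ 2 * w p.1 p.2 ^+ 2 / 2).
  rewrite RintegralD// Rintegral_addc// RintegralZl// RintegralZl// RintegralD// RintegralZr//.
  rewrite /a /b; under [X in _ + _ * (_ + X / 2)]eq_Rintegral do rewrite exprMn.
  have il : mu.-integrable setT (EFin \o linU D w s).
    by apply: (bounded_integrable mu (c := B ^+ 2 * wsum w)) => [|X]; [exact: measurable_linU|exact: linU_le].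
  have is' : mu.-integrable setT (EFin \o sqrU D s).
    apply: (bounded_integrable mu (c := (K ^ 2)%:R * B ^+ 4)) => [|X]; first exact: measurable_sqrU.
    by rewrite ger0_norm ?sqrU_ge0// sqrU_le.
  have il2 : mu.-integrable setT (EFin \o (fun X => linU D w s X ^+ 2)).
    apply: (bounded_integrable mu (c := (B ^+ 2 * wsum w) ^+ 2)) => [|X].
      by apply: measurable_funX; exact: measurable_linU.
    rewrite normrX; apply: lerXn2r; rewrite ?nnegrE ?linU_le//.
    by rewrite mulr_ge0 ?sqr_ge0// sumr_ge0.
  rewrite !RintegralZl// Rintegral_linU Rintegral_sqrU Rintegral_linU2.
  rewrite mulr0 mulr0 add0r big_split/= -!mulr_suml -!mulr_sumr; congr (1 + _ * (_ + _)).
  by rewrite mulr_sumr; apply: eq_bigr => p _; rewrite mulr1.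
rewrite -E -RintegralB//; last exact: integrable_site.
have intS : mu.-integrable setT (EFin \o (fun X => site D (dl * al) (dl ^+ 2 * be) w s X -
    (dl * a X + 1 + dl ^+ 2 * (b X + a X ^+ 2 / 2)))).
  by have := integrableB measurableT (integrable_site D (dl * al) (dl ^+ 2 * be) w s) intM.
apply: le_trans (le_normr_Rintegral _ intS) _ => //.
rewrite -[leRHS](Rintegral_prob_cst mu); apply: le_Rintegral => //.
- by have := integrable_norm intS.
- exact: finite_measure_integrable_cst.
move=> X _; rewrite (addrC (dl * a X) 1).
have -> : site D (dl * al) (dl ^+ 2 * be) w s X = expR (dl * a X + dl ^+ 2 * b X).
  by rewrite /site /a /b !mulrA.
exact: expR_two_scale A1 d0 dA (aA X) (bA X).
Qed.

End site_average.

Lemma cvg_approx (R : realType) (a b e : nat -> R) (L : R) :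
  b @ \oo --> L -> e @ \oo --> (0 : R) ->
  (\forall N \near \oo, `|a N - b N| <= e N) -> a @ \oo --> L.
Proof.
move=> bL e0 h.
have h1 : (fun N => b N - e N) @ \oo --> L by rewrite -[L]subr0; exact: cvgB.
have h2 : (fun N => b N + e N) @ \oo --> L by rewrite -[L]addr0; exact: cvgD.
apply: squeeze_cvgr h1 h2.
by near=> N; have : `|a N - b N| <= e N by [near: N]; rewrite ler_norml; lra.
Unshelve. all: by end_near. Qed.

Lemma cvg_sumP (R : realType) (I : Type) (r : seq I) (P : pred I) (f : nat -> I -> R)
    (l : I -> R) : (forall i, P i -> f N i @[N --> \oo] --> l i) ->
  \sum_(i <- r | P i) f N i @[N --> \oo] --> \sum_(i <- r | P i) l i.
Proof.
move=> fl; elim: r => [|i r IH].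
  under eq_fun do rewrite big_nil.
  by rewrite big_nil; exact: cvg_cst.
under eq_fun do rewrite big_cons.
by rewrite big_cons; case: ifP => // Pi; apply: cvgD => //; exact: fl.
Qed.

Lemma cvg_sqrtV (R : realType) : (Num.sqrt (N%:R : R)^-1) @[N --> \oo] --> (0 : R).
Proof.
rewrite -[X in _ --> X]sqrtr0.
apply: (@continuous_cvg _ _ _ _ _ _ (@Num.sqrt R)); first exact: sqrt_continuous.
apply/gtr0_cvgV0; last exact: cvgr_idn.
by near=> N; rewrite ltr0n; near: N; exists 1%N.
Unshelve. all: by end_near. Qed.

Lemma integral_wigner_sqr (R : realType) (K : nat) (w2 : R) (G : probability 'M[R]_K R)
    (al : 'I_K * 'I_K -> R) : 0 < w2 -> wigner_law w2 G -> (forall p, supper p -> al p < 1) ->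
  (\int[G]_w (expR (\sum_(p | supper p) al p * w p.1 p.2 ^+ 2 / 2))%:E =
   (\prod_(p | supper p) (Num.sqrt (1 - al p))^-1)%:E)%E.
Proof.
move=> w20 hG al1.
pose F (p : 'I_K * 'I_K) (y : R) := (expR (al p * y ^+ 2 / 2))%:E.
have mF p : measurable_fun setT (F p).
  apply/measurable_EFinP; apply: measurableT_comp => //; apply: measurable_funM => //.
  by apply: measurable_funM.
have F0 p y : (0 <= F p y)%E by rewrite lee_fin expR_ge0.
rewrite -prod_EFin -[RHS](eq_bigr _ (fun p sp => integral_gauss_sqr (al1 p sp))).
rewrite -(wigner_indep hG mF F0); apply: eq_integral => w _.
by rewrite /F prod_EFin -expR_sumP.
Qed.

(** * Limits of the exponential moments of overlaps *)

Section moment_limit.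
Context {R : realType} (lam w2 : R).
Hypotheses (lam0 : 0 < lam) (lam1 : lam < 1) (w20 : 0 < w2).
Variables (prior : probability R R) (q : R -> R) (B : R).
Hypotheses (B1 : 1 <= B) (mq : measurable_fun setT q) (qB : forall x, `|q x| <= B).
Hypothesis q1 : (\int[prior]_x (q x)%:E = 0)%E.
Hypothesis q2 : (\int[prior]_x (q x ^+ 2)%:E = 1)%E.

Definition qcol {N K} (X : 'M[R]_(N, K)) (i : 'I_K) (a : 'I_N) : R := q (X a i).

Definition overlaps {N K} (n : 'I_K * 'I_K -> nat) (X : 'M[R]_(N, K)) : R :=
  \sum_(p | supper p) overlap lam w2 (n p) (qcol X p.1) (qcol X p.2).

(** Limiting variance of the logarithm of the rank-one likelihood ratio when the
    spike is supported on a proportion [t] of the rows *)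
Definition logV (t : R) : R := - ln (1 - lam * t) / 2 + lam * t * (w2^-1 - 2^-1).

Let c : R := w2^-1 - 2^-1.

Section fixed_size.
Context {N K : nat} (n : 'I_K * 'I_K -> nat).
Variables (mu : probability 'M[R]_(N, K) R) (G : probability 'M[R]_K R).
Hypotheses (hmu : iid_law prior mu) (hG : wigner_law w2 G).

Let D (s : 'I_N) : pred ('I_K * 'I_K) := fun p => (s < n p)%N.
Let al : R := Num.sqrt (lam / N%:R).
Let be : R := lam / N%:R * c.

Definition site_factor (w : 'M[R]_K) (s : 'I_N) : R :=
  \int[mu]_X site q (D s) al be w s X.

Let sum_linU w (X : 'M[R]_(N, K)) : \sum_s linU q (D s) w s X =
  \sum_(p | supper p) w p.1 p.2 * \sum_(s < N | (s < n p)%N) qpair q X s p.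
Proof.
under eq_bigr do rewrite /linU big_mkcondr.
rewrite exchange_big/=; apply: eq_bigr => p _.
by rewrite -big_mkcond/= -mulr_sumr.
Qed.

Let sum_sqrU (X : 'M[R]_(N, K)) : \sum_s sqrU q (D s) s X =
  \sum_(p | supper p) \sum_(s < N | (s < n p)%N) qpair q X s p ^+ 2.
Proof.
under eq_bigr do rewrite /sqrU big_mkcondr.
by rewrite exchange_big/=; apply: eq_bigr => p _; rewrite -big_mkcond.
Qed.

(** Once linearized, the exponent is a sum over rows. The rows of [X] are independent, so for each
    fixed [w] the integral over [X] factorizes. *)
Lemma integral_overlaps :
  (\int[mu]_X (expR (overlaps n X))%:E = \int[G]_w (\prod_s site_factor w s)%:E)%E.
Proof.
pose g (Xw : 'M[R]_(N, K) * 'M[R]_K) : R := \prod_s site q (D s) al be Xw.2 s Xw.1.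
have gE0 Xw : g Xw = expR (al * \sum_s linU q (D s) Xw.2 s Xw.1 + be * \sum_s sqrU q (D s) s Xw.1).
  by rewrite !mulr_sumr -big_split expR_sumP.
have gE X w : g (X, w) = expR (\sum_(p | supper p) al * (\sum_(s < N | (s < n p)%N) qpair q X s p) * w p.1 p.2) *
    expR (be * \sum_s sqrU q (D s) s X).
  rewrite gE0 expRD sum_linU mulr_sumr; congr (expR _ * _); apply: eq_bigr => p _.
  by rewrite mulrCA mulrC.
have mg : measurable_fun setT g.
  apply: (eq_measurable_fun (fun Xw => expR (al * \sum_s linU q (D s) Xw.2 s Xw.1 + be * \sum_s sqrU q (D s) s Xw.1))).
    by move=> Xw _; rewrite gE0.
  apply: measurableT_comp => //; apply: measurable_funD.
    apply: measurable_funM => //; apply: measurable_sum => s.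
    rewrite /linU; under eq_fun do rewrite big_mkcond; apply: measurable_sum => p.
    case: (_ && _) => //; apply: measurable_funM.
      by apply: measurableT_comp (measurable_mx_entry _ _) _; exact: measurable_snd.
    by apply: (measurableT_comp (measurable_qpair mq s p)); exact: measurable_fst.
  apply: measurable_funM => //; apply: measurable_sum => s.
  by apply: (measurableT_comp (measurable_sqrU mq (D s) s)); exact: measurable_fst.
have g0 Xw : 0 <= g Xw by apply: prodr_ge0 => s _; exact: expR_ge0.
transitivity (\int[mu]_X \int[G]_w (g (X, w))%:E)%E.
  apply: eq_integral => X _.
  under eq_integral do rewrite gE EFinM.
  rewrite ge0_integralZr//; last first.
    apply/measurable_EFinP; apply: measurableT_comp => //; apply: measurable_sum_cond => p _.
    by apply: measurable_funM => //; exact: measurable_mx_entry.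
  rewrite -(hubbard_stratonovich _ w20 hG) -EFinM -expRD; congr (expR _)%:E.
  rewrite /overlaps sum_sqrU mulr_sumr -big_split/=; apply: eq_bigr => p _.
  set s1 := \sum_(s < N | _) qpair q X s p; set s2 := \sum_(s < N | _) qpair q X s p ^+ 2.
  have -> : overlap lam w2 (n p) (qcol X p.1) (qcol X p.2) = lam / N%:R * (s1 ^+ 2 / 2 + c * s2).
    by apply: overlapE => //; exact: ltW.
  have al2 : al ^+ 2 = lam / N%:R by rewrite sqr_sqrtr// divr_ge0// ltW.
  by rewrite exprMn al2 /be; ring.
rewrite (@fubini_tonelli _ _ _ _ _ mu G (fun Xw => (g Xw)%:E)); last 2 first.
- exact/measurable_EFinP.
- by move=> Xw; rewrite lee_fin.
apply: eq_integral => w _; rewrite -prod_EFin.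
under eq_integral do rewrite /g/= -prod_EFin.
rewrite (iid_blocks hmu (D := fun s p => p.1 == s))//.
- by apply: eq_bigr => s _; rewrite /site_factor EFin_Rintegral//; exact: (integrable_site mu B1 mq qB).
- exact: index_enum_uniq.
- by move=> s; apply/measurable_EFinP; exact: measurable_site.
- by move=> s X; rewrite lee_fin expR_ge0.
- move=> s X X' XX'; have XE k : X s k = X' s k by apply: XX'; rewrite /= eqxx.
  have pE p : qpair q X s p = qpair q X' s p by rewrite /qpair (XE p.1) (XE p.2).
  have lE : linU q (D s) w s X = linU q (D s) w s X' by apply: eq_bigr => p _; rewrite pE.
  have sE : sqrU q (D s) s X = sqrU q (D s) s X' by apply: eq_bigr => p _; rewrite pE.
  by rewrite /site lE sE.
- by move=> s s' p ss' /eqP ->.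
Qed.

Lemma site_factor_ge0 w s : 0 <= site_factor w s.
Proof. exact: site_ge0. Qed.

Lemma measurable_site_factors : measurable_fun setT (fun w => \prod_s site_factor w s).
Proof.
apply: measurable_prod => s _; apply/measurable_EFinP.
rewrite (_ : EFin \o _ = fun w => (\int[mu]_X (site q (D s) al be w s X)%:E)%E); last first.
  apply/funext => w /=; rewrite /site_factor EFin_Rintegral//.
  exact: (integrable_site mu B1 mq qB).
apply: (@measurable_fun_fubini_tonelli_G _ _ _ _ _ mu
  (fun Xw => (site q (D s) al be Xw.2 s Xw.1)%:E)) => [|Xw]; last by rewrite lee_fin expR_ge0.
apply/measurable_EFinP; apply: measurableT_comp => //; apply: measurable_funD.
  apply: measurable_funM => //; apply: measurable_sum_cond => p _.
  apply: measurable_funM.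
    by apply: measurableT_comp (measurable_mx_entry _ _) _; exact: measurable_snd.
  by apply: (measurableT_comp (measurable_qpair mq s p)); exact: measurable_fst.
apply: measurable_funM => //.
by apply: (measurableT_comp (measurable_sqrU mq (D s) s)); exact: measurable_fst.
Qed.

(** With [al ^+ 2 = lam / N], the N bounds [site_le] multiply to an exponential independent of N.
    Its coefficient of [wsq w / 2] must be below 1 for the Gaussian integral to be finite: this is
    the origin of the smallness condition on [lam]. *)
Lemma site_factors_le w : \prod_s site_factor w s <=
  expR (lam * `|c| * ((K ^ 2)%:R * B ^+ 4) + 4 * lam * (K ^ 2)%:R * B ^+ 4 * wsq w / 2).
Proof.
set b := _ * _ * _; set a := _ / 2.
have B0 : 0 <= B := le_trans ler01 B1.
have W0 : 0 <= wsq w by apply: sumr_ge0 => p _; exact: sqr_ge0.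
have l0 : 0 <= lam by exact: ltW.
have B40 : 0 <= B ^+ 4 by exact: exprn_ge0.
have b0 : 0 <= b by rewrite !mulr_ge0.
have a0 : 0 <= a by rewrite !mulr_ge0.
apply: (@le_trans _ _ (\prod_(s < N) expR (N%:R^-1 * (b + a)))).
  apply: ler_prod => s _; rewrite site_factor_ge0/=.
  apply: le_trans (site_le hmu B1 mq qB q1 _ _ _ _ _) _.
  have lN : 0 <= lam / N%:R by rewrite divr_ge0.
  rewrite ler_expR /be /al sqr_sqrtr// normrM (ger0_norm lN) /b /a.
  move: (N%:R^-1 : R) => iN.
  by rewrite le_eqVlt; apply/orP; left; apply/eqP; field.
rewrite -expR_sumP sumr_const card_ord ler_expR -mulrnAl -(mulr_natr N%:R^-1).
have [->|N0] := posnP N; first by rewrite mulr0 mul0r addr_ge0.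
by rewrite mulVf ?mul1r// pnatr_eq0 -lt0n.
Qed.

(** Each row errs by 18 (A dl)^3 in its expansion and by 2 (A dl)^3 in replacing 1 + x by exp x,
    where dl = N^(-1/2); the N rows together err by 20 A^3 dl. *)
Lemma site_factors_approx w (A : R) : (0 < N)%N -> 1 <= A ->
  Num.sqrt (N%:R^-1) * A <= 1 / 4 ->
  `|Num.sqrt lam| * (B ^+ 2 * wsum w) <= A ->
  `|lam * c| * ((K ^ 2)%:R * B ^+ 4) <= A ->
  \sum_(p | supper p) `|lam * c + lam * w p.1 p.2 ^+ 2 / 2| <= A ->
  (forall p, supper p -> (n p <= N)%N) ->
  `|\prod_s site_factor w s -
    expR (\sum_(p | supper p) (n p)%:R / N%:R * (lam * c + lam * w p.1 p.2 ^+ 2 / 2))|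
  <= expR (A + 18 * A ^+ 3) * (20 * A ^+ 3 * Num.sqrt (N%:R^-1)).
Proof.
move=> N0 A1 dA hal hbe hrho nN.
set dl := Num.sqrt (N%:R^-1) in dA *.
have d0 : 0 <= dl by exact: sqrtr_ge0.
have N0R : (0 : R) < N%:R by rewrite ltr0n.
have d2 : dl ^+ 2 = N%:R^-1 by rewrite sqr_sqrtr// invr_ge0 ltW.
have Nd2 : dl ^+ 2 *+ N = 1 by rewrite d2 -mulr_natr mulVf// gt_eqF.
have alE : al = dl * Num.sqrt lam.
  by rewrite /al sqrtrM ?ltW// mulrC.
have beE : be = dl ^+ 2 * (lam * c) by rewrite /be d2; ring.
pose rho (p : 'I_K * 'I_K) : R := lam * c + lam * w p.1 p.2 ^+ 2 / 2.
pose ka (s : 'I_N) : R := \sum_(p | supper p && D s p) rho p.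
have kaA s : `|ka s| <= A.
  apply: le_trans hrho; apply: le_trans (ler_norm_sum _ _ _) _.
  by rewrite big_mkcondr/=; apply: ler_sum => p _; case: ifP.
have l2 : Num.sqrt lam ^+ 2 = lam by rewrite sqr_sqrtr// ltW.
have h1 s : `|site_factor w s - (1 + dl ^+ 2 * ka s)| <= 18 * (A * dl) ^+ 3.
  rewrite /site_factor alE beE.
  have := site_expansion hmu B1 mq qB q1 q2 (D s) s A1 d0 dA hal hbe.
  by rewrite l2.
have A0 : 0 <= A by lra.
have dl1 : dl <= 1 / 4 by nra.
have dA0 : 0 <= A * dl by rewrite mulr_ge0.
have d2A : dl ^+ 2 * A <= 1 / 4.
  by apply: le_trans dA; rewrite expr2 -mulrA ler_piMl ?mulr_ge0//; lra.
have dk s : `|dl ^+ 2 * ka s| <= dl ^+ 2 * A.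
  by rewrite normrM ger0_norm ?sqr_ge0// ler_wpM2l ?sqr_ge0.
have h2 s : `|expR (dl ^+ 2 * ka s) - (1 + dl ^+ 2 * ka s)| <= 2 * (A * dl) ^+ 3.
  rewrite opprD addrA; apply: le_trans (expR_abs1 _) _.
    by apply: le_trans (dk s) _; lra.
  rewrite ler_pM2l// -(real_normK (num_real _)).
  apply: (@le_trans _ _ ((dl ^+ 2 * A) ^+ 2)).
    by apply: lerXn2r; rewrite ?nnegrE// mulr_ge0// sqr_ge0.
  have -> : (dl ^+ 2 * A) ^+ 2 = (A ^+ 2 * dl ^+ 3) * dl by ring.
  have -> : (A * dl) ^+ 3 = (A ^+ 2 * dl ^+ 3) * A by ring.
  by rewrite ler_wpM2l//; [rewrite mulr_ge0 ?exprn_ge0|lra].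
(* Chosen so that both kinds of factors are at most [expR (dl ^+ 2 * M)], whose N-th power is
   [expR M]. *)
pose M : R := A + 18 * A ^+ 3.
have M0 : 0 <= M by rewrite addr_ge0// mulr_ge0// exprn_ge0.
have dAM : dl ^+ 2 * A + 18 * (A * dl) ^+ 3 <= dl ^+ 2 * M.
  have -> : dl ^+ 2 * M = dl ^+ 2 * A + 18 * (A ^+ 3 * dl ^+ 2) by rewrite /M; ring.
  have -> : (A * dl) ^+ 3 = (A ^+ 3 * dl ^+ 2) * dl by ring.
  rewrite lerD2l ler_pM2l// ler_piMr//; last lra.
  by rewrite mulr_ge0 ?exprn_ge0.
have up1 s : site_factor w s <= expR (dl ^+ 2 * M).
  apply: le_trans (expR_ge1Dx _).
  have := h1 s; have := dk s; rewrite !ler_norml; lra.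
have up2 s : expR (dl ^+ 2 * ka s) <= expR (dl ^+ 2 * M).
  rewrite ler_expR; apply: le_trans (ler_norm _) _; apply: le_trans (dk s) _.
  by apply: le_trans dAM; rewrite lerDl mulr_ge0// exprn_ge0.
have -> : expR (\sum_(p | supper p) (n p)%:R / N%:R * (lam * c + lam * w p.1 p.2 ^+ 2 / 2)) =
    \prod_s expR (dl ^+ 2 * ka s).
  (* After exchanging the sums over rows and over pairs, the pair [p] is counted once for each row
     below its level, that is [n p] times. *)
  rewrite -expR_sumP; congr expR; rewrite -mulr_sumr /ka.
  under [in RHS]eq_bigr do rewrite big_mkcondr.
  rewrite exchange_big/= mulr_sumr; apply: eq_bigr => p sp.
  rewrite -big_mkcond/= -(big_ord_widen N (fun=> rho p) (nN p sp)) sumr_const card_ord d2.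
  by rewrite -(mulr_natl (rho p)) /rho; ring.
apply: le_trans (prod_diff_le _ (m := expR (dl ^+ 2 * M)) _ _ _) _.
- by rewrite -expR0 ler_expR mulr_ge0// sqr_ge0.
- by move=> s; rewrite site_factor_ge0 up1.
- by move=> s; rewrite expR_ge0 up2.
have -> : size (index_enum 'I_N) = N by rewrite -sum1_size sum1_card card_ord.
have -> : expR (dl ^+ 2 * M) ^+ N = expR M.
  by rewrite -expRM_natl mulrA mulr_natl Nd2 mul1r.
rewrite ler_pM2l ?expR_gt0//.
apply: (@le_trans _ _ (\sum_(s < N) 20 * (A * dl) ^+ 3)).
  apply: ler_sum => s _.
  have -> : site_factor w s - expR (dl ^+ 2 * ka s) = (site_factor w s - (1 + dl ^+ 2 * ka s))
     - (expR (dl ^+ 2 * ka s) - (1 + dl ^+ 2 * ka s)) by ring.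
  apply: le_trans (ler_normB _ _) _; have := h1 s; have := h2 s; lra.
rewrite sumr_const card_ord -(mulr_natl (20 * _)).
have -> : N%:R * (20 * (A * dl) ^+ 3) = (N%:R * dl ^+ 2) * (20 * A ^+ 3 * dl) by ring.
by rewrite mulr_natl Nd2 mul1r.
Qed.

End fixed_size.

Lemma expR_logV (t : R) : lam * t < 1 ->
  expR (logV t) = expR (lam * t * c) * (Num.sqrt (1 - lam * t))^-1.
Proof.
move=> lt1; rewrite /logV addrC expRD mulNr expRN; congr (_ * _^-1).
have e : expR (ln (1 - lam * t) / 2) ^+ 2 = 1 - lam * t.
  by rewrite -expRM_natl [2%:R * _]mulrC divfK ?pnatr_eq0// lnK// posrE subr_gt0.
by rewrite -[in RHS]e sqrtr_sqr ger0_norm// expR_ge0.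
Qed.

(** Dominated convergence in the auxiliary matrix [w]: in the limit each pair of replicas
    contributes the independent factor E exp(lam t (c + g^2/2)), with g standard Gaussian, which is
    [expR (logV t)]. *)
Theorem moment_limit K (mu : forall N, probability 'M[R]_(N, K) R)
    (G : probability 'M[R]_K R) (n : nat -> 'I_K * 'I_K -> nat) (t : 'I_K * 'I_K -> R) :
  (forall N, iid_law prior (mu N)) -> wigner_law w2 G ->
  4 * lam * (K ^ 2)%:R * B ^+ 4 < 1 ->
  (forall N p, supper p -> (n N p <= N)%N) ->
  (forall p, supper p -> (n N p)%:R / N%:R @[N --> \oo] --> t p) ->
  (\int[mu N]_X (expR (overlaps (n N) X))%:E @[N --> \oo] -->
    (expR (\sum_(p | supper p) logV (t p)))%:E)%E.
Proof.
move=> hmu hG small nN nt.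
set al := 4 * lam * _ * _ in small.
(* At [N = 0] the quotient is 0 by convention. *)
have nN1 N p : supper p -> (n N p)%:R / N%:R <= 1 :> R.
  move=> sp; have [->|N0] := posnP N; first by rewrite invr0 mulr0.
  by rewrite ler_pdivrMr ?ltr0n// mul1r ler_nat nN.
have t1 p : supper p -> t p <= 1.
  move=> sp; apply: (ler_cvg_to (nt p sp) (cvg_cst (1 : R))); apply: nearW => N; exact: nN1.
have lt1 p : supper p -> lam * t p < 1.
  by move=> sp; apply: le_lt_trans lam1; rewrite ler_piMr ?t1// ltW.
pose r (w : 'M[R]_K) p : R := lam * c + lam * w p.1 p.2 ^+ 2 / 2.
pose f (w : 'M[R]_K) : R := expR (\sum_(p | supper p) t p * r w p).
pose b : R := lam * `|c| * ((K ^ 2)%:R * B ^+ 4).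
pose g (w : 'M[R]_K) : R := expR (b + al * wsq w / 2).
pose h N (w : 'M[R]_K) : R := \prod_s site_factor (n N) (mu N) w s.
have mr p : measurable_fun setT (fun w => r w p).
  apply: measurable_funD => //; apply: measurable_funM => //; apply: measurable_funM => //.
  by apply: measurable_funX; exact: measurable_mx_entry.
have mf : measurable_fun setT f.
  by apply: measurableT_comp => //; apply: measurable_sum_cond => p _; exact: measurable_funM.
have mh N : measurable_fun setT (h N).
  exact: (measurable_site_factors (n N) (mu N)).
have hf w : h N w @[N --> \oo] --> f w.
  (* The sum of all the lower bounds that [site_factors_approx] imposes on its constant; it depends
     on [w] but not on [N]. *)
  pose A : R := 1 + `|Num.sqrt lam| * (B ^+ 2 * wsum w) + `|lam * c| * ((K ^ 2)%:R * B ^+ 4)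
    + \sum_(p | supper p) `|r w p|.
  have B0 : 0 <= B := le_trans ler01 B1.
  have x1 : 0 <= `|Num.sqrt lam| * (B ^+ 2 * wsum w).
    by rewrite !mulr_ge0 ?exprn_ge0// sumr_ge0.
  have x2 : 0 <= `|lam * c| * ((K ^ 2)%:R * B ^+ 4) by rewrite !mulr_ge0 ?exprn_ge0.
  have x3 : 0 <= \sum_(p | supper p) `|r w p| by rewrite sumr_ge0.
  have A1 : 1 <= A by rewrite /A; lra.
  apply: (cvg_approx (b := fun N => expR (\sum_(p | supper p) (n N p)%:R / N%:R * r w p))
    (e := fun N => expR (A + 18 * A ^+ 3) * (20 * A ^+ 3 * Num.sqrt (N%:R^-1)))).
  - apply: continuous_cvg; first exact: continuous_expR.
    apply: cvg_sumP => p sp; apply: cvgMl; exact: nt.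
  - rewrite -[X in _ --> X](mulr0 (expR (A + 18 * A ^+ 3))); apply: cvgMr.
    rewrite -[X in _ --> X](mulr0 (20 * A ^+ 3)); apply: cvgMr; exact: cvg_sqrtV.
  - have : Num.sqrt (N%:R^-1) * A @[N --> \oo] --> (0 : R).
      by rewrite -[X in _ --> X](mul0r A); apply: cvgMl; exact: cvg_sqrtV.
    move=> /cvgr_le /(_ (1 / 4)) hA.
    near=> N; apply: site_factors_approx => //; rewrite ?/A; try lra.
    + by near: N; exists 1%N.
    + by near: N; apply: hA; lra.
    + exact: nN.
have fg N w : h N w <= g w by exact: site_factors_le.
have mwsq : measurable_fun setT (fun w : 'M[R]_K => wsq w).
  by apply: measurable_sum_cond => p _; apply: measurable_funX; exact: measurable_mx_entry.
have expR_wsq x : (\int[G]_w (expR (x + al * wsq w / 2))%:E =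
    (expR x)%:E * \int[G]_w (expR (\sum_(p | supper p) al * w p.1 p.2 ^+ 2 / 2))%:E)%E.
  rewrite -ge0_integralZl//.
  - apply: eq_integral => w _; rewrite -EFinM -expRD /wsq mulr_sumr mulr_suml.
    by congr (expR _)%:E.
  - apply/measurable_EFinP; apply: measurableT_comp => //; apply: measurable_sum_cond => p _.
    apply: measurable_funM => //; apply: measurable_funM => //.
    by apply: measurable_funX; exact: measurable_mx_entry.
have mg : measurable_fun setT g.
  apply: measurableT_comp => //; apply: measurable_funD => //.
  by apply: measurable_funM => //; exact: measurable_funM.
have Gg : G.-integrable setT (EFin \o g).
  apply/integrableP; split; first exact/measurable_EFinP.
  under eq_integral do rewrite /= ger0_norm ?expR_ge0//.
  by rewrite expR_wsq (integral_wigner_sqr w20 hG)// -EFinM ltry.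
have hfE : {ae G, forall w, setT w -> (EFin \o h N) w @[N --> \oo] --> (EFin \o f) w}.
  by apply: aeW => w _; apply/fine_cvgP; split; [exact: nearW|exact: hf].
have fgE : {ae G, forall w N, setT w -> (`|(EFin \o h N) w| <= (EFin \o g) w)%E}.
  have h0 N w : 0 <= h N w by apply: prodr_ge0 => s _; exact: site_factor_ge0.
  apply: aeW => w N _.
  have : (`|(h N w)%:E| <= (g w)%:E)%E by rewrite gee0_abs lee_fin.
  exact.
have [_ _] := dominated_convergence measurableT (fun N => proj2 (measurable_EFinP _ _) (mh N))
  (proj2 (measurable_EFinP _ _) mf) hfE Gg fgE.
have <- : (\int[G]_w (f w)%:E = (expR (\sum_(p | supper p) logV (t p)))%:E)%E.
  rewrite expR_sumP (eq_bigr _ (fun p sp => expR_logV (lt1 p sp))) big_split/= EFinM.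
  rewrite -(integral_wigner_sqr w20 hG lt1) -ge0_integralZl//.
  - apply: eq_integral => w _; rewrite -EFinM -expR_sumP -expRD -big_split/=.
    by congr (expR _)%:E; apply: eq_bigr => p _; rewrite /r; field.
  - apply/measurable_EFinP; apply: measurableT_comp => //; apply: measurable_sum_cond => p _.
    apply: measurable_funM => //; apply: measurable_funM => //.
    by apply: measurable_funX; exact: measurable_mx_entry.
  - by rewrite lee_fin prodr_ge0// => p _; exact: expR_ge0.
by under eq_fun do rewrite -(integral_overlaps _ (hmu _) hG).
Unshelve. all: by end_near. Qed.

End moment_limit.

Section row_mx_law.
Context {R : realType} (prior : probability R R) {m n n' : nat}.
Variables (mu : probability 'M[R]_(m, n) R) (mu' : probability 'M[R]_(m, n') R).
Hypotheses (hmu : iid_law prior mu) (hmu' : iid_law prior mu').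

Lemma measurable_row_mx :
  measurable_fun setT (fun XX : 'M[R]_(m, n) * 'M[R]_(m, n') => row_mx XX.1 XX.2).
Proof.
apply: measurable_mxP => i j; under eq_fun do rewrite mxE.
by case: (fintype.split j) => k; apply: measurableT_comp (measurable_mx_entry i k) _.
Qed.

Lemma row_mx_rect (B : 'I_m -> 'I_(n + n') -> set R) : (forall i j, measurable (B i j)) ->
  (mu \x mu')%E ((fun XX => row_mx XX.1 XX.2) @^-1` rect B) =
  \big[mule/1%E]_(ij : 'I_m * 'I_(n + n')) prior (B ij.1 ij.2).
Proof.
move=> mB.
have -> : (fun XX : 'M[R]_(m, n) * 'M[R]_(m, n') => row_mx XX.1 XX.2) @^-1` rect B =
    rect (fun i j => B i (lshift n' j)) `*` rect (fun i j => B i (rshift n j)).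
  apply/seteqP; split=> -[X X']/=.
    move=> h; split=> i j.
      by have := h i (lshift n' j); rewrite row_mxEl.
    by have := h i (rshift n j); rewrite row_mxEr.
  move=> [h h'] i j; rewrite -[j]splitK mxE unsplitK.
  by case: (fintype.split j) => k /=; [exact: h|exact: h'].
transitivity (mu (rect (fun i j => B i (lshift n' j))) * mu' (rect (fun i j => B i (rshift n j))))%E.
  by apply: product_measure1E; exact: measurable_rect.
rewrite (hmu (B := fun i j => B i (lshift n' j)))// (hmu' (B := fun i j => B i (rshift n j)))//.
rewrite -(pair_bigA _ (fun i j => prior (B i j)))/=.
rewrite -(pair_bigA _ (fun i j => prior (B i (lshift n' j))))/=.
rewrite -(pair_bigA _ (fun i j => prior (B i (rshift n j))))/= -big_split/=.
by apply: eq_bigr => i _; rewrite big_split_ord.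
Qed.

Lemma iid_row_mx : iid_law prior (image_law (mu \x mu')%E measurable_row_mx).
Proof. by move=> B mB; exact: etrans (row_mx_rect mB). Qed.

Lemma integral_row_mx (nu : probability 'M[R]_(m, n + n') R) (f : 'M[R]_(m, n + n') -> \bar R) :
  iid_law prior nu -> measurable_fun setT f -> (forall A, 0 <= f A)%E ->
  (\int[nu]_X f X = \int[mu \x mu']_XX f (row_mx XX.1 XX.2))%E.
Proof.
move=> hnu mf f0; apply: (mx_transfer measurable_row_mx) => // B mB.
exact: etrans (row_mx_rect mB) (esym (hnu _ mB)).
Qed.

End row_mx_law.

Section split_sums.
Context {V : nmodType} {n n' : nat}.

Lemma sum_supper_split (F : 'I_(n + n') * 'I_(n + n') -> V) :
  \sum_(p | supper p) F p =
  \sum_(p | supper p) F (lshift n' p.1, lshift n' p.2) +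
  \sum_(p | supper p) F (rshift n p.1, rshift n p.2) +
  \sum_i \sum_j F (lshift n' i, rshift n j).
Proof.
have pairs k (H : 'I_k * 'I_k -> V) : \sum_(p | supper p) H p =
      \sum_(i < k) \sum_(j < k | (i < j)%N) H (i, j).
  by rewrite pair_big_dep; apply: eq_big => -[].
rewrite !pairs big_split_ord/=.
under eq_bigr => i _.
  rewrite big_split_ord/=.
  rewrite [X in _ + X](eq_bigl xpredT); last by move=> j /=; rewrite (leq_trans (ltn_ord i))// leq_addr.
  over.
rewrite big_split/= -!addrA; congr (_ + _); rewrite addrC; congr (_ + _).
apply: eq_bigr => i _; rewrite big_split_ord/= big_pred0; last first.
  by move=> j; apply/negbTE; rewrite -leqNgt (leq_trans (ltnW (ltn_ord j)))// leq_addr.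
by rewrite add0r; apply: eq_bigl => j; rewrite ltn_add2l.
Qed.

End split_sums.

Lemma cvg_minn (R : realType) (a b : nat -> nat) (s t : R) :
  (a N)%:R / N%:R @[N --> \oo] --> s -> (b N)%:R / N%:R @[N --> \oo] --> t ->
  (minn (a N) (b N))%:R / N%:R @[N --> \oo] --> Num.min s t.
Proof.
move=> as_ bt; rewrite minr_absE.
under eq_cvg => N.
  rewrite (_ : _ / _ = ((a N)%:R / N%:R + (b N)%:R / N%:R - `|(a N)%:R / N%:R - (b N)%:R / N%:R|) / 2 :> R); last first.
    rewrite -mulrDl -mulrBl normrM (ger0_norm (_ : 0 <= N%:R^-1))// -mulrBl mulrAC -minr_absE.
    congr (_ / _); rewrite /minn /Num.min /Order.min ltr_nat; by case: ifP.
  over.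
by apply: cvgMl; apply: cvgB; [exact: cvgD|apply: cvg_norm; exact: cvgB].
Qed.

(** * Calculus of likelihood ratios averaged over several spikes *)

Section replicas.
Context {R : realType} (lam w2 : R).
Hypotheses (lam0 : 0 < lam) (lam1 : lam < 1) (w20 : 0 < w2).
Variables (prior : probability R R) (q : R -> R) (B : R).
Hypotheses (B1 : 1 <= B) (mq : measurable_fun setT q) (qB : forall x, `|q x| <= B).
Hypothesis q1 : (\int[prior]_x (q x)%:E = 0)%E.
Hypothesis q2 : (\int[prior]_x (q x ^+ 2)%:E = 1)%E.
Variables (mu : forall N K, probability 'M[R]_(N, K) R) (G : forall N, probability 'M[R]_N R).
Hypotheses (hmu : forall N K, iid_law prior (mu N K)) (hG : forall N, wigner_law w2 (G N)).

Local Notation ovl := (overlaps lam w2 q).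
Local Notation lV := (logV lam w2).

Definition spikes {N K} (d : 'I_K -> nat) (X : 'M[R]_(N, K)) : 'M[R]_N :=
  \sum_i spike lam (d i) (qcol q X i).

Lemma spike_le N K n (X : 'M[R]_(N, K)) i a b :
  `|spike lam n (qcol q X i) a b| <= Num.sqrt (lam / N%:R) * B ^+ 2.
Proof.
have B0 : 0 <= B := le_trans ler01 B1.
rewrite mxE; case: ifP => _; last by rewrite normr0 mulr_ge0// sqr_ge0.
rewrite !normrM ger0_norm// -mulrA ler_wpM2l// expr2 ler_pM//; exact: qB.
Qed.

Lemma measurable_spike N K n i :
  measurable_fun setT (fun X : 'M[R]_(N, K) => spike lam n (qcol q X i)).
Proof.
apply: measurable_mxP => a b; under eq_fun do rewrite mxE.
have [_|_] := boolP ((a < n)%N && (b < n)%N); last exact: measurable_cst.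
apply: measurable_funM; last exact: (measurableT_comp mq (measurable_mx_entry b i)).
by apply: measurable_funM => //; exact: (measurableT_comp mq (measurable_mx_entry a i)).
Qed.

Lemma regular_spikes N K d n :
  regular (@spikes N K d) (ovl n).
Proof.
have b0 : 0 <= Num.sqrt (lam / N%:R) * B ^+ 2 by rewrite mulr_ge0// sqr_ge0.
split.
- apply: measurable_mxP => a b; under eq_fun do rewrite summxE.
  apply: measurable_sum => i.
  exact: (measurableT_comp (measurable_mx_entry a b) (measurable_spike (d i) i)).
- by move=> X; rewrite linear_sum/=; apply: eq_bigr => i _; exact: spike_sym.
- exists (\sum_(i < K) Num.sqrt (lam / N%:R) * B ^+ 2) => X a b; rewrite summxE.
  apply: le_trans (ler_norm_sum _ _ _) _; apply: ler_sum => i _; exact: spike_le.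
- apply: measurable_sum_cond => p _; apply: measurable_mxip2; exact: measurable_spike.
- exists (\sum_(p : 'I_K * 'I_K | supper p) \sum_(r : 'I_N * 'I_N | upper r)
    (Num.sqrt (lam / N%:R) * B ^+ 2) * (Num.sqrt (lam / N%:R) * B ^+ 2) / sdev w2 r.1 r.2 ^+ 2) => X.
  apply: le_trans (ler_norm_sum _ _ _) _; apply: ler_sum => p _.
  apply: le_trans (mxip_bound w20 _ (fun a b => spike_le _ X _ a b)) _.
  apply: ler_sum => r _; rewrite ler_wpM2r ?sdev2V_ge0// ler_wpM2l//.
  exact: spike_le.
Qed.

(** Spike [i] is truncated at level [d i], and the weight contains the overlap of the pair [p] at
    level [n p]. The two are kept independent because lowering [d] at fixed [n] is how conditional
    expectations are expressed. *)
Definition replica_lik N K (d : 'I_K -> nat) (n : 'I_K * 'I_K -> nat) : 'M[R]_N -> R :=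
  lik w2 (mu N K) (spikes d) (ovl n).

Definition split_fun {T} {K K'} (f : 'I_K -> T) (f' : 'I_K' -> T) (i : 'I_(K + K')) : T :=
  match fintype.split i with inl j => f j | inr j => f' j end.

Definition split_fun2 {T} {K K'} (f : 'I_K * 'I_K -> T) (f' : 'I_K' * 'I_K' -> T)
    (g : 'I_K -> 'I_K' -> T) (p : 'I_(K + K') * 'I_(K + K')) : T :=
  match fintype.split p.1, fintype.split p.2 with
  | inl i, inl j => f (i, j)
  | inr i, inr j => f' (i, j)
  | inl i, inr j | inr j, inl i => g i j
  end.

Lemma split_lshift K K' (i : 'I_K) : fintype.split (lshift K' i) = inl i.
Proof. exact: (unsplitK (inl i)). Qed.

Lemma split_rshift K K' (i : 'I_K') : fintype.split (rshift K i) = inr i.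
Proof. exact: (unsplitK (inr i)). Qed.

(** The product joins the two families of spikes. By [likM] each cross pair leaves its overlap in
    the weight, at the lower of the two truncation levels. *)
Lemma replica_likM N K K' d d' n n' (w : 'M[R]_N) :
  replica_lik (K := K) d n w * replica_lik (K := K') d' n' w =
  replica_lik (split_fun d d') (split_fun2 n n' (fun i j => minn (d i) (d' j))) w.
Proof.
have h1 : regular (@spikes N K d) (ovl n) by exact: regular_spikes.
have h2 : regular (@spikes N K' d') (ovl n') by exact: regular_spikes.
rewrite /replica_lik likM//; apply: EFin_inj.
rewrite !likE//; [|exact: regular_spikes|exact: regular_prod].
rewrite (integral_row_mx (@hmu N K) (@hmu N K') (@hmu N (K + K')%N)); last 2 first.
- by apply/measurable_EFinP; apply: measurable_lexpl => //; exact: regular_spikes.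
- by move=> X; rewrite lee_fin expR_ge0.
apply: eq_integral => -[X X'] _ /=; congr (_%:E).
have cl i : qcol q (row_mx X X') (lshift K' i) = qcol q X i.
  by apply/funext => a; rewrite /qcol row_mxEl.
have cr i : qcol q (row_mx X X') (rshift K i) = qcol q X' i.
  by apply/funext => a; rewrite /qcol row_mxEr.
have eS : prodS (spikes d) (spikes d') (X, X') = spikes (split_fun d d') (row_mx X X').
  rewrite /prodS /spikes/= big_split_ord/=; congr (_ + _); apply: eq_bigr => i _.
    by rewrite cl /split_fun split_lshift.
  by rewrite cr /split_fun split_rshift.
have eC : prodC w2 (spikes d) (ovl n) (spikes d') (ovl n') (X, X') =
    ovl (split_fun2 n n' (fun i j => minn (d i) (d' j))) (row_mx X X').
  rewrite /prodC /overlaps/= sum_supper_split/= /split_fun2/=; congr (_ + _ + _).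
  - by apply: eq_bigr => -[i j] _ /=; rewrite !split_lshift !cl.
  - by apply: eq_bigr => -[i j] _ /=; rewrite !split_rshift !cr.
  - rewrite mxip_suml; apply: eq_bigr => i _; rewrite mxipC mxip_suml; apply: eq_bigr => j _.
    by rewrite mxipC mxip_spike split_lshift split_rshift cl cr.
by rewrite /lexp eS eC.
Qed.

Lemma integral_replica_lik N K d n :
  (\int[G N]_w (replica_lik (K := K) d n w)%:E = \int[mu N K]_X (expR (ovl n X))%:E)%E.
Proof. by apply: integral_lik1 => //; exact: regular_spikes. Qed.

Lemma replica_lik_ge0 N K d n (w : 'M[R]_N) : 0 <= replica_lik (K := K) d n w.
Proof. by apply: lik_ge0 => //; exact: regular_spikes. Qed.

Lemma measurable_replica_lik N K d n :
  measurable_fun setT (replica_lik (N := N) (K := K) d n).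
Proof. by apply: measurable_lik => //; exact: regular_spikes. Qed.

(** [replicas s f e]: [f] is a likelihood ratio averaged over [size s]
    independent spikes occupying asymptotic proportions [s] of the rows, whose
    expectation tends to [expR e]. *)
Definition replicas (s : seq R) (f : forall N, 'M[R]_N -> R) (e : R) :=
  exists K (t : 'I_K -> R) (d : nat -> 'I_K -> nat) (n : nat -> 'I_K * 'I_K -> nat)
    (u : 'I_K * 'I_K -> R),
  [/\ size s = K /\ (forall F : R -> R, \sum_(x <- s) F x = \sum_i F (t i)),
    (forall N i, (d N i <= N)%N) /\ (forall i, (d N i)%:R / N%:R @[N --> \oo] --> t i),
    (forall N p, (n N p <= N)%N) /\ (forall p, (n N p)%:R / N%:R @[N --> \oo] --> u p),
    e = \sum_(p | supper p) lV (u p) &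
    forall N w, f N w = replica_lik (d N) (n N) w].

(** Limiting log-expectations add up, with one extra term per cross pair of spikes. All limits of
    moments below are read off from this rule. *)
Lemma replicasM s s' f f' e e' : replicas s f e -> replicas s' f' e' ->
  replicas (s ++ s') (fun N w => f N w * f' N w)
    (e + e' + \sum_(x <- s) \sum_(y <- s') lV (Num.min x y)).
Proof.
move=> [K [t [d [n [u [[sK st] [dN dt] [nN nu] -> fE]]]]]].
move=> [K' [t' [d' [n' [u' [[sK' st'] [dN' dt'] [nN' nu'] -> fE']]]]]].
exists (K + K')%N, (split_fun t t'), (fun N => split_fun (d N) (d' N)).
exists (fun N => split_fun2 (n N) (n' N) (fun i j => minn (d N i) (d' N j))).
exists (split_fun2 u u' (fun i j => Num.min (t i) (t' j))); split.
- split=> [|F]; first by rewrite size_cat sK sK'.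
  rewrite big_cat/= st st' big_split_ord/= /split_fun; congr (_ + _); apply: eq_bigr => i _.
    by rewrite split_lshift.
  by rewrite split_rshift.
- split=> [N i|i]; rewrite /split_fun; case: (fintype.split i) => j //; exact: dt || exact: dt'.
- have minN N i j : (minn (d N i) (d' N j) <= N)%N by rewrite geq_min dN.
  split=> [N p|p]; rewrite /split_fun2; case: (fintype.split p.1) => i; case: (fintype.split p.2) => j //.
  + exact: cvg_minn.
  + exact: cvg_minn.
- rewrite sum_supper_split/= /split_fun2/=; congr (_ + _ + _).
  + by apply: eq_bigr => -[i j] _ /=; rewrite !split_lshift.
  + by apply: eq_bigr => -[i j] _ /=; rewrite !split_rshift.
  + rewrite st; apply: eq_bigr => i _; rewrite st'; apply: eq_bigr => j _.
    by rewrite split_lshift split_rshift.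
- by move=> N w; rewrite fE fE' replica_likM.
Qed.

Lemma replicas_cvg s f e : 4 * lam * (size s ^ 2)%:R * B ^+ 4 < 1 -> replicas s f e ->
  (\int[G N]_w (f N w)%:E @[N --> \oo] --> (expR e)%:E)%E.
Proof.
move=> small [K [t [d [n [u [[sK st] [dN dt] [nN nu] -> fE]]]]]].
under eq_cvg => N.
  under eq_integral do rewrite fE.
  rewrite integral_replica_lik.
  over.
apply: (moment_limit lam0 lam1 w20 B1 mq qB q1 q2 (fun N => @hmu N K) (@hG K)) => //.
by rewrite -sK.
Qed.

Lemma replicas_one : replicas [::] (fun _ _ => 1) 0.
Proof.
exists 0%N, (fun=> 0), (fun _ _ => 0%N), (fun _ _ => 0%N), (fun=> 0); split.
- by split=> // F; rewrite big_nil big_ord0.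
- by split=> // -[].
- by split=> // -[[]].
- by rewrite big_pred0// => -[[]].
- move=> N w; rewrite /replica_lik; apply: EFin_inj; rewrite likE//; last exact: regular_spikes.
  under eq_integral => X _.
    rewrite /lexp /spikes big_ord0 /overlaps big_pred0; last by case=> -[].
    rewrite !mxip0l mul0r subrr addr0 expR0.
    over.
  by rewrite integral_prob_cst.
Qed.

Lemma replicasX s f e k : replicas s f e ->
  replicas (flatten (nseq k s)) (fun N w => f N w ^+ k)
    (k%:R * e + k%:R * (k%:R - 1) / 2 * \sum_(x <- s) \sum_(y <- s) lV (Num.min x y)).
Proof.
move=> h; elim: k => [|k IH].
  rewrite !mul0r addr0/=; exact: replicas_one.
have := replicasM h IH.
set S := \sum_(x <- s) \sum_(y <- s) _; set e' := _ + _; set e'' := (X in _ -> replicas _ _ X).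
suff -> : e' = e''.
  by congr (replicas _ _ _); apply: functional_extensionality_dep => N; apply/funext => w; rewrite exprS.
have fl : \sum_(x <- s) \sum_(y <- flatten (nseq k s)) lV (Num.min x y) = k%:R * S.
  rewrite exchange_big/= big_flatten/= big_nseq iter_addr_0 mulr_natl.
  by congr (_ *+ _); rewrite exchange_big.
by rewrite /e' /e'' fl -(natr1 k); field.
Qed.

Definition rank1 (a N : nat) : 'M[R]_N -> R :=
  replica_lik (K := 1) (fun=> a) (fun=> 0%N).

Lemma replicas_rank1 a t : (forall N, (a N <= N)%N) ->
  (a N)%:R / N%:R @[N --> \oo] --> t -> replicas [:: t] (fun N => rank1 (a N) (N := N)) 0.
Proof.
move=> aN at_; exists 1%N, (fun=> t), (fun N _ => a N), (fun _ _ => 0%N), (fun=> 0); split => //.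
- by split=> // F; rewrite big_seq1 big_ord1.
- split=> // p; under eq_fun do rewrite mul0r; exact: cvg_cst.
- by rewrite big_pred0// => -[i j]; rewrite !ord1 /supper ltnn.
Qed.

Lemma logV0 : lV 0 = 0.
Proof. by rewrite /lV mulr0 subr0 ln1 oppr0 !mul0r addr0. Qed.

Lemma replicas_level k a b t u : (forall N, (a N <= N)%N) -> (forall N, (b N <= N)%N) ->
  (a N)%:R / N%:R @[N --> \oo] --> t -> (b N)%:R / N%:R @[N --> \oo] --> u ->
  replicas (nseq k t) (fun N => replica_lik (N := N) (K := k) (fun=> a N) (fun=> b N))
    (k%:R * (k%:R - 1) / 2 * lV u).
Proof.
move=> aN bN at_ bu; exists k, (fun=> t), (fun N _ => a N), (fun N _ => b N), (fun=> u); split => //.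
- by split=> [|F]; [rewrite size_nseq|rewrite big_nseq iter_addr_0 sumr_const card_ord].
- transitivity ((\sum_(p : 'I_k * 'I_k | supper p) 1) * lV u); last first.
    by rewrite mulr_suml; apply: eq_bigr => p _; rewrite mul1r.
  (* The number [c] of increasing pairs is obtained from k * k = k + 2c. *)
  congr (_ * _); set c := (RHS).
  have : (k * k)%:R = k%:R + (c + c).
    have h : \sum_(p : 'I_k * 'I_k) 1 = \sum_(i : 'I_k) 1 + (c + c) :> R.
      by rewrite /c -big_split; exact: (sum_pair_supper (fun=> 1)).
    by move: h; rewrite !sumr_const card_prod !card_ord.
  by rewrite natrM; lra.
Qed.

End replicas.

(** * Lindeberg replacement *)

Section expectation.
Context {d : measure_display} {T : measurableType d} {R : realType}.
Variable P : probability T R.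
Implicit Types f g : T -> R.
Local Notation E f := (Rintegral P setT f).
Local Notation "f \in_L1" := (P.-integrable setT (EFin \o f)) (at level 70).

Lemma ler_integrable f g : measurable_fun setT f -> (forall x, `|f x| <= g x) ->
  g \in_L1 -> f \in_L1.
Proof.
move=> mf fg; apply: le_integrable => //; first exact/measurable_EFinP.
by move=> x _ /=; rewrite lee_fin (le_trans (fg x))// ler_norm.
Qed.

Lemma ler_expectation f g : f \in_L1 -> g \in_L1 -> (forall x, f x <= g x) -> E f <= E g.
Proof. by move=> fi gi fg; apply: le_Rintegral => // x _; exact: fg. Qed.

Lemma expectationD f g : f \in_L1 -> g \in_L1 -> E (fun x => f x + g x) = E f + E g.
Proof. exact: RintegralD. Qed.

Lemma expectationB f g : f \in_L1 -> g \in_L1 -> E (fun x => f x - g x) = E f - E g.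
Proof. exact: RintegralB. Qed.

Lemma expectationZ c f : f \in_L1 -> E (fun x => c * f x) = c * E f.
Proof. by move=> fi; exact: RintegralZl. Qed.

Lemma expectation_dist_le f g h : f \in_L1 -> g \in_L1 -> h \in_L1 ->
  (forall x, `|f x - g x| <= h x) -> `|E f - E g| <= E h.
Proof.
move=> fi gi hi fgh; rewrite -expectationB// ler_norml.
have hN : E (fun x => -1 * h x) = - E h by rewrite expectationZ// mulN1r.
by rewrite -hN; apply/andP; split; apply: ler_expectation => //;
  [exact: integrableZlR|exact: integrableBR|move=> x|exact: integrableBR|move=> x];
  move: (fgh x); rewrite ler_norml ?mulN1r => /andP[].
Qed.

(** One step of the Lindeberg replacement: the hypotheses say that, given [X],
    [Y] has conditional mean [X] and conditional second moment that of [W]. *)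
Lemma lindeberg_taylor (X Y W : T -> R) (c k eps eta : R) :
  measurable_fun setT X -> measurable_fun setT Y -> measurable_fun setT W ->
  (forall x, 0 <= X x) -> (forall x, 0 <= Y x) -> (forall x, 0 <= W x) ->
  (fun x => X x ^+ 4) \in_L1 -> (fun x => Y x ^+ 4) \in_L1 -> (fun x => W x ^+ 2) \in_L1 ->
  0 <= c -> 0 < eps -> 0 < eta ->
  E (fun x => expR (- (c * X x)) * Y x) = E (fun x => expR (- (c * X x)) * X x) ->
  E (fun x => expR (- (c * X x)) * (X x * Y x)) = E (fun x => expR (- (c * X x)) * X x ^+ 2) ->
  E (fun x => expR (- (c * X x)) * Y x ^+ 2) = E (fun x => expR (- (c * X x)) * W x) ->
  `|E (fun x => expR (- (c * Y x))) - (E (fun x => expR (- (c * X x))) +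
      c ^+ 2 / 2 * (k - 1) * E (fun x => expR (- (c * X x)) * X x ^+ 2))| <=
  c ^+ 2 / 2 * ((eps + E (fun x => (W x - k * X x ^+ 2) ^+ 2) / eps) / 2) +
  21 * c ^+ 3 * ((eta * E (fun x => (Y x - X x) ^+ 2) + E (fun x => (Y x - X x) ^+ 4) / eta) / 2).
Proof.
move=> mX mY mW X0 Y0 W0 X4 Y4 W2 c0 e0 n0 s1 s2 s3.
pose e x := expR (- (c * X x)).
have me : measurable_fun setT e.
  by apply: measurableT_comp => //; apply: measurableT_comp => //; exact: measurable_funM.
have eb x : 0 <= e x <= 1.
  by rewrite expR_ge0/= -expR0 ler_expR oppr_le0 mulr_ge0.
(* A single function that dominates, up to a factor, every integrand of the expansion. *)
pose g x := 1 + X x ^+ 4 + Y x ^+ 4 + W x ^+ 2.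
have gi : g \in_L1.
  by apply: integrableDR => //; apply: integrableDR => //; apply: integrableDR => //; exact: integrable_cstR.
have dom r f : measurable_fun setT f -> (forall x, `|f x| <= r * g x) -> f \in_L1.
  by move=> mf fg; apply: (ler_integrable mf fg); exact: integrableZlR.
have emul f : measurable_fun setT f -> f \in_L1 -> (fun x => e x * f x) \in_L1.
  move=> mf fi; apply: (ler_integrable (g := fun x => `|f x|)).
  - exact: measurable_funM.
  - by move=> x; rewrite normrM; have /andP[h1 h2] := eb x; rewrite ger0_norm// ler_piMl.
  - by have := integrable_abse fi.
have sq2 (a : R) : 0 <= a -> a <= 1 + a ^+ 4.
  move=> a0; have := sqr_ge0 (a ^+ 2 - 1); have := sqr_ge0 (a - 1 / 2).
  by rewrite (_ : a ^+ 4 = (a ^+ 2) ^+ 2)//; [nra|ring].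
have sq4 (a : R) : a ^+ 2 <= 1 / 2 + a ^+ 4.
  by have := sqr_ge0 (a ^+ 2 - 1 / 2); rewrite (_ : a ^+ 4 = (a ^+ 2) ^+ 2)//; [nra|ring].
have p4 (a : R) : 0 <= a ^+ 4 by rewrite (_ : a ^+ 4 = (a ^+ 2) ^+ 2) ?sqr_ge0//; ring.
have Xi : X \in_L1.
  apply: (dom 1) => // x; rewrite ger0_norm// mul1r /g.
  by have := sq2 _ (X0 x); have := p4 (Y x); have := sqr_ge0 (W x); lra.
have Yi : Y \in_L1.
  apply: (dom 1) => // x; rewrite ger0_norm// mul1r /g.
  by have := sq2 _ (Y0 x); have := p4 (X x); have := sqr_ge0 (W x); lra.
have X2i : (fun x => X x ^+ 2) \in_L1.
  apply: (dom 1) => [|x]; first exact: measurable_funX.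
  rewrite ger0_norm ?sqr_ge0// mul1r /g.
  by have := sq4 (X x); have := p4 (Y x); have := sqr_ge0 (W x); lra.
have Y2i : (fun x => Y x ^+ 2) \in_L1.
  apply: (dom 1) => [|x]; first exact: measurable_funX.
  rewrite ger0_norm ?sqr_ge0// mul1r /g.
  by have := sq4 (Y x); have := p4 (X x); have := sqr_ge0 (W x); lra.
have XYi : (fun x => X x * Y x) \in_L1.
  apply: (dom 1) => [|x]; first exact: measurable_funM.
  rewrite ger0_norm ?mulr_ge0// mul1r /g.
  have := sq4 (Y x); have := sq4 (X x); have := sqr_ge0 (W x); have := sqr_ge0 (X x - Y x).
  by nra.
have Wi : W \in_L1.
  apply: (dom 1) => // x; rewrite ger0_norm// mul1r /g.
  by have := p4 (X x); have := p4 (Y x); have := sqr_ge0 (W x - 1); nra.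
have D2i : (fun x => (Y x - X x) ^+ 2) \in_L1.
  apply: (dom 1) => [|x]; first by apply: measurable_funX; exact: measurable_funB.
  rewrite ger0_norm ?sqr_ge0// mul1r /g.
  have := sq4 (Y x); have := sq4 (X x); have := sqr_ge0 (W x).
  have : 0 <= X x * Y x by rewrite mulr_ge0.
  by rewrite sqrrB -mulr_natr; lra.
have D4i : (fun x => (Y x - X x) ^+ 4) \in_L1.
  apply: (dom 2) => [|x]; first by apply: measurable_funX; exact: measurable_funB.
  rewrite ger0_norm ?p4// /g.
  apply: (@le_trans _ _ ((X x ^+ 2 + Y x ^+ 2) ^+ 2)).
    have -> : (Y x - X x) ^+ 4 = ((Y x - X x) ^+ 2) ^+ 2 by ring.
    apply: lerXn2r; rewrite ?nnegrE ?sqr_ge0 ?addr_ge0 ?sqr_ge0//.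
    have : 0 <= X x * Y x by rewrite mulr_ge0.
    by rewrite sqrrB -mulr_natr; lra.
  have := sqr_ge0 (X x ^+ 2 - Y x ^+ 2); have := sqr_ge0 (W x).
  have -> : X x ^+ 4 = (X x ^+ 2) ^+ 2 by ring.
  have -> : Y x ^+ 4 = (Y x ^+ 2) ^+ 2 by ring.
  by nra.
have W2Xi : (fun x => (W x - k * X x ^+ 2) ^+ 2) \in_L1.
  apply: (dom (2 + 2 * k ^+ 2)) => [|x].
    by apply: measurable_funX; apply: measurable_funB => //; apply: measurable_funM => //; exact: measurable_funX.
  rewrite ger0_norm ?sqr_ge0// /g.
  have -> : X x ^+ 4 = (X x ^+ 2) ^+ 2 by ring.
  have h1 := sqr_ge0 (W x + k * X x ^+ 2); have h2 := sqr_ge0 (W x); have h3 := p4 (Y x).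
  have h4 := sqr_ge0 (X x ^+ 2); have h5 := sqr_ge0 k.
  have h6 := mulr_ge0 h5 h2; have h7 := mulr_ge0 h5 h3.
  by nra.
have ei : e \in_L1.
  by apply: (bounded_integrable P (c := 1)) => // x; have /andP[h1 h2] := eb x; rewrite ger0_norm.
have mX2 : measurable_fun setT (fun x => X x ^+ 2) by exact: measurable_funX.
have mY2 : measurable_fun setT (fun x => Y x ^+ 2) by exact: measurable_funX.
have mXY : measurable_fun setT (fun x => X x * Y x) by exact: measurable_funM.
have eXi := emul _ mX Xi; have eYi := emul _ mY Yi; have eX2i := emul _ mX2 X2i.
have eY2i := emul _ mY2 Y2i; have eXYi := emul _ mXY XYi; have eWi := emul _ mW Wi.
(* Second-order Taylor polynomial of exp(-c Y) at X, multiplied out so that the three hypotheses on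
   conditional moments apply to its terms. *)
pose S x := e x + - c * (e x * Y x) + c * (e x * X x) + c ^+ 2 / 2 * (e x * Y x ^+ 2)
  + - c ^+ 2 * (e x * (X x * Y x)) + c ^+ 2 / 2 * (e x * X x ^+ 2).
have ES : E S = E e + c ^+ 2 / 2 * (E (fun x => e x * W x) - E (fun x => e x * X x ^+ 2)).
  rewrite /S !expectationD ?expectationZ//; do ?apply: integrableDR => //; do ?exact: integrableZlR.
  by rewrite s1 s2 s3 -/e; field.
have Si : S \in_L1.
  by rewrite /S; do ?apply: integrableDR => //; do ?exact: integrableZlR.
(* The cubic error |D|^3 is at most (eta D^2 + D^4 / eta) / 2, which trades it for even moments;
   those are polynomial in the ratios and their limits are computable. *)
pose Hb x := 21 * c ^+ 3 / 2 * eta * (Y x - X x) ^+ 2 + 21 * c ^+ 3 / 2 / eta * (Y x - X x) ^+ 4.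
have h1 : `|E (fun x => expR (- (c * Y x))) - E S| <=
    21 * c ^+ 3 * ((eta * E (fun x => (Y x - X x) ^+ 2) + E (fun x => (Y x - X x) ^+ 4) / eta) / 2).
  apply: (@le_trans _ _ (E Hb)).
    apply: expectation_dist_le => //.
    - apply: (bounded_integrable P (c := 1)) => [|x].
        by apply: measurableT_comp => //; apply: measurableT_comp => //; exact: measurable_funM.
      by rewrite ger0_norm ?expR_ge0// -expR0 ler_expR oppr_le0 mulr_ge0.
    - by rewrite /Hb; apply: integrableDR; exact: integrableZlR.
    - move=> x; have -> : c * Y x = c * X x + c * (Y x - X x) by ring.
      have -> : S x = expR (- (c * X x)) * (1 - c * (Y x - X x) + (c * (Y x - X x)) ^+ 2 / 2).
        by rewrite /S -/(e x); field.
      apply: le_trans (expRN_taylor _ _) _; first exact: mulr_ge0.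
        by rewrite mulrBr subrKC mulr_ge0.
      rewrite normrM (ger0_norm c0) exprMn /Hb.
      set D := Y x - X x.
      have -> : D ^+ 2 = `|D| ^+ 2 by rewrite real_normK ?num_real.
      have -> : D ^+ 4 = `|D| ^+ 4.
        have -> : D ^+ 4 = (D ^+ 2) ^+ 2 by ring.
        by rewrite -(real_normK (num_real D)); ring.
      have D0 : 0 <= `|D| by [].
      have c3 : 0 <= c ^+ 3 by exact: exprn_ge0.
      have -> : 21 * c ^+ 3 / 2 * eta * `|D| ^+ 2 + 21 * c ^+ 3 / 2 / eta * `|D| ^+ 4 =
        21 * c ^+ 3 * ((eta ^+ 2 * `|D| ^+ 2 + `|D| ^+ 4) / eta / 2) by field; rewrite gt_eqF.
      rewrite -mulrA; apply: ler_wpM2l => //; apply: ler_wpM2l => //.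
      rewrite ler_pdivlMr// ler_pdivlMr//.
      have := mulr_ge0 (sqr_ge0 `|D|) (sqr_ge0 (eta - `|D|)).
      have -> : `|D| ^+ 4 = `|D| ^+ 2 * `|D| ^+ 2 by ring.
      have -> : `|D| ^+ 3 = `|D| ^+ 2 * `|D| by ring.
      by nra.
  rewrite /Hb expectationD ?expectationZ//; do ?exact: integrableZlR.
  by rewrite le_eqVlt; apply/orP; left; apply/eqP; field; rewrite gt_eqF.
(* Again the inequality of means, |z| <= (eps + z^2 / eps) / 2, so that only an L^2 estimate of
   [W - k X^2] is required. *)
have h2 : `|E (fun x => e x * W x) - k * E (fun x => e x * X x ^+ 2)| <=
    (eps + E (fun x => (W x - k * X x ^+ 2) ^+ 2) / eps) / 2.
  rewrite -expectationZ//.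
  apply: (@le_trans _ _ (E (fun x => (2 * eps)^-1 * (W x - k * X x ^+ 2) ^+ 2 + eps / 2))).
    apply: expectation_dist_le => //.
    - exact: integrableZlR.
    - by apply: integrableDR; [exact: integrableZlR|exact: integrable_cstR].
    - move=> x; have -> : e x * W x - k * (e x * X x ^+ 2) = e x * (W x - k * X x ^+ 2) by ring.
      have /andP[e0' e1] := eb x.
      set z := W x - _; rewrite normrM ger0_norm//.
      apply: (@le_trans _ _ `|z|); first by rewrite ler_piMl.
      have -> : z ^+ 2 = `|z| ^+ 2 by rewrite real_normK ?num_real.
      have -> : (2 * eps)^-1 * `|z| ^+ 2 + eps / 2 = (`|z| ^+ 2 + eps ^+ 2) / (2 * eps).
        by field; rewrite gt_eqF.
      rewrite ler_pdivlMr ?mulr_gt0//.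
      by have := sqr_ge0 (`|z| - eps); nra.
  rewrite Rintegral_addc ?expectationZ//; last exact: integrableZlR.
  by rewrite le_eqVlt; apply/orP; left; apply/eqP; field; rewrite gt_eqF.
rewrite -/e; set a := E (fun x => expR (- (c * Y x))) in h1 *.
have -> : a - (E e + c ^+ 2 / 2 * (k - 1) * E (fun x => e x * X x ^+ 2)) =
   c ^+ 2 / 2 * (E (fun x => e x * W x) - k * E (fun x => e x * X x ^+ 2)) + (a - E S).
  by rewrite ES; ring.
apply: le_trans (ler_normD _ _) _; apply: lerD => //.
by rewrite normrM ger0_norm ?divr_ge0 ?sqr_ge0// ler_wpM2l// divr_ge0 ?sqr_ge0.
Qed.

End expectation.

Section gaussian_convolution.
Context {R : realType}.
Notation mu := (@lebesgue_measure R).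
Local Notation p := (normal_pdf 0 1 : R -> R).

Let mp : measurable_fun setT (EFin \o p).
Proof. by apply/measurable_EFinP; exact: measurable_normal_pdf. Qed.

Let mpa (u t : R) : measurable_fun setT (fun y : R => (p (u * y + t))%:E).
Proof.
apply: (measurableT_comp mp); apply: measurable_funD => //; exact: measurable_funM.
Qed.

(** Completing the square in [y]: the joint density of [y] and z = a x + b y is split into the
    density of z and the conditional density of [y]. *)
Lemma normal_pdf_product (a b s y z : R) : 0 < a -> 0 < s -> a ^+ 2 + b ^+ 2 = s ^+ 2 ->
  p ((z - b * y) / a) * p y = p (z / s) * p (s / a * y - b * z / (s * a)).
Proof.
move=> a0 s0 abs; rewrite !normal_pdf0E ?oner_neq0// mulrACA [RHS]mulrACA -!expRD; congr (_ * expR _).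
rewrite expr1n.
have b2 : b ^+ 2 = s ^+ 2 - a ^+ 2 by rewrite -abs; ring.
have -> : (s / a * y - b * z / (s * a)) ^+ 2 =
   (s ^+ 2 * y ^+ 2 - 2 * b * z * y + b ^+ 2 * z ^+ 2 / s ^+ 2) / a ^+ 2.
  by field; rewrite !gt_eqF.
have -> : ((z - b * y) / a) ^+ 2 = (z ^+ 2 - 2 * b * z * y + b ^+ 2 * y ^+ 2) / a ^+ 2.
  by field; rewrite gt_eqF.
by rewrite b2; field; rewrite !gt_eqF.
Qed.

Lemma gauss_convolution (a b s : R) (f : R -> \bar R) : 0 < a -> 0 < s ->
  a ^+ 2 + b ^+ 2 = s ^+ 2 -> measurable_fun [set: R] f -> (forall x, 0 <= f x)%E ->
  (\int[gauss 1]_y \int[gauss 1]_x f (a * x + b * y)%R = \int[gauss 1]_x f (s * x)%R)%E.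
Proof.
move=> a0 s0 abs mf f0; have n1 : (1 : R) != 0 by exact: oner_neq0.
have maff (u t : R) : measurable_fun [set: R] (fun x => f (u * x + t)).
  by apply: measurableT_comp => //; apply: measurable_funD => //; exact: measurable_funM.
have p0 x : (0 <= (p x)%:E)%E by rewrite lee_fin normal_pdf_ge0.
have st1 y : (\int[gauss 1]_x f (a * x + b * y)%R =
    (a^-1)%:E * \int[mu]_z (f z * (p ((z - b * y) / a))%:E))%E.
  rewrite integral_gauss//.
  rewrite -(ge0_integral_lebesgue_affine (b * y) a0); last 2 first.
  - apply: emeasurable_funM => //; apply: (eq_measurable_fun _ _ (mpa a^-1 (- (b * y) / a))).
    by move=> z _; congr (p _)%:E; field; rewrite gt_eqF.
  - by move=> z; rewrite mule_ge0.
  by apply: eq_integral => x _; congr (_ * (p _)%:E)%E; field; rewrite gt_eqF.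
under eq_integral do rewrite st1.
have mj : measurable_fun setT (fun yz : R * R => (p ((yz.2 - b * yz.1) / a))%:E).
  apply: (measurableT_comp mp); apply: measurable_funM => //; apply: measurable_funB => //.
  exact: measurable_funM.
have mfj : measurable_fun setT (fun yz : R * R => f yz.2 * (p ((yz.2 - b * yz.1) / a))%:E)%E.
  by apply: emeasurable_funM => //; exact: (measurableT_comp mf).
have fp0 y z : (0 <= f z * (p ((z - b * y) / a))%:E)%E by rewrite mule_ge0.
rewrite ge0_integralZl//; last 3 first.
- exact: (@measurable_fun_fubini_tonelli_F _ _ _ _ _ mu
    (fun yz : R * measurableTypeR R => f yz.2 * (p ((yz.2 - b * yz.1) / a))%:E)%E mfj (fun yz => fp0 yz.1 yz.2)).
- by move=> y _; apply: integral_ge0 => z _; exact: fp0.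
- by rewrite lee_fin invr_ge0 ltW.
rewrite (@fubini_tonelli _ _ _ _ _ (gauss 1) mu
  (fun yz : R * measurableTypeR R => f yz.2 * (p ((yz.2 - b * yz.1) / a))%:E)%E mfj (fun yz => fp0 yz.1 yz.2)).
have st3 z : (\int[gauss 1]_y (p ((z - b * y) / a))%:E = (a / s * p (z / s))%:E)%E.
  have m1 : measurable_fun [set: R] (fun y => (p ((z - b * y) / a))%:E).
    apply: (eq_measurable_fun _ _ (mpa (- b / a) (z / a))).
    by move=> y _; congr (p _)%:E; field; rewrite gt_eqF.
  rewrite integral_gauss//.
  under eq_integral do rewrite -EFinM (normal_pdf_product _ z a0 s0 abs) EFinM.
  rewrite ge0_integralZl//; last first.
    by have := mpa (s / a) (- (b * z / (s * a))).
  rewrite (@ge0_integral_lebesgue_affine _ (s / a) (- (b * z / (s * a))) (EFin \o p)) ?divr_gt0//.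
  rewrite integral_normal_pdf mule1 -EFinM; congr EFin; field.
  by rewrite !gt_eqF.
under eq_integral => z _.
  rewrite /= ge0_integralZl//; last first.
    apply: (eq_measurable_fun _ _ (mpa (- b / a) (z / a))).
    by move=> y _; congr (p _)%:E; field; rewrite gt_eqF.
  rewrite st3 EFinM muleCA.
  over.
have mfz : measurable_fun setT (fun z : R => f z * (p (z / s))%:E)%E.
  apply: emeasurable_funM => //; apply: (eq_measurable_fun _ _ (mpa s^-1 0)).
  by move=> y _; rewrite addr0 mulrC.
rewrite ge0_integralZl//; last 2 first.
- by move=> z _; rewrite mule_ge0.
- by rewrite lee_fin divr_ge0 ?ltW.
rewrite muleA -EFinM (_ : a^-1 * (a / s) = s^-1); last by field; rewrite !gt_eqF.
rewrite -(@ge0_integral_lebesgue_affine _ s 0 (fun z => f z * (p (z / s))%:E)%E)//; last first.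
  by move=> z; rewrite mule_ge0.
have mfs : measurable_fun [set: R] (fun x => f (s * x)).
  by apply: measurableT_comp => //; exact: measurable_funM.
rewrite (integral_gauss n1 mfs (fun x => f0 _)).
apply: eq_integral => x _; rewrite addr0; congr (_ * (p _)%:E)%E.
by field; rewrite gt_eqF.
Qed.

End gaussian_convolution.

Section lognormal.
Context {R : realType}.
Implicit Types (v s c a : R).
Local Notation gam := (gauss 1 : probability R R).

(** Log-normal variable of mean one. *)
Definition lgn v (y : R) : R := expR (Num.sqrt v * y - v / 2).
Lemma lgn_ge0 v y : 0 <= lgn v y. Proof. exact: expR_ge0. Qed.

Lemma measurable_lgn v : measurable_fun setT (lgn v).
Proof.
apply: measurableT_comp => //; apply: measurable_funB => //; exact: measurable_funM.
Qed.

Lemma integral_lgnX k v : 0 <= v ->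
  (\int[gam]_y (lgn v y ^+ k)%:E = (expR (k%:R * (k%:R - 1) * v / 2))%:E)%E.
Proof.
move=> v0; have n1 : (1 : R) != 0 by exact: oner_neq0.
pose t : R := k%:R * Num.sqrt v.
have t2 : t ^+ 2 = k%:R ^+ 2 * v by rewrite exprMn sqr_sqrtr.
transitivity (\int[gam]_y ((expR (k%:R * (k%:R - 1) * v / 2))%:E *
    (expR (t * y / 1 ^+ 2 - t ^+ 2 / (2 * 1 ^+ 2)))%:E))%E.
  apply: eq_integral => y _; rewrite -EFinM -expRD /lgn -expRM_natl t2 /t expr1n.
  by congr (expR _)%:E; field.
rewrite ge0_integralZl//.
- by rewrite integral_gauss_expR// mule1.
- apply/measurable_EFinP; apply: measurableT_comp => //; apply: measurable_funB => //.
  by apply: measurable_funM => //; exact: measurable_funM.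
Qed.

Lemma integrable_lgnX k v : 0 <= v -> gam.-integrable setT (EFin \o (fun y => lgn v y ^+ k)).
Proof.
move=> v0; apply/integrableP; split.
  by apply/measurable_EFinP; apply: measurable_funX; exact: measurable_lgn.
under eq_integral do rewrite /= ger0_norm ?exprn_ge0 ?lgn_ge0//.
by rewrite integral_lgnX// ltry.
Qed.

Lemma Rintegral_lgnX k v : 0 <= v ->
  \int[gam]_y (lgn v y ^+ k) = expR (k%:R * (k%:R - 1) * v / 2).
Proof. by move=> v0; rewrite /Rintegral integral_lgnX. Qed.

(** These are the centered moments of order 2 and 4 of [lgn v]. In the second one the terms of order
    [v] cancel, leaving 72 + 6 * 2 = 84; the range 1/12 comes from 6 v <= 1/2. *)
Lemma expR_increment_bounds v : 0 < v -> v <= 1 / 12 ->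
  expR v - 1 <= 2 * v /\
  expR (6 * v) - 4 * expR (3 * v) + 6 * expR v - 3 <= 84 * v ^+ 2.
Proof.
move=> v0 v1.
have b1 : expR v <= 1 + v + 2 * v ^+ 2.
  have : `|v| <= 1 / 2 by rewrite ger0_norm//; lra.
  by move/expR_abs1; rewrite ler_norml; lra.
have b6 : expR (6 * v) <= 1 + 6 * v + 72 * v ^+ 2.
  have : `|6 * v| <= 1 / 2 by rewrite ger0_norm ?mulr_ge0//; lra.
  by move/expR_abs1; rewrite ler_norml exprMn; lra.
have b3 : 1 + 3 * v <= expR (3 * v) by exact: expR_ge1Dx.
by split; nra.
Qed.

Lemma lgn_centered_moments v : 0 < v -> v <= 1 / 12 ->
  \int[gam]_y ((lgn v y - 1) ^+ 2) <= 2 * v /\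
  \int[gam]_y ((lgn v y - 1) ^+ 4) <= 84 * v ^+ 2.
Proof.
move=> v0 v1; have v0' := ltW v0.
have i k := integrable_lgnX k v0'.
have i1 : gam.-integrable setT (EFin \o lgn v) := i 1%N.
have e1 : \int[gam]_y lgn v y = 1.
  by have := Rintegral_lgnX 1 v0'; rewrite subrr mulr0 !mul0r expR0.
have e2 := Rintegral_lgnX 2 v0'; have e3 := Rintegral_lgnX 3 v0'; have e4 := Rintegral_lgnX 4 v0'.
have [b1 b2] := expR_increment_bounds v0 v1.
split.
- have -> : \int[gam]_y ((lgn v y - 1) ^+ 2) = \int[gam]_y (lgn v y ^+ 2 + (-2) * lgn v y + 1).
    by apply: eq_Rintegral => y _; ring.
  rewrite Rintegral_addc; last by apply: integrableDR => //; exact: integrableZlR.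
  rewrite expectationD ?expectationZ//; last exact: integrableZlR.
  rewrite e1 e2 (_ : 2 * (2 - 1) * v / 2 = v); last by field.
  by lra.
- have -> : \int[gam]_y ((lgn v y - 1) ^+ 4) = \int[gam]_y (lgn v y ^+ 4 + (-4) * lgn v y ^+ 3 + 6 * lgn v y ^+ 2 + (-4) * lgn v y + 1).
    by apply: eq_Rintegral => y _; ring.
  rewrite Rintegral_addc; last by do ?apply: integrableDR => //; do ?exact: integrableZlR.
  rewrite !expectationD ?expectationZ//; do ?apply: integrableDR => //; do ?exact: integrableZlR.
  rewrite e1 e2 e3 e4 (_ : 2 * (2 - 1) * v / 2 = v); last by field.
  rewrite (_ : 3 * (3 - 1) * v / 2 = 3 * v); last by field.
  rewrite (_ : 4 * (4 - 1) * v / 2 = 6 * v); last by field.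
  by lra.
Qed.

Definition laplace d (T : measurableType d) (P : probability T R) (X : T -> R) c : R :=
  \int[P]_x expR (- (c * X x)).

(** An instance of [lindeberg_taylor] with X constant equal to 1, where the second-moment gap
    vanishes. With eta = sqrt v the constant is 21 (2 + 84) / 2 = 903. *)
Lemma lgn_laplace_taylor a v : 0 <= a -> 0 < v -> v <= 1 / 12 ->
  `|laplace gam (lgn v) a - expR (- a) * (1 + a ^+ 2 / 2 * (expR v - 1))| <=
  903 * a ^+ 3 * (v * Num.sqrt v).
Proof.
move=> a0 v0 v1; have v0' := ltW v0.
have [m2 m4] := lgn_centered_moments v0 v1.
have sv : 0 < Num.sqrt v by rewrite sqrtr_gt0.
have sv2 : Num.sqrt v ^+ 2 = v by rewrite sqr_sqrtr.
apply/ler_addgt0Pr => eps e0.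
(* The gap being zero, [e'] is free; this value makes the corresponding term at most [eps]. *)
pose e' := 4 * eps / (1 + a ^+ 2).
have a2 : 0 < 1 + a ^+ 2 by rewrite ltr_pwDl// sqr_ge0.
have e'0 : 0 < e' by rewrite divr_gt0// mulr_gt0.
have ic k : gam.-integrable setT (EFin \o (fun=> k)) by exact: integrable_cstR.
have e1 : \int[gam]_y lgn v y = 1.
  by have := Rintegral_lgnX 1 v0'; rewrite subrr mulr0 !mul0r expR0.
have e2 : \int[gam]_y (lgn v y ^+ 2) = expR v.
  by rewrite Rintegral_lgnX//; congr expR; field.
have i1 : gam.-integrable setT (EFin \o lgn v) := integrable_lgnX 1 v0'.
have := @lindeberg_taylor _ _ _ gam (fun=> 1) (lgn v) (fun=> expR v) a (expR v) e' (Num.sqrt v)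
  (measurable_cst _) (measurable_lgn v) (measurable_cst _) (fun=> ler01) (lgn_ge0 v)
  (fun=> expR_ge0 v) (ic _) (integrable_lgnX 4 v0') (ic _) a0 e'0 sv.
have -> : (fun x => expR (- (a * 1)) * (1 * lgn v x)) = (fun x => expR (- (a * 1)) * lgn v x).
  by apply/funext => x; rewrite mul1r.
rewrite !expr1n !mulr1 subrr expr0n/= !expectationZ//; last exact: (integrable_lgnX 2).
rewrite e1 e2 !Rintegral_prob_cst !mulr1 mul0r addr0.
move=> /(_ erefl erefl erefl) h.
rewrite (_ : expR (- a) * _ = expR (- a) + a ^+ 2 / 2 * (expR v - 1) * expR (- a)); last by ring.
apply: le_trans h _; rewrite [leRHS]addrC; apply: lerD.
  have -> : a ^+ 2 / 2 * (e' / 2) = eps * (a ^+ 2 / (1 + a ^+ 2)).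
    by rewrite /e'; field; rewrite gt_eqF.
  by rewrite ler_piMr ?(ltW e0)// ler_pdivrMr// mul1r lerDr.
have a3 : 0 <= a ^+ 3 by exact: exprn_ge0.
rewrite (_ : 903 * a ^+ 3 * (v * Num.sqrt v) = 21 * a ^+ 3 * (43 * (v * Num.sqrt v))); last by ring.
apply: ler_wpM2l; first by rewrite mulr_ge0.
rewrite ler_pdivrMr//.
have h1 : Num.sqrt v * \int[gam]_y ((lgn v y - 1) ^+ 2) <= Num.sqrt v * (2 * v).
  by rewrite ler_pM2l.
have h2 : \int[gam]_y ((lgn v y - 1) ^+ 4) / Num.sqrt v <= 84 * (v * Num.sqrt v).
  by rewrite ler_pdivrMr// (le_trans m4)// -mulrA -mulrA -expr2 sv2; nra.
by lra.
Qed.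

Section laplace_theory.
Context {d : measure_display} {T : measurableType d} (P : probability T R).
Variable X : T -> R.
Hypotheses (mX : measurable_fun setT X) (X0 : forall x, 0 <= X x).

Let mE c : measurable_fun setT (fun x => expR (- (c * X x))).
Proof. by apply: measurableT_comp => //; apply: measurableT_comp => //; exact: measurable_funM. Qed.

Lemma expRN_le1 c x : 0 <= c -> `|expR (- (c * X x))| <= 1.
Proof. by move=> c0; rewrite ger0_norm ?expR_ge0// -expR0 ler_expR oppr_le0 mulr_ge0. Qed.

Lemma integrable_laplace c : 0 <= c ->
  P.-integrable setT (EFin \o (fun x => expR (- (c * X x)))).
Proof.
by move=> c0; apply: (bounded_integrable P (c := 1)) => // x; exact: expRN_le1.
Qed.

Lemma EFin_laplace c : 0 <= c ->
  ((laplace P X c)%:E = \int[P]_x (expR (- (c * X x)))%:E)%E.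
Proof. by move=> c0; rewrite /laplace EFin_Rintegral//; exact: integrable_laplace. Qed.

Lemma laplace_norm_le1 c : 0 <= c -> `|laplace P X c| <= 1.
Proof.
move=> c0; have := @expectation_dist_le _ _ _ P (fun x => expR (- (c * X x))) (fun=> 0) (fun=> 1).
rewrite !Rintegral_prob_cst subr0; apply; [exact: integrable_laplace|exact: integrable_cstR|exact: integrable_cstR|].
by move=> x; rewrite subr0; exact: expRN_le1.
Qed.

Section mixture.
Context {d' : measure_display} {T' : measurableType d'} (Q : probability T' R).
Variable Z : T' -> R.
Hypotheses (mZ : measurable_fun setT Z) (Z0 : forall y, 0 <= Z y).

Let h (c : R) (yx : T' * T) : \bar R := (expR (- (c * Z yx.1 * X yx.2)))%:E.

Let mh c : measurable_fun setT (h c).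
Proof.
apply/measurable_EFinP; apply: measurableT_comp => //; apply: measurableT_comp => //.
by apply: measurable_funM; [apply: measurable_funM => //|]; exact: measurableT_comp.
Qed.

Let h0 c yx : (0 <= h c yx)%E. Proof. by rewrite lee_fin expR_ge0. Qed.

Lemma measurable_laplace_mix c : 0 <= c -> measurable_fun setT (fun y => laplace P X (c * Z y)).
Proof.
move=> c0; apply/measurable_EFinP.
rewrite (_ : EFin \o _ = fun y => (\int[P]_x h c (y, x))%E).
  exact: (@measurable_fun_fubini_tonelli_F _ _ _ _ _ P _ (mh c) (h0 c)).
by apply/funext => y /=; rewrite EFin_laplace ?mulr_ge0.
Qed.

Lemma integrable_laplace_mix c : 0 <= c ->
  Q.-integrable setT (EFin \o (fun y => laplace P X (c * Z y))).
Proof.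
move=> c0; apply: (bounded_integrable Q (c := 1)) => [|y]; first exact: measurable_laplace_mix.
by apply: laplace_norm_le1; rewrite mulr_ge0.
Qed.

Lemma EFin_laplace_mix c : 0 <= c -> ((\int[Q]_y laplace P X (c * Z y))%:E =
  \int[Q]_y \int[P]_x (expR (- (c * Z y * X x)))%:E)%E.
Proof.
move=> c0; rewrite EFin_Rintegral; last exact: integrable_laplace_mix.
by apply: eq_integral => y _; rewrite EFin_laplace ?mulr_ge0.
Qed.

Lemma laplace_mixC c : 0 <= c ->
  (\int[Q]_y \int[P]_x (expR (- (c * Z y * X x)))%:E =
   \int[P]_x \int[Q]_y (expR (- (c * X x * Z y)))%:E)%E.
Proof.
move=> c0; rewrite (@fubini_tonelli _ _ _ _ _ Q P (h c) (mh c) (h0 c)).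
by apply: eq_integral => x _; apply: eq_integral => y _; rewrite /h/= mulrAC.
Qed.

End mixture.
End laplace_theory.

Lemma laplace_swap d d' (T : measurableType d) (T' : measurableType d')
    (P : probability T R) (Q : probability T' R) (X : T -> R) (Z : T' -> R) c :
  measurable_fun setT X -> measurable_fun setT Z -> (forall x, 0 <= X x) ->
  (forall y, 0 <= Z y) -> 0 <= c ->
  \int[Q]_y laplace P X (c * Z y) = \int[P]_x laplace Q Z (c * X x).
Proof.
by move=> mX mZ X0 Z0 c0; apply: EFin_inj; rewrite !EFin_laplace_mix// laplace_mixC.
Qed.

(** [Y] is compared with [X] times an independent [lgn v]: both Laplace transforms are close to the
    same second-order expansion [m] around [X]. The test functions [e] of linear growth express
    conditional moments given [X]. *)
Lemma lindeberg_step d (T : measurableType d) (P : probability T R) (X Y W : T -> R)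
    (c v eps : R) :
  measurable_fun setT X -> measurable_fun setT Y -> measurable_fun setT W ->
  (forall x, 0 <= X x) -> (forall x, 0 <= Y x) -> (forall x, 0 <= W x) ->
  P.-integrable setT (EFin \o (fun x => X x ^+ 4)) ->
  P.-integrable setT (EFin \o (fun x => Y x ^+ 4)) ->
  P.-integrable setT (EFin \o (fun x => W x ^+ 2)) ->
  P.-integrable setT (EFin \o (fun x => X x ^+ 3)) ->
  P.-integrable setT (EFin \o (fun x => X x ^+ 2)) ->
  0 <= c -> 0 < eps -> 0 < v -> v <= 1 / 12 ->
  (forall e : R -> R, measurable_fun setT e -> (forall x, 0 <= e x) ->
    (forall x, 0 <= x -> e x <= x + 1) ->
    \int[P]_x (e (X x) * Y x) = \int[P]_x (e (X x) * X x)) ->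
  (forall e : R -> R, measurable_fun setT e -> (forall x, 0 <= e x) ->
    (forall x, 0 <= x -> e x <= x + 1) ->
    \int[P]_x (e (X x) * Y x ^+ 2) = \int[P]_x (e (X x) * W x)) ->
  `|laplace P Y c - \int[gam]_y laplace P X (c * lgn v y)| <=
  c ^+ 2 / 2 * ((eps + \int[P]_x ((W x - expR v * X x ^+ 2) ^+ 2) / eps) / 2) +
  21 * c ^+ 3 * ((Num.sqrt v * \int[P]_x ((Y x - X x) ^+ 2) +
    \int[P]_x ((Y x - X x) ^+ 4) / Num.sqrt v) / 2) +
  903 * c ^+ 3 * (v * Num.sqrt v) * \int[P]_x (X x ^+ 3).
Proof.
move=> mX mY mW X0 Y0 W0 X4 Y4 W2 X3 X2 c0 e0 v0 v1 s1 s2.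
have sv : 0 < Num.sqrt v by rewrite sqrtr_gt0.
have mc : measurable_fun setT (fun x : R => expR (- (c * x))).
  by apply: measurableT_comp => //; apply: measurableT_comp => //; exact: measurable_funM.
have ec1 (x : R) : 0 <= x -> expR (- (c * x)) <= 1.
  by move=> x0; rewrite -expR0 ler_expR oppr_le0 mulr_ge0.
have s1' := s1 (fun x => expR (- (c * x))) mc (fun x => expR_ge0 _) _.
have s2' := s2 (fun x => expR (- (c * x))) mc (fun x => expR_ge0 _) _.
(* The absolute value makes the test function nonnegative on the whole line; it disappears at [X],
   which is nonnegative. *)
have s3' : \int[P]_x (expR (- (c * X x)) * `|X x| * Y x) =
    \int[P]_x (expR (- (c * X x)) * `|X x| * X x).
  apply: (s1 (fun x => expR (- (c * x)) * `|x|)) => [|x|x x0].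
  - by apply: measurable_funM => //; exact: measurableT_comp.
  - by rewrite mulr_ge0 ?expR_ge0.
  - by rewrite ger0_norm// (@le_trans _ _ x) ?lerDl// ler_piMl// ec1.
rewrite laplace_swap//; [|exact: measurable_lgn|exact: lgn_ge0].
pose m x := expR (- (c * X x)) * (1 + (c * X x) ^+ 2 / 2 * (expR v - 1)).
have eX2i : P.-integrable setT (EFin \o (fun x => expR (- (c * X x)) * X x ^+ 2)).
  apply: (ler_integrable _ _ X2) => [|x].
    apply: measurable_funM; last exact: measurable_funX.
    exact: (measurableT_comp mc).
  by rewrite ger0_norm ?mulr_ge0 ?expR_ge0 ?sqr_ge0// ler_piMl ?sqr_ge0// ec1.
have mE : \int[P]_x m x = \int[P]_x expR (- (c * X x)) +
     c ^+ 2 / 2 * (expR v - 1) * \int[P]_x (expR (- (c * X x)) * X x ^+ 2).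
  have -> : \int[P]_x m x = \int[P]_x (expR (- (c * X x)) + c ^+ 2 / 2 * (expR v - 1) * (expR (- (c * X x)) * X x ^+ 2)).
    by apply: eq_Rintegral => x _; rewrite /m; field.
  by rewrite expectationD ?expectationZ//; [exact: integrable_laplace|exact: integrableZlR].
have mi : P.-integrable setT (EFin \o m).
  rewrite (_ : m = fun x => expR (- (c * X x)) + c ^+ 2 / 2 * (expR v - 1) * (expR (- (c * X x)) * X x ^+ 2)).
    by apply: integrableDR; [exact: integrable_laplace|exact: integrableZlR].
  by apply/funext => x; rewrite /m; field.
have h1 : `|laplace P Y c - \int[P]_x m x| <=
  c ^+ 2 / 2 * ((eps + \int[P]_x ((W x - expR v * X x ^+ 2) ^+ 2) / eps) / 2) +
  21 * c ^+ 3 * ((Num.sqrt v * \int[P]_x ((Y x - X x) ^+ 2) +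
    \int[P]_x ((Y x - X x) ^+ 4) / Num.sqrt v) / 2).
  rewrite mE; apply: lindeberg_taylor => //.
  - by apply: s1' => x x0; apply: le_trans (ec1 _ x0) _; rewrite lerDr.
  - transitivity (\int[P]_x (expR (- (c * X x)) * `|X x| * Y x)).
      by apply: eq_Rintegral => x _; rewrite ger0_norm// mulrA.
    by rewrite s3'; apply: eq_Rintegral => x _; rewrite ger0_norm// expr2 mulrA.
  - by apply: s2' => x x0; apply: le_trans (ec1 _ x0) _; rewrite lerDr.
have h2 : `|\int[P]_x m x - \int[P]_x laplace gam (lgn v) (c * X x)| <=
    903 * c ^+ 3 * (v * Num.sqrt v) * \int[P]_x (X x ^+ 3).
  rewrite -expectationZ//; apply: expectation_dist_le => //.
  - by apply: integrable_laplace_mix => //; [exact: measurable_lgn|exact: lgn_ge0].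
  - exact: integrableZlR.
  - move=> x; rewrite distrC (le_trans (lgn_laplace_taylor _ v0 v1)) ?mulr_ge0//.
    by rewrite exprMn le_eqVlt; apply/orP; left; apply/eqP; ring.
rewrite (_ : laplace P Y c - _ = (laplace P Y c - \int[P]_x m x) +
  (\int[P]_x m x - \int[P]_x laplace gam (lgn v) (c * X x))); last by ring.
by apply: le_trans (ler_normD _ _) _; exact: lerD.
Qed.

(** A product of independent log-normals is log-normal with added variances, by [gauss_convolution].
    This lets successive block factors merge. *)
Lemma laplace_lgnD s v c : 0 <= s -> 0 < v -> 0 <= c ->
  \int[gam]_y laplace gam (lgn s) (c * lgn v y) = laplace gam (lgn (s + v)) c.
Proof.
move=> s0 v0 c0; apply: EFin_inj.
have mF : measurable_fun setT (fun x : R => (expR (- (c * expR (x - (s + v) / 2))))%:E).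
  apply/measurable_EFinP; apply: measurableT_comp => //; apply: measurableT_comp => //.
  by apply: measurable_funM => //; apply: measurableT_comp => //; exact: measurable_funB.
have F0 (x : R) : (0 <= (expR (- (c * expR (x - (s + v) / 2))))%:E)%E by rewrite lee_fin expR_ge0.
rewrite EFin_laplace_mix//; [|exact: measurable_lgn|exact: lgn_ge0|exact: measurable_lgn|exact: lgn_ge0].
rewrite EFin_laplace//; [|exact: measurable_lgn|exact: lgn_ge0].
have eqF y x : (expR (- (c * lgn v y * lgn s x)))%:E =
    (expR (- (c * expR (Num.sqrt s * x + Num.sqrt v * y - (s + v) / 2))))%:E.
  by rewrite /lgn -mulrA -expRD; congr (expR (- (c * expR _)))%:E; field.
under eq_integral do under eq_integral do rewrite eqF.
(* For [s = 0] the first factor is the constant 1, and [gauss_convolution] asks for a positive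
   coefficient. *)
have [s_eq0|s_neq0] := eqVneq s 0.
  rewrite s_eq0 sqrtr0 add0r.
  by apply: eq_integral => y _; under eq_integral do rewrite mul0r add0r; rewrite integral_prob_cst.
have s_gt0 : 0 < s by rewrite lt_def s_neq0.
apply: (gauss_convolution (f := fun x => (expR (- (c * expR (x - (s + v) / 2))))%:E)) => //.
- by rewrite sqrtr_gt0.
- by rewrite sqrtr_gt0 addr_gt0.
- by rewrite !sqr_sqrtr ?addr_ge0// ltW.
Qed.

End lognormal.

(** * The rank-one likelihood ratio as a martingale in the truncation level *)

Section rank_one.
Context {R : realType} (lam w2 : R).
Hypotheses (lam0 : 0 < lam) (lam1 : lam < 1) (w20 : 0 < w2).
Variables (prior : probability R R) (q : R -> R) (B : R).
Hypotheses (B1 : 1 <= B) (mq : measurable_fun setT q) (qB : forall x, `|q x| <= B).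
Hypothesis q1 : (\int[prior]_x (q x)%:E = 0)%E.
Hypothesis q2 : (\int[prior]_x (q x ^+ 2)%:E = 1)%E.
Variables (mu : forall N K, probability 'M[R]_(N, K) R) (G : forall N, probability 'M[R]_N R).
Hypotheses (hmu : forall N K, iid_law prior (mu N K)) (hG : forall N, wigner_law w2 (G N)).

Local Notation lV := (logV lam w2).
Local Notation rlik := (replica_lik lam w2 q mu).
Local Notation rk a := (@rank1 R lam w2 q mu a).
Local Notation reps := (replicas lam w2 q mu).

Let reg N K d n := @regular_spikes R lam w2 w20 q B B1 mq qB N K d n.

Section fixed_N.
Context {N : nat}.

Lemma replica_lik_level_eq K d n n' : (forall p, supper p -> n p = n' p) ->
  @replica_lik R lam w2 q mu N K d n = @replica_lik R lam w2 q mu N K d n'.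
Proof.
move=> nn'; rewrite /replica_lik; congr (lik _ _ _ _); apply/funext => X.
by apply: eq_bigr => p sp; rewrite nn'.
Qed.

Lemma rank1_shift a K (d d' : 'I_K -> nat) (X : 'M[R]_(N, K)) w :
  (forall i, minn a (d i) = minn a (d' i)) ->
  rk a (w + spikes lam q d X) = rk a (w + spikes lam q d' X).
Proof.
move=> dd'; apply: eq_Rintegral => Z _; rewrite /lexp !mxipDr.
suff -> : mxip w2 (spikes lam q (fun=> a) Z) (spikes lam q d X) =
  mxip w2 (spikes lam q (fun=> a) Z) (spikes lam q d' X) by [].
rewrite ![mxip w2 (spikes _ _ _ Z) _]mxipC !mxip_suml; apply: eq_bigr => i _.
rewrite ![mxip w2 _ (spikes _ _ _ Z)]mxipC !mxip_suml; apply: eq_bigr => j _.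
by rewrite !mxip_spike dd'.
Qed.

(** Tilting by [rlik d n] amounts to shifting the noise by the spikes at levels [d], so a function
    that does not see the difference between two families of levels allows one to replace the
    other. *)
Lemma integral_replica_lik_shift K (d d' : 'I_K -> nat) n (f : 'M[R]_N -> \bar R) :
  measurable_fun setT f -> (forall w, 0 <= f w)%E ->
  (forall w X, f (w + spikes lam q d X) = f (w + spikes lam q d' X)) ->
  (\int[G N]_w (f w * (rlik d n w)%:E) = \int[G N]_w (f w * (rlik d' n w)%:E))%E.
Proof.
move=> mf f0 fdd'.
apply: etrans (integral_lik w20 (mu N K) (@reg N K d n) (@hG N) mf f0) _.
apply: etrans _ (esym (integral_lik w20 (mu N K) (@reg N K d' n) (@hG N) mf f0)).
by apply: eq_integral => X _; congr (_ * _)%E; apply: eq_integral => w _; rewrite fdd'.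
Qed.

Lemma measurable_rank1 a : measurable_fun setT (rk a (N := N)).
Proof. exact: (measurable_replica_lik lam w20 B1 mq qB). Qed.

Lemma rank1_ge0 a w : 0 <= rk a (N := N) w.
Proof. exact: (replica_lik_ge0 lam w20 B1 mq qB). Qed.

Let Rintegral_EFin_eq (f g : 'M[R]_N -> R) :
  (\int[G N]_w (f w)%:E = \int[G N]_w (g w)%:E)%E -> \int[G N]_w f w = \int[G N]_w g w.
Proof. by rewrite /Rintegral => ->. Qed.

Section conditional.
Variables (a b : nat) (e : R -> R).
Hypotheses (ab : (a <= b)%N) (me : measurable_fun setT e) (e0 : forall x, 0 <= e x).

Let f (w : 'M[R]_N) : \bar R := (e (rk a w))%:E.
Let mf : measurable_fun setT f.
Proof. by apply/measurable_EFinP; exact: (measurableT_comp me (measurable_rank1 a)). Qed.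
Let f0 w : (0 <= f w)%E. Proof. by rewrite lee_fin. Qed.

Let f_shift K w (X : 'M[R]_(N, K)) :
  f (w + spikes lam q (fun=> b) X) = f (w + spikes lam q (fun=> a) X).
Proof. by rewrite /f (@rank1_shift a K (fun=> b) (fun=> a))// => i; rewrite minnn (minn_idPl ab). Qed.

(** Adding the rows between [a] and [b] to the spike does not change the
    projection on the first [a] rows, so [rank1 a] is a conditional
    expectation of [rank1 b]. *)
Lemma rank1_martingale : \int[G N]_w (e (rk a w) * rk b w) = \int[G N]_w (e (rk a w) * rk a w).
Proof.
apply: Rintegral_EFin_eq.
exact: (@integral_replica_lik_shift 1 (fun=> b) (fun=> a) (fun=> 0%N) f mf f0 (@f_shift 1)).
Qed.

(** The square is a pair of replicas with spikes and overlap at level [b]. Functions of [rk a] see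
    the spikes only up to level [a], but the overlap stays at [b]: conditional second moments need
    [d] and [n] to differ. *)
Lemma rank1_sqr : \int[G N]_w (e (rk a w) * rk b w ^+ 2) =
  \int[G N]_w (e (rk a w) * rlik (N := N) (K := 2) (fun=> a) (fun=> b) w).
Proof.
apply: Rintegral_EFin_eq; under [RHS]eq_integral do rewrite EFinM.
have bE w : rk b w ^+ 2 = rlik (N := N) (K := 2) (fun=> b) (fun=> b) w.
  rewrite expr2 /rank1 (replica_likM lam w20 B1 mq qB hmu).
  rewrite (_ : split_fun _ _ = fun=> b); last first.
    by apply/funext => i; rewrite /split_fun; case: fintype.split.
  apply: (congr1 (fun F : 'M[R]_N -> R => F w)); apply: (@replica_lik_level_eq (1 + 1)) => -[i j] ij.
  rewrite /split_fun2/=.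
  case: (fintype.splitP i) => k ik; case: (fintype.splitP j) => l jl.
  - by move: ij; rewrite /supper /= ik jl !ord1.
  - by rewrite minnn.
  - by rewrite minnn.
  - by move: ij; rewrite /supper /= ik jl !ord1.
transitivity (\int[G N]_w (f w * (rlik (N := N) (K := 2) (fun=> b) (fun=> b) w)%:E))%E.
  by apply: eq_integral => w _; rewrite EFinM; congr (_ * _%:E)%E; exact: bE.
exact: (@integral_replica_lik_shift 2 (fun=> b) (fun=> a) (fun=> b) f mf f0 (@f_shift 2)).
Qed.

End conditional.
End fixed_N.

Lemma replicas_measurable s f e N : reps s f e -> measurable_fun setT (f N).
Proof.
move=> [K [t [d [n [u [_ _ _ _ fE]]]]]].
rewrite (_ : f N = rlik (d N) (n N)); last by apply/funext => w.
exact: (measurable_replica_lik lam w20 B1 mq qB).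
Qed.

Lemma replicas_ge0 s f e N w : reps s f e -> 0 <= f N w.
Proof.
move=> [K [t [d [n [u [_ _ _ _ ->]]]]]].
exact: (replica_lik_ge0 lam w20 B1 mq qB).
Qed.

Lemma replicas_integrable s f e N : reps s f e -> (G N).-integrable setT (EFin \o f N).
Proof.
move=> h; have f0 w := replicas_ge0 w h; have mf := @replicas_measurable _ _ _ N h.
apply/integrableP; split; first exact/measurable_EFinP.
under eq_integral do rewrite /= ger0_norm//.
case: h => [K [t [d [n [u [_ _ _ _ fE]]]]]].
under eq_integral do rewrite fE.
rewrite (integral_replica_lik lam w20 B1 mq qB _ hG).
have [_ _ _ mC [c Cc]] := @reg N K (d N) (n N).
apply: (@le_lt_trans _ _ (expR c)%:E); last exact: ltry.
rewrite -[leRHS](integral_prob_cst (mu N K)); apply: ge0_le_integral => //.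
- by apply/measurable_EFinP; exact: measurableT_comp.
- by move=> X _; rewrite lee_fin ler_expR (le_trans (ler_norm _)).
Qed.

Variable kmax : nat.
Hypothesis small : 4 * lam * (kmax ^ 2)%:R * B ^+ 4 < 1.

Lemma replicas_Rcvg s f e : (size s <= kmax)%N -> reps s f e ->
  \int[G N]_w f N w @[N --> \oo] --> expR e.
Proof.
move=> sk h.
have sm : 4 * lam * (size s ^ 2)%:R * B ^+ 4 < 1.
  apply: le_lt_trans small; apply: ler_wpM2r; first by rewrite exprn_ge0// (le_trans ler01).
  apply: ler_wpM2l; first by rewrite mulr_ge0// ltW.
  by rewrite ler_nat leq_exp2r.
have /fine_cvgP[_] := replicas_cvg lam0 lam1 w20 B1 mq qB q1 q2 hmu hG sm h.
exact.
Qed.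

End rank_one.

Section lindeberg.
Context {R : realType} (lam w2 : R).
Hypotheses (lam0 : 0 < lam) (lam1 : lam < 1) (w20 : 0 < w2).
Variables (prior : probability R R) (q : R -> R) (B : R).
Hypotheses (B1 : 1 <= B) (mq : measurable_fun setT q) (qB : forall x, `|q x| <= B).
Hypothesis q1 : (\int[prior]_x (q x)%:E = 0)%E.
Hypothesis q2 : (\int[prior]_x (q x ^+ 2)%:E = 1)%E.
Variables (mu : forall N K, probability 'M[R]_(N, K) R) (G : forall N, probability 'M[R]_N R).
Hypotheses (hmu : forall N K, iid_law prior (mu N K)) (hG : forall N, wigner_law w2 (G N)).
Variable kmax : nat.
Hypothesis small : 4 * lam * (kmax ^ 2)%:R * B ^+ 4 < 1.

Local Notation lV := (logV lam w2).
Local Notation rlik := (replica_lik lam w2 q mu).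
Local Notation rk a := (@rank1 R lam w2 q mu a).
Local Notation reps := (replicas lam w2 q mu).

Let Rcvg s f e := @replicas_Rcvg R lam w2 lam0 lam1 w20 prior q B B1 mq qB q1 q2 mu G hmu hG
  kmax small s f e.
Let Rint s f e N := @replicas_integrable R lam w2 w20 q B B1 mq qB mu G hG s f e N.
Let repM s s' f f' e e' :=
  @replicasM R lam w2 w20 prior q B B1 mq qB mu hmu s s' f f' e e'.

Lemma flatten_nseq1 (T : Type) k (x : T) : flatten (nseq k [:: x]) = nseq k x.
Proof. by elim: k => //= k ->. Qed.

Lemma replicas_rank1X a t k : (forall N, (a N <= N)%N) ->
  (a N)%:R / N%:R @[N --> \oo] --> t ->
  reps (nseq k t) (fun N w => rk (a N) w ^+ k) (k%:R * (k%:R - 1) / 2 * lV t).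
Proof.
move=> aN at_; have := replicasX w20 B1 mq qB hmu k (replicas_rank1 lam w2 q mu aN at_).
by rewrite flatten_nseq1 mulr0 add0r !big_seq1 minxx.
Qed.

Lemma sum_nseq2 i j (x y : R) (F : R -> R -> R) :
  \sum_(u <- nseq i x) \sum_(v <- nseq j y) F u v = i%:R * j%:R * F x y.
Proof.
rewrite big_nseq iter_addr_0 big_nseq iter_addr_0 -mulr_natr -(mulr_natr (F x y)).
by ring.
Qed.

Section two_levels.
Variables (a b : nat -> nat) (x y : R).
Hypotheses (ab : forall N, (a N <= b N)%N) (bN : forall N, (b N <= N)%N).
Hypotheses (ax : (a N)%:R / N%:R @[N --> \oo] --> x) (by_ : (b N)%:R / N%:R @[N --> \oo] --> y).
Hypothesis xy : x <= y.

Let aN N : (a N <= N)%N. Proof. exact: leq_trans (ab N) (bN N). Qed.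
Let X N (w : 'M[R]_N) : R := rk (a N) w.
Let Y N (w : 'M[R]_N) : R := rk (b N) w.
Let W N (w : 'M[R]_N) : R := rlik (K := 2) (fun=> a N) (fun=> b N) w.

Lemma replicas_XY i j : reps (nseq j y ++ nseq i x) (fun N w => Y w ^+ j * X w ^+ i)
  (j%:R * (j%:R - 1) / 2 * lV y + i%:R * (i%:R - 1) / 2 * lV x + j%:R * i%:R * lV x).
Proof.
have := repM (replicas_rank1X j bN by_) (replicas_rank1X i aN ax).
by rewrite (sum_nseq2 j i y x (fun u v => lV (Num.min u v))) (min_idPr xy).
Qed.

Let v : R := lV y - lV x.

Hypothesis kmax4 : (4 <= kmax)%N.

Let cvgXY i j : (j + i <= 4)%N -> \int[G N]_w (Y w ^+ j * X w ^+ i) @[N --> \oo] -->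
  expR (j%:R * (j%:R - 1) / 2 * lV y + i%:R * (i%:R - 1) / 2 * lV x + j%:R * i%:R * lV x).
Proof.
move=> ij; apply: Rcvg (replicas_XY i j); rewrite size_cat !size_nseq.
exact: leq_trans kmax4.
Qed.

Let intXY i j N : (G N).-integrable setT (EFin \o (fun w => Y w ^+ j * X w ^+ i)).
Proof. exact: Rint N (replicas_XY i j). Qed.

Lemma cvg_increment2 : \int[G N]_w ((Y w - X w) ^+ 2) @[N --> \oo] -->
  expR (lV x) * (expR v - 1).
Proof.
have e N : \int[G N]_w ((Y w - X w) ^+ 2) = \int[G N]_w (Y w ^+ 2 * X w ^+ 0) +
    (-2) * \int[G N]_w (Y w ^+ 1 * X w ^+ 1) + \int[G N]_w (Y w ^+ 0 * X w ^+ 2).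
  rewrite -expectationZ// -!expectationD//; try exact: integrableZlR.
    by apply: eq_Rintegral => w _; ring.
  by apply: integrableDR => //; exact: integrableZlR.
under eq_cvg do rewrite e.
have -> : expR (lV x) * (expR v - 1) = expR (2 * (2 - 1) / 2 * lV y + 0 * (0 - 1) / 2 * lV x + 2 * 0 * lV x) +
    (-2) * expR (1 * (1 - 1) / 2 * lV y + 1 * (1 - 1) / 2 * lV x + 1 * 1 * lV x) +
    expR (0 * (0 - 1) / 2 * lV y + 2 * (2 - 1) / 2 * lV x + 0 * 2 * lV x).
  rewrite mulrBr -expRD (_ : lV x + v = lV y); last by rewrite /v; ring.
  rewrite (_ : 2 * (2 - 1) / 2 * lV y + 0 * (0 - 1) / 2 * lV x + 2 * 0 * lV x = lV y); last by field.
  rewrite (_ : 1 * (1 - 1) / 2 * lV y + 1 * (1 - 1) / 2 * lV x + 1 * 1 * lV x = lV x); last by field.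
  rewrite (_ : 0 * (0 - 1) / 2 * lV y + 2 * (2 - 1) / 2 * lV x + 0 * 2 * lV x = lV x); last by field.
  by ring.
apply: cvgD; last exact: cvgXY.
by apply: cvgD; [exact: cvgXY|apply: cvgMr; exact: cvgXY].
Qed.

(** The limit is the one predicted by Y = X L with L an independent [lgn v]: the limiting fourth
    moment of X times the centered fourth moment of L. *)
Lemma cvg_increment4 : \int[G N]_w ((Y w - X w) ^+ 4) @[N --> \oo] -->
  expR (6 * lV x) * (expR (6 * v) - 4 * expR (3 * v) + 6 * expR v - 3).
Proof.
have e N : \int[G N]_w ((Y w - X w) ^+ 4) = \int[G N]_w (Y w ^+ 4 * X w ^+ 0) +
    (-4) * \int[G N]_w (Y w ^+ 3 * X w ^+ 1) + 6 * \int[G N]_w (Y w ^+ 2 * X w ^+ 2) +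
    (-4) * \int[G N]_w (Y w ^+ 1 * X w ^+ 3) + \int[G N]_w (Y w ^+ 0 * X w ^+ 4).
  rewrite -!expectationZ// -!expectationD//; do ?apply: integrableDR => //; do ?exact: integrableZlR.
  by apply: eq_Rintegral => w _; ring.
under eq_cvg do rewrite e.
have -> : expR (6 * lV x) * (expR (6 * v) - 4 * expR (3 * v) + 6 * expR v - 3) =
    expR (4 * (4 - 1) / 2 * lV y + 0 * (0 - 1) / 2 * lV x + 4 * 0 * lV x) +
    (-4) * expR (3 * (3 - 1) / 2 * lV y + 1 * (1 - 1) / 2 * lV x + 3 * 1 * lV x) +
    6 * expR (2 * (2 - 1) / 2 * lV y + 2 * (2 - 1) / 2 * lV x + 2 * 2 * lV x) +
    (-4) * expR (1 * (1 - 1) / 2 * lV y + 3 * (3 - 1) / 2 * lV x + 1 * 3 * lV x) +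
    expR (0 * (0 - 1) / 2 * lV y + 4 * (4 - 1) / 2 * lV x + 0 * 4 * lV x).
  have -> : expR (6 * lV x) * (expR (6 * v) - 4 * expR (3 * v) + 6 * expR v - 3) =
     expR (6 * lV x + 6 * v) - 4 * expR (6 * lV x + 3 * v) + 6 * expR (6 * lV x + v) - 3 * expR (6 * lV x).
    by rewrite !expRD; ring.
  rewrite (_ : 4 * (4 - 1) / 2 * lV y + 0 * (0 - 1) / 2 * lV x + 4 * 0 * lV x = 6 * lV x + 6 * v); last by rewrite /v; field.
  rewrite (_ : 3 * (3 - 1) / 2 * lV y + 1 * (1 - 1) / 2 * lV x + 3 * 1 * lV x = 6 * lV x + 3 * v); last by rewrite /v; field.
  rewrite (_ : 2 * (2 - 1) / 2 * lV y + 2 * (2 - 1) / 2 * lV x + 2 * 2 * lV x = 6 * lV x + v); last by rewrite /v; field.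
  rewrite (_ : 1 * (1 - 1) / 2 * lV y + 3 * (3 - 1) / 2 * lV x + 1 * 3 * lV x = 6 * lV x); last by field.
  rewrite (_ : 0 * (0 - 1) / 2 * lV y + 4 * (4 - 1) / 2 * lV x + 0 * 4 * lV x = 6 * lV x); last by field.
  by ring.
apply: cvgD; last exact: cvgXY.
apply: cvgD; last by apply: cvgMr; exact: cvgXY.
apply: cvgD; last by apply: cvgMr; exact: cvgXY.
by apply: cvgD; [exact: cvgXY|apply: cvgMr; exact: cvgXY].
Qed.

Let repW : reps (nseq 2 x) W (lV y).
Proof.
have := replicas_level lam w2 q mu 2 aN bN ax by_.
by rewrite (_ : 2%:R * (2%:R - 1) / 2 * lV y = lV y)//; field.
Qed.

Let repWW : reps (nseq 2 x ++ nseq 2 x) (fun N w => W w * W w) (2 * lV y + 4 * lV x).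
Proof.
have := repM repW repW; rewrite (sum_nseq2 2 2 x x (fun u v => lV (Num.min u v))) minxx.
by rewrite (_ : lV y + lV y + 2%:R * 2%:R * lV x = 2 * lV y + 4 * lV x)//; ring.
Qed.

Let repX2 : reps (nseq 2 x) (fun N w => X w ^+ 2) (lV x).
Proof.
have := replicas_rank1X 2 aN ax.
by rewrite (_ : 2%:R * (2%:R - 1) / 2 * lV x = lV x)//; field.
Qed.

Let repWX : reps (nseq 2 x ++ nseq 2 x) (fun N w => W w * X w ^+ 2) (lV y + 5 * lV x).
Proof.
have := repM repW repX2; rewrite (sum_nseq2 2 2 x x (fun u v => lV (Num.min u v))) minxx.
by rewrite (_ : lV y + lV x + 2%:R * 2%:R * lV x = lV y + 5 * lV x)//; ring.
Qed.

(** The conditional second moment of Y given X is asymptotically the multiple [expR v] of X^2. The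
    three limits after expansion have the common value exp(2 lV y + 4 lV x) with coefficients 1, -2
    and 1. *)
Lemma cvg_second_moment_gap :
  \int[G N]_w ((W w - expR v * X w ^+ 2) ^+ 2) @[N --> \oo] --> (0 : R).
Proof.
have e N : \int[G N]_w ((W w - expR v * X w ^+ 2) ^+ 2) = \int[G N]_w (W w * W w) +
    (-2 * expR v) * \int[G N]_w (W w * X w ^+ 2) + expR v ^+ 2 * \int[G N]_w (Y w ^+ 0 * X w ^+ 4).
  have i1 := Rint N repWW; have i2 := Rint N repWX.
  rewrite -!expectationZ// -!expectationD//; do ?apply: integrableDR => //; do ?exact: integrableZlR.
  by apply: eq_Rintegral => w _; ring.
have z : expR (2 * lV y + 4 * lV x) + (-2 * expR v) * expR (lV y + 5 * lV x) +
    expR v ^+ 2 * expR (0 * (0 - 1) / 2 * lV y + 4 * (4 - 1) / 2 * lV x + 0 * 4 * lV x) = 0.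
  rewrite (_ : 0 * (0 - 1) / 2 * lV y + 4 * (4 - 1) / 2 * lV x + 0 * 4 * lV x = 6 * lV x); last by field.
  rewrite (_ : 2 * lV y + 4 * lV x = 6 * lV x + v + v); last by rewrite /v; ring.
  rewrite (_ : lV y + 5 * lV x = 6 * lV x + v); last by rewrite /v; ring.
  by rewrite !expRD; ring.
rewrite -[X in _ --> X]z.
under eq_cvg do rewrite e.
apply: cvgD; last by apply: cvgMr; exact: cvgXY.
by apply: cvgD; [exact: Rcvg repWW|apply: cvgMr; exact: Rcvg repWX].
Qed.

(** Uniformity in [c] is essential, as [c] will be multiplied by an unbounded log-normal variable.
    The constant is 1806 = 903 + 903, one half from the increments of Y, 21 (2 + 84) / 2, the other
    from the log-normal factor. *)
Lemma lindeberg_limit eps : 0 < v -> v <= 1 / 12 -> 0 <= lV x -> 0 < eps ->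
  \forall N \near \oo, forall c, 0 <= c ->
  `|laplace (G N) (@Y N) c - \int[gauss 1]_z laplace (G N) (@X N) (c * lgn v z)| <=
  c ^+ 2 * eps + c ^+ 3 * (1806 * expR (6 * lV x) * (v * Num.sqrt v) + eps).
Proof.
move=> v0 v1 V0 e0.
have half_le u : u <= eps -> 2^-1 * ((eps + u) / 2) <= eps by lra.
have sv : 0 < Num.sqrt v by rewrite sqrtr_gt0.
have sv2 : Num.sqrt v ^+ 2 = v by rewrite sqr_sqrtr// ltW.
pose U N := 21 * ((Num.sqrt v * \int[G N]_w ((Y w - X w) ^+ 2) +
    (Num.sqrt v)^-1 * \int[G N]_w ((Y w - X w) ^+ 4)) / 2) +
  903 * (v * Num.sqrt v) * \int[G N]_w (Y w ^+ 0 * X w ^+ 3).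
pose l := 21 * ((Num.sqrt v * (expR (lV x) * (expR v - 1)) + (Num.sqrt v)^-1 *
    (expR (6 * lV x) * (expR (6 * v) - 4 * expR (3 * v) + 6 * expR v - 3))) / 2) +
    903 * (v * Num.sqrt v) *
    expR (0 * (0 - 1) / 2 * lV y + 3 * (3 - 1) / 2 * lV x + 0 * 3 * lV x).
have Ul : U N @[N --> \oo] --> l.
  apply: cvgD; last by apply: cvgMr; exact: cvgXY.
  apply: cvgMr; apply: cvgMl; apply: cvgD; apply: cvgMr; first exact: cvg_increment2.
  exact: cvg_increment4.
have ll : l <= 1806 * expR (6 * lV x) * (v * Num.sqrt v).
  have [b1 b2] := expR_increment_bounds v0 v1.
  rewrite /l (_ : 0 * (0 - 1) / 2 * lV y + 3 * (3 - 1) / 2 * lV x + 0 * 3 * lV x = 3 * lV x); last by field.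
  have E6 : 0 < expR (6 * lV x) by exact: expR_gt0.
  have e1 : expR (lV x) <= expR (6 * lV x) by rewrite ler_expR; lra.
  have e3 : expR (3 * lV x) <= expR (6 * lV x) by rewrite ler_expR; lra.
  have t1 : Num.sqrt v * (expR (lV x) * (expR v - 1)) <= Num.sqrt v * (expR (6 * lV x) * (2 * v)).
    rewrite ler_pM2l//; apply: ler_pM; [exact: expR_ge0| |exact: e1|exact: b1].
    by rewrite subr_ge0 -expR0 ler_expR ltW.
  have t2 : (Num.sqrt v)^-1 * (expR (6 * lV x) * (expR (6 * v) - 4 * expR (3 * v) + 6 * expR v - 3))
      <= expR (6 * lV x) * (84 * (v * Num.sqrt v)).
    rewrite mulrCA ler_pM2l// ler_pdivrMl// (le_trans b2)//.
    have -> : Num.sqrt v * (84 * (v * Num.sqrt v)) = 84 * v * Num.sqrt v ^+ 2 by ring.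
    by rewrite sv2 -mulrA -expr2.
  have t3 : 903 * (v * Num.sqrt v) * expR (3 * lV x) <= 903 * (v * Num.sqrt v) * expR (6 * lV x).
    by apply: ler_wpM2l e3; apply: mulr_ge0; [exact: ler0n|exact/ltW/mulr_gt0].
  rewrite (_ : 1806 * expR (6 * lV x) * (v * Num.sqrt v) = 1806 * (expR (6 * lV x) * (v * Num.sqrt v))); last by ring.
  move: t1; rewrite (_ : Num.sqrt v * (expR (6 * lV x) * (2 * v)) = 2 * (expR (6 * lV x) * (v * Num.sqrt v))); last by ring.
  move: t2; rewrite (_ : expR (6 * lV x) * (84 * (v * Num.sqrt v)) = 84 * (expR (6 * lV x) * (v * Num.sqrt v))); last by ring.
  move: t3; rewrite (_ : 903 * (v * Num.sqrt v) * expR (6 * lV x) = 903 * (expR (6 * lV x) * (v * Num.sqrt v))); last by ring.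
  move: (expR (6 * lV x) * (v * Num.sqrt v)) (Num.sqrt v * _) (_^-1 * _) (_ * expR (3 * lV x)) => P1 P2 P3 P4.
  by lra.
have /cvgr_lt/(_ (1806 * expR (6 * lV x) * (v * Num.sqrt v) + eps)) hU := Ul.
(* The square compensates the division by [eps] in the Lindeberg bound. *)
have /cvgr_lt/(_ (eps ^+ 2)) hW := cvg_second_moment_gap.
near=> N; move=> c c0.
have UN : U N <= 1806 * expR (6 * lV x) * (v * Num.sqrt v) + eps.
  by apply: ltW; near: N; apply: hU; lra.
have WN : \int[G N]_w ((W w - expR v * X w ^+ 2) ^+ 2) <= eps ^+ 2.
  by apply: ltW; near: N; apply: hW; rewrite exprn_gt0.
have mX : measurable_fun setT (@X N) by exact: (measurable_rank1 lam w20 B1 mq qB).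
have mY : measurable_fun setT (@Y N) by exact: (measurable_rank1 lam w20 B1 mq qB).
have mW : measurable_fun setT (@W N) by exact: (measurable_replica_lik lam w20 B1 mq qB).
have X0 w : 0 <= @X N w by exact: (rank1_ge0 lam w20 B1 mq qB).
have Y0 w : 0 <= @Y N w by exact: (rank1_ge0 lam w20 B1 mq qB).
have W0 w : 0 <= @W N w by exact: (replica_lik_ge0 lam w20 B1 mq qB).
have iX k : (G N).-integrable setT (EFin \o (fun w => X w ^+ k)).
  by have := intXY k 0 N; under [X in _ \o X]eq_fun do rewrite mul1r.
have iY k : (G N).-integrable setT (EFin \o (fun w => Y w ^+ k)).
  by have := intXY 0 k N; under [X in _ \o X]eq_fun do rewrite mulr1.
have iW : (G N).-integrable setT (EFin \o (fun w => W w ^+ 2)) := Rint N repWW.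
apply: le_trans (lindeberg_step (eps := eps) mX mY mW X0 Y0 W0 (iX 4) (iY 4) iW (iX 3) (iX 2) c0 e0 v0 v1 _ _) _.
- by move=> e me e'0 _; exact: (rank1_martingale lam w20 B1 mq qB mu hG (ab N) me e'0).
- by move=> e me e'0 _; exact: (rank1_sqr lam w20 B1 mq qB hmu hG (ab N) me e'0).
have c2 : 0 <= c ^+ 2 by exact: sqr_ge0.
have c3 : 0 <= c ^+ 3 by exact: exprn_ge0.
rewrite -addrA; apply: lerD.
  rewrite -mulrA; apply: ler_wpM2l => //.
  by apply: half_le; rewrite ler_pdivrMr.
apply: le_trans (ler_wpM2l c3 UN).
have eX3 : \int[G N]_w (Y w ^+ 0 * X w ^+ 3) = \int[G N]_w (X w ^+ 3).
  have e1 (r t : R) : r ^+ 0 * t = t by rewrite expr0 mul1r.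
  by apply: eq_Rintegral => w _; exact: e1.
rewrite /U eX3.
by rewrite le_eqVlt; apply/orP; left; apply/eqP; field; rewrite gt_eqF.
Unshelve. all: by end_near. Qed.

End two_levels.
End lindeberg.

Section logV_bounds.
Context {R : realType} (lam w2 : R).
Hypotheses (lam0 : 0 < lam) (lam1 : lam < 1) (w20 : 0 < w2).
Local Notation lV := (logV lam w2).

Lemma ln_le_subr1 (z : R) : 0 < z -> ln z <= z - 1.
Proof. by move=> z0; have := expR_ge1Dx (ln z); rewrite lnK//; lra. Qed.

Let one_sub_gt0 (z : R) : z <= 1 -> 0 < 1 - lam * z.
Proof. by move=> z1; rewrite subr_gt0 (le_lt_trans _ lam1)// ler_piMr// ltW. Qed.

(** The derivative of [logV] is lam/w2 + (lam/2) (1/(1 - lam t) - 1), at least lam/w2. Strictly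
    positive increments are needed because each step divides by their square root. *)
Lemma logV_increment_ge (x y : R) : 0 <= x -> x <= y -> y <= 1 ->
  lam / w2 * (y - x) <= lV y - lV x.
Proof.
move=> x0 xy y1.
have p0 : 0 < 1 - lam * x by exact: one_sub_gt0 (le_trans xy y1).
have r0 : 0 < 1 - lam * y by exact: one_sub_gt0.
have := ln_le_subr1 (divr_gt0 r0 p0); rewrite ln_div ?posrE// => h.
have h2 : (1 - lam * y) / (1 - lam * x) - 1 <= - lam * (y - x).
  have t0 : 0 <= (lam * x) * (lam * (y - x)).
    by apply: mulr_ge0; apply: mulr_ge0; rewrite ?subr_ge0// ltW.
  by rewrite lerBlDr ler_pdivrMr//; nra.
rewrite (_ : lV y - lV x = - (ln (1 - lam * y) - ln (1 - lam * x)) / 2 + lam / w2 * (y - x) - lam * (y - x) / 2).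
  by move: h h2; rewrite mulNr; move: (lam * _) (lam / _ * _) (ln _ - _) (_ / _ - 1) => t1 t2 t3 t4; lra.
by rewrite /logV; field; rewrite gt_eqF.
Qed.

Lemma logV_increment_le (x y : R) : 0 <= x -> x <= y -> y <= 1 ->
  lV y - lV x <= (lam / (1 - lam) / 2 + lam / w2) * (y - x).
Proof.
move=> x0 xy y1.
have l1 : 0 < 1 - lam by rewrite subr_gt0.
have p0 : 0 < 1 - lam * x by exact: one_sub_gt0 (le_trans xy y1).
have r0 : 0 < 1 - lam * y by exact: one_sub_gt0.
have := ln_le_subr1 (divr_gt0 p0 r0); rewrite ln_div ?posrE// => h.
have h2 : (1 - lam * x) / (1 - lam * y) - 1 <= lam / (1 - lam) * (y - x).
  have -> : (1 - lam * x) / (1 - lam * y) - 1 = lam * (y - x) / (1 - lam * y) by field; rewrite gt_eqF.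
  rewrite [leRHS]mulrAC; apply: ler_wpM2l; first by rewrite mulr_ge0 ?subr_ge0// ltW.
  by rewrite lef_pV2 ?posrE// lerD2l lerN2 ler_piMr// ltW.
have h3 : 0 <= lam * (y - x) by rewrite mulr_ge0 ?subr_ge0// ltW.
rewrite (_ : lV y - lV x = (ln (1 - lam * x) - ln (1 - lam * y)) / 2 + lam / w2 * (y - x) - lam * (y - x) / 2); last first.
  by rewrite /logV; field; rewrite gt_eqF.
rewrite (_ : (lam / (1 - lam) / 2 + lam / w2) * (y - x) = lam / (1 - lam) * (y - x) / 2 + lam / w2 * (y - x)); last first.
  by field; rewrite !gt_eqF.
move: h h2 h3; move: (lam * _) (lam / w2 * _) (lam / _ * _) (ln _ - _) (_ / _ - 1) => t1 t2 t3 t4 t5; lra.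
Qed.

Lemma logV_ge0 (x : R) : 0 <= x -> x <= 1 -> 0 <= lV x.
Proof.
move=> x0 x1; have := logV_increment_ge (lexx 0) x0 x1.
by rewrite logV0 !subr0; apply: le_trans; rewrite mulr_ge0// divr_ge0// ltW.
Qed.

Lemma logV_le (x y : R) : 0 <= x -> x <= y -> y <= 1 -> lV x <= lV y.
Proof.
move=> x0 xy y1; rewrite -subr_ge0; apply: le_trans (logV_increment_ge x0 xy y1).
by rewrite mulr_ge0 ?subr_ge0// divr_ge0// ltW.
Qed.

End logV_bounds.

Lemma cvg_invn (R : realType) : (N%:R : R)^-1 @[N --> \oo] --> (0 : R).
Proof.
apply/gtr0_cvgV0; last exact: cvgr_idn.
by near=> N; rewrite ltr0n; near: N; exists 1%N.
Unshelve. all: by end_near. Qed.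

Lemma cvg_floor_ratio (R : realType) (m M : nat) : (0 < M)%N ->
  ((m * N) %/ M)%:R / N%:R @[N --> \oo] --> (m%:R / M%:R : R).
Proof.
move=> M0; apply: (cvg_approx (b := fun=> m%:R / M%:R) (e := fun N => N%:R^-1)).
- exact: cvg_cst.
- exact: cvg_invn.
- near=> N; have N0 : (0 < N)%N by near: N; exists 1%N.
  have MR : (0 : R) < M%:R by rewrite ltr0n.
  have NR : (0 : R) < N%:R by rewrite ltr0n.
  have e : (m%:R * N%:R : R) = ((m * N) %/ M)%:R * M%:R + ((m * N) %% M)%:R.
    by rewrite -!natrM -natrD -divn_eq.
  have r1 : ((m * N) %% M)%:R <= M%:R :> R by rewrite ler_nat ltnW// ltn_mod.
  have r0 : (0 : R) <= ((m * N) %% M)%:R by [].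
  have -> : ((m * N) %/ M)%:R / N%:R - m%:R / M%:R = - (((m * N) %% M)%:R / M%:R) / N%:R :> R.
    have -> : ((m * N) %% M)%:R = m%:R * N%:R - ((m * N) %/ M)%:R * M%:R :> R by rewrite e addrAC subrr add0r.
    by field; rewrite !gt_eqF.
  rewrite mulNr normrN ger0_norm ?divr_ge0//.
  by rewrite ler_piMl ?invr_ge0// ler_pdivrMr// mul1r.
Unshelve. all: by end_near. Qed.

(** * Iterating the replacement over blocks of rows *)

Section laplace_limit.
Context {R : realType} (lam w2 : R).
Hypotheses (lam0 : 0 < lam) (lam1 : lam < 1) (w20 : 0 < w2).
Variables (prior : probability R R) (q : R -> R) (B : R).
Hypotheses (B1 : 1 <= B) (mq : measurable_fun setT q) (qB : forall x, `|q x| <= B).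
Hypothesis q1 : (\int[prior]_x (q x)%:E = 0)%E.
Hypothesis q2 : (\int[prior]_x (q x ^+ 2)%:E = 1)%E.
Variables (mu : forall N K, probability 'M[R]_(N, K) R) (G : forall N, probability 'M[R]_N R).
Hypotheses (hmu : forall N K, iid_law prior (mu N K)) (hG : forall N, wigner_law w2 (G N)).
Variable kmax : nat.
Hypothesis small : 4 * lam * (kmax ^ 2)%:R * B ^+ 4 < 1.
Hypothesis kmax4 : (4 <= kmax)%N.

Local Notation lV := (logV lam w2).
Local Notation rk a := (@rank1 R lam w2 q mu a).
Local Notation gam := (gauss 1 : probability R R).

Lemma rank1_0 N w : rk 0 (N := N) w = 1.
Proof.
have spk0 (X : 'M[R]_(N, 1)) : spikes lam q (fun=> 0%N) X = 0.
  rewrite /spikes big_ord1; apply/matrixP => i j; rewrite !mxE.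
  by rewrite ltn0.
rewrite /rank1 /replica_lik /lik.
rewrite -[RHS](Rintegral_prob_cst (mu N 1)); apply: eq_Rintegral => X _.
rewrite /lexp spk0 !mxip0l mul0r subrr /overlaps big_pred0 ?addr0 ?expR0//.
by move=> -[i j]; rewrite !ord1 /supper ltnn.
Qed.

Section blocks.
Variable M : nat.
Hypothesis M0 : (0 < M)%N.
(** [h] bounds the variance increment of any block, and [D] below the cubic error coefficient of any
    single replacement. *)
Let h : R := (lam / (1 - lam) / 2 + lam / w2) / M%:R.
Hypothesis h12 : h <= 1 / 12.
Let V m : R := lV (m%:R / M%:R).
Let D : R := 1806 * expR (6 * lV 1) * (h * Num.sqrt h).

Lemma lindeberg_induction m eps : (m <= M)%N -> 0 < eps ->
  \forall N \near \oo, forall c, 0 <= c ->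
  `|laplace (G N) (rk ((m * N) %/ M) (N := N)) c - laplace gam (lgn (V m)) c| <=
  c ^+ 2 * eps + c ^+ 3 * (m%:R * D * expR (3 * V m) + eps).
Proof.
have MR : (0 : R) < M%:R by rewrite ltr0n.
elim: m eps => [|m IH] eps mM e0.
  near=> N; move=> c c0.
  have -> : laplace (G N) (rk ((0 * N) %/ M) (N := N)) c = expR (- c).
    rewrite mul0n div0n /laplace -[RHS](Rintegral_prob_cst (G N)).
    by apply: eq_Rintegral => w _; rewrite rank1_0 mulr1.
  have -> : laplace gam (lgn (V 0)) c = expR (- c).
    rewrite /laplace -[RHS](Rintegral_prob_cst gam); apply: eq_Rintegral => z _.
    by rewrite /V mul0r logV0 /lgn sqrtr0 !mul0r subrr expR0 mulr1.
  rewrite subrr normr0 !mul0r add0r; apply: addr_ge0; apply: mulr_ge0 => //; try exact: ltW.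
    exact: sqr_ge0.
  exact: exprn_ge0.
have xy : m%:R / M%:R <= m.+1%:R / M%:R :> R by rewrite ler_pM2r ?invr_gt0// ler_nat.
have x0 : 0 <= m%:R / M%:R :> R by rewrite divr_ge0// ltW.
have y1 : m.+1%:R / M%:R <= 1 :> R by rewrite ler_pdivrMr// mul1r ler_nat.
have dxy : m.+1%:R / M%:R - m%:R / M%:R = M%:R^-1 :> R by rewrite -natr1; field; rewrite gt_eqF.
pose v := V m.+1 - V m.
have v0 : 0 < v.
  apply: lt_le_trans (logV_increment_ge lam0 lam1 w20 x0 xy y1).
  by rewrite dxy; apply: mulr_gt0; [exact: divr_gt0|rewrite invr_gt0].
have vh : v <= h.
  by apply: le_trans (logV_increment_le lam0 lam1 w20 x0 xy y1) _; rewrite dxy.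
have V0 : 0 <= V m by exact: (logV_ge0 lam0 lam1 w20 x0 (le_trans xy y1)).
have V1 : 0 <= V m.+1 by exact: (logV_ge0 lam0 lam1 w20 (le_trans x0 xy) y1).
have VE : V m + v = V m.+1 by rewrite /v; ring.
have vD : 1806 * expR (6 * V m) * (v * Num.sqrt v) <= D.
  rewrite /D -[leLHS]mulrA -[leRHS]mulrA; apply: ler_wpM2l; first exact: ler0n.
  apply: ler_pM; [exact: expR_ge0|by apply: mulr_ge0; [exact: ltW|]|idtac|idtac].
    by rewrite ler_expR; apply: ler_wpM2l => //; exact: (logV_le lam0 lam1 w20 x0 (le_trans xy y1)).
  by apply: ler_pM => //; [exact: ltW|rewrite ler_sqrt// (le_trans (ltW v0))].
have D0 : 0 <= D.
  by apply: le_trans vD; rewrite -mulrA; apply: mulr_ge0; [exact: ler0n|rewrite mulr_ge0 ?expR_ge0// mulr_ge0// ltW].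
pose e3 := expR (3 * v).
have e31 : 1 <= e3 by rewrite -expR0 ler_expR; lra.
have ev3 : expR v <= e3 by rewrite ler_expR; lra.
(* Serves twice: for the new step and, amplified by at most [e3], for the induction hypothesis. *)
pose ep := eps / (1 + e3).
have ep0 : 0 < ep by rewrite divr_gt0//; lra.
have epE : ep * (1 + e3) = eps by rewrite /ep divfK// gt_eqF//; lra.
have {}IH := IH ep (ltnW mM) ep0.
have ab N : ((m * N) %/ M <= (m.+1 * N) %/ M)%N by rewrite leq_div2r// leq_mul2r leqnSn orbT.
have bN N : ((m.+1 * N) %/ M <= N)%N.
  by rewrite -[X in (_ <= X)%N](mulKn N M0) leq_div2r// leq_mul2r mM orbT.
have st := lindeberg_limit lam0 lam1 w20 B1 mq qB q1 q2 hmu hG small ab bN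
  (@cvg_floor_ratio R m M M0) (@cvg_floor_ratio R m.+1 M M0) xy kmax4 v0 (le_trans vh h12) V0 ep0.
near=> N.
have h1 : forall c, 0 <= c -> `|laplace (G N) (rk ((m.+1 * N) %/ M) (N := N)) c -
   \int[gam]_z laplace (G N) (rk ((m * N) %/ M) (N := N)) (c * lgn v z)| <=
   c ^+ 2 * ep + c ^+ 3 * (1806 * expR (6 * V m) * (v * Num.sqrt v) + ep).
  by near: N.
have h2 : forall c, 0 <= c ->
  `|laplace (G N) (rk ((m * N) %/ M) (N := N)) c - laplace gam (lgn (V m)) c| <=
  c ^+ 2 * ep + c ^+ 3 * (m%:R * D * expR (3 * V m) + ep).
  by near: N.
move=> c c0; have {}h1 := h1 c c0.
pose b := m%:R * D * expR (3 * V m).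
have mX : measurable_fun setT (rk ((m * N) %/ M) (N := N)) by exact: (measurable_rank1 lam w20 B1 mq qB).
have X0 w : 0 <= rk ((m * N) %/ M) (N := N) w by exact: (rank1_ge0 lam w20 B1 mq qB).
have h3 : `|\int[gam]_z laplace (G N) (rk ((m * N) %/ M) (N := N)) (c * lgn v z) -
    laplace gam (lgn (V m.+1)) c| <= c ^+ 2 * ep * expR v + c ^+ 3 * (b + ep) * e3.
  rewrite -VE -laplace_lgnD//.
  have -> : c ^+ 2 * ep * expR v + c ^+ 3 * (b + ep) * e3 =
    \int[gam]_z (c ^+ 2 * ep * lgn v z ^+ 2 + c ^+ 3 * (b + ep) * lgn v z ^+ 3).
    rewrite expectationD ?expectationZ ?Rintegral_lgnX; do ?apply: integrableZlR; do ?apply: integrable_lgnX; try exact: ltW.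
    rewrite (_ : 2 * (2 - 1) * v / 2 = v); last by field.
    by rewrite (_ : 3 * (3 - 1) * v / 2 = 3 * v)//; field.
  have mg : measurable_fun setT (lgn v) := measurable_lgn v.
  apply: expectation_dist_le.
  - by apply: integrable_laplace_mix => // z; exact: lgn_ge0.
  - by apply: integrable_laplace_mix => // [|z|z]; [exact: measurable_lgn|exact: lgn_ge0|exact: lgn_ge0].
  - by apply: integrableDR; apply: integrableZlR; apply: integrable_lgnX; exact: ltW.
  - move=> z; apply: le_trans (h2 _ _) _; first by rewrite mulr_ge0// lgn_ge0.
    by rewrite !exprMn /b le_eqVlt; apply/orP; left; apply/eqP; ring.
have c2 : 0 <= c ^+ 2 by exact: sqr_ge0.
have c3 : 0 <= c ^+ 3 by exact: exprn_ge0.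
rewrite (_ : laplace (G N) _ c - _ = (laplace (G N) (rk ((m.+1 * N) %/ M) (N := N)) c -
   \int[gam]_z laplace (G N) (rk ((m * N) %/ M) (N := N)) (c * lgn v z)) +
   (\int[gam]_z laplace (G N) (rk ((m * N) %/ M) (N := N)) (c * lgn v z) -
    laplace gam (lgn (V m.+1)) c)); last by ring.
apply: le_trans (ler_normD _ _) _; apply: le_trans (lerD h1 h3) _.
have -> : m.+1%:R * D * expR (3 * V m.+1) = D * expR (3 * V m.+1) + b * e3.
  by rewrite /b /e3 -VE mulrDr expRD -natr1; ring.
have eV : 1 <= expR (3 * V m.+1) by rewrite -expR0 ler_expR mulr_ge0.
have DD : D <= D * expR (3 * V m.+1) by rewrite ler_peMr.
move: vD DD epE ev3; rewrite -/b.
move: (1806 * expR (6 * V m) * _) (D * expR _) => d1 d2 vD DD epE ev3.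
have g1 : c ^+ 2 * ep + c ^+ 2 * ep * expR v <= c ^+ 2 * eps.
  rewrite -epE (_ : c ^+ 2 * ep + c ^+ 2 * ep * expR v = c ^+ 2 * (ep * (1 + expR v))); last by ring.
  by apply: ler_wpM2l => //; apply: ler_wpM2l; [exact: ltW|rewrite lerD2l].
have g2 : c ^+ 3 * (d1 + ep) + c ^+ 3 * (b + ep) * e3 <= c ^+ 3 * (d2 + b * e3 + eps).
  rewrite -epE (_ : c ^+ 3 * (d1 + ep) + c ^+ 3 * (b + ep) * e3 =
    c ^+ 3 * (d1 + b * e3 + ep * (1 + e3))); last by ring.
  by apply: ler_wpM2l => //; rewrite lerD2r lerD2r (le_trans vD).
by rewrite addrACA; exact: lerD.
Unshelve. all: by end_near. Qed.

End blocks.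
(** The M cubic errors add up to a multiple of M (1/M)^(3/2) = M^(-1/2). So M is fixed first, from
    [eps] and [c], and only then does N tend to infinity. *)
Theorem laplace_limit c : 0 <= c ->
  laplace (G N) (rk N (N := N)) c @[N --> \oo] --> laplace gam (lgn (lV 1)) c.
Proof.
move=> c0; apply/cvgrPdist_le => eps e0.
have c2 : 0 <= c ^+ 2 by exact: sqr_ge0.
have c3 : 0 <= c ^+ 3 by exact: exprn_ge0.
pose C := lam / (1 - lam) / 2 + lam / w2.
have C0 : 0 < C.
  by apply: addr_gt0; [do 2!apply: divr_gt0 => //; rewrite subr_gt0|exact: divr_gt0].
pose ka := c ^+ 3 * (1806 * expR (6 * lV 1) * (C * Num.sqrt C) * expR (3 * lV 1)).
have [M [M0 hM kaM]] : exists M, [/\ (0 < M)%N, C / M%:R <= 1 / 12 & ka * Num.sqrt (M%:R^-1) <= eps / 2].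
  have h1 : C * M%:R^-1 @[M --> \oo] --> (0 : R).
    by rewrite -[X in _ --> X](mulr0 C); apply: cvgMr; exact: cvg_invn.
  have h2 : ka * Num.sqrt (M%:R^-1) @[M --> \oo] --> (0 : R).
    by rewrite -[X in _ --> X](mulr0 ka); apply: cvgMr; exact: cvg_sqrtV.
  have /cvgr_le/(_ (1 / 12)) g1 := h1; have /cvgr_le/(_ (eps / 2)) g2 := h2.
  apply: (@filter_ex _ \oo); near=> M; split; near: M.
  - by exists 1%N.
  - by apply: g1; rewrite divr_gt0.
  - by apply: g2; rewrite divr_gt0.
pose ep := eps / 2 / (1 + c ^+ 2 + c ^+ 3).
have s0 : 0 < 1 + c ^+ 2 + c ^+ 3 by rewrite -addrA ltr_pwDl// addr_ge0.
have ep0 : 0 < ep by rewrite !divr_gt0.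
have := lindeberg_induction M0 hM (leqnn M) ep0.
have MR : (0 : R) < M%:R by rewrite ltr0n.
rewrite divff ?gt_eqF// => ind.
near=> N; rewrite distrC.
have hN : forall c, 0 <= c ->
  `|laplace (G N) (rk ((M * N) %/ M) (N := N)) c - laplace gam (lgn (lV 1)) c| <=
  c ^+ 2 * ep + c ^+ 3 * (M%:R * (1806 * expR (6 * lV 1) * (C / M%:R * Num.sqrt (C / M%:R)))
    * expR (3 * lV 1) + ep) by near: N.
have := hN c c0; rewrite mulKn// => /le_trans; apply.
have -> : c ^+ 2 * ep + c ^+ 3 * (M%:R * (1806 * expR (6 * lV 1) * (C / M%:R * Num.sqrt (C / M%:R)))
    * expR (3 * lV 1) + ep) = ka * Num.sqrt (M%:R^-1) + (c ^+ 2 + c ^+ 3) * ep.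
  by rewrite sqrtrM ?(ltW C0)// /ka; field; rewrite gt_eqF.
have epE : ep * (1 + c ^+ 2 + c ^+ 3) = eps / 2 by rewrite /ep divfK// gt_eqF.
have le2 : (c ^+ 2 + c ^+ 3) * ep <= eps / 2.
  by rewrite -epE mulrC ler_pM2l// -addrA lerDr.
by rewrite [leRHS]splitr; exact: lerD.
Unshelve. all: by end_near. Qed.

End laplace_limit.

(** * From Laplace transforms to expectations *)

Section bernstein.
Context {R : realType}.
Implicit Types (f : nat -> R) (x y a b t : R).

(** Expectation of [f (k + S)], where [S] is a sum of [n] independent Bernoulli
    variables of parameter [x]. *)
Fixpoint bernstein f n k x : R :=
  if n is n'.+1 then x * bernstein f n' k.+1 x + (1 - x) * bernstein f n' k x else f k.

(** The bracket is the exact mean of (k + S - t)^2, squared bias plus binomial variance, so the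
    induction on [n] closes with an equality. *)
Lemma bernstein_dist_le f y a b t n k x : 0 <= x <= 1 ->
  (forall j, `|f j - y| <= a + b * (j%:R - t) ^+ 2) ->
  `|bernstein f n k x - y| <= a + b * ((k%:R + n%:R * x - t) ^+ 2 + n%:R * x * (1 - x)).
Proof.
move=> /andP[x0 x1] hf; elim: n k => [|n IH] k /=.
  by rewrite !mul0r !addr0.
have x1' : 0 <= 1 - x by lra.
have -> : x * bernstein f n k.+1 x + (1 - x) * bernstein f n k x - y =
  x * (bernstein f n k.+1 x - y) + (1 - x) * (bernstein f n k x - y) by ring.
apply: le_trans (ler_normD _ _) _; rewrite !normrM (ger0_norm x0) (ger0_norm x1').
apply: le_trans (lerD (ler_wpM2l x0 (IH _)) (ler_wpM2l x1' (IH _))) _.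
by rewrite -!natr1 le_eqVlt; apply/orP; left; apply/eqP; ring.
Qed.

Lemma measurable_bernstein f n k : measurable_fun setT (bernstein f n k).
Proof.
elim: n k => [|n IH] k /=; first exact: measurable_cst.
by apply: measurable_funD; apply: measurable_funM => //; exact: measurable_funB.
Qed.

Lemma bernstein_norm_le f a n k x : 0 <= x <= 1 -> (forall j, `|f j| <= a) ->
  `|bernstein f n k x| <= a.
Proof.
move=> x01 fa; have := @bernstein_dist_le f 0 a 0 0 n k x x01.
by rewrite subr0 !mul0r addr0; apply => j; rewrite subr0 mul0r addr0.
Qed.

(** The Lipschitz bound is made quadratic by |u| <= (e + u^2 / e) / 2 with e = n^(-1/2), the order
    of the standard deviation of S/n. *)
Lemma bernstein_lipschitz (phi : R -> R) (L : R) n x : 0 <= x <= 1 -> 0 <= L -> (0 < n)%N ->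
  (forall u v, `|phi u - phi v| <= L * `|u - v|) ->
  `|bernstein (fun j => phi (j%:R / n%:R)) n 0 x - phi x| <= L * Num.sqrt (n%:R^-1).
Proof.
move=> x01 L0 n0 hphi; have /andP[x0 x1] := x01.
have nR : (0 : R) < n%:R by rewrite ltr0n.
set e := Num.sqrt _; have e0 : 0 < e by rewrite sqrtr_gt0 invr_gt0.
have e2 : e ^+ 2 = n%:R^-1 by rewrite sqr_sqrtr// invr_ge0 ltW.
have ne2 : n%:R * e ^+ 2 = 1 by rewrite e2 mulfV// gt_eqF.
apply: (le_trans (@bernstein_dist_le _ (phi x) (L * e / 2) (L * e ^+ 3 / 2) (n%:R * x) n 0 x x01 _)).
  move=> j; apply: le_trans (hphi _ _) _.
  have -> : (j%:R - n%:R * x) ^+ 2 = (j%:R / n%:R - x) ^+ 2 * n%:R ^+ 2 by field; rewrite gt_eqF.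
  have -> : L * e / 2 + L * e ^+ 3 / 2 * ((j%:R / n%:R - x) ^+ 2 * n%:R ^+ 2) =
    L * ((e ^+ 2 + (n%:R * e ^+ 2) ^+ 2 * (j%:R / n%:R - x) ^+ 2) / (2 * e)).
    by field; rewrite !gt_eqF.
  rewrite ne2 expr1n mul1r; apply: ler_wpM2l => //.
  rewrite ler_pdivlMr ?mulr_gt0// -(real_normK (num_real (_ - x))).
  by have := sqr_ge0 (e - `|j%:R / n%:R - x|); nra.
rewrite add0r subrr expr0n/= add0r.
have -> : L * e / 2 + L * e ^+ 3 / 2 * (n%:R * x * (1 - x)) =
  L * (e / 2 + (n%:R * e ^+ 2) * e / 2 * (x * (1 - x))) by ring.
rewrite ne2 mul1r; apply: ler_wpM2l => //.
have : x * (1 - x) <= 1 by nra.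
by move=> h; have := ler_wpM2l (ltW e0) h; lra.
Qed.

End bernstein.

Section laplace_to_law.
Context {R : realType} {d d' : measure_display}.
Variables (T : nat -> measurableType d) (T' : measurableType d').
Variables (P : forall N, probability (T N) R) (Q : probability T' R).
Variables (X : forall N, T N -> R) (Z : T' -> R).
Arguments X : clear implicits.
Hypotheses (mX : forall N, measurable_fun setT (X N)) (mZ : measurable_fun setT Z).
Hypotheses (X0 : forall N w, 0 <= X N w) (Z0 : forall z, 0 <= Z z).
Hypothesis XZ : forall c, 0 <= c -> laplace (P N) (X N) c @[N --> \oo] --> laplace Q Z c.

Let bounded_int d0 (S : measurableType d0) (p : probability S R) (Y : S -> R) (f : R -> R) (a : R) :
  measurable_fun setT Y -> (forall s, 0 <= Y s) -> measurable_fun setT f ->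
  (forall x, 0 <= x <= 1 -> `|f x| <= a) ->
  p.-integrable setT (EFin \o (fun s => f (expR (- Y s)))).
Proof.
move=> mY Y0 mf fa; apply: (bounded_integrable p (c := a)) => [|s].
  by apply: (measurableT_comp mf); apply: measurableT_comp => //; exact: measurableT_comp.
by apply: fa; rewrite expR_ge0 -expR0 ler_expR oppr_le0 Y0.
Qed.

(** Powers of exp(-X) have Laplace transforms at integers as expectations. The factor with exponent
    [j] strengthens the statement so that the recursion defining [bernstein] becomes the induction
    step. *)
Lemma bernstein_cvg f a n k j : (forall i, `|f i| <= a) ->
  \int[P N]_w (expR (- X N w) ^+ j * bernstein f n k (expR (- X N w))) @[N --> \oo] -->
  \int[Q]_z (expR (- Z z) ^+ j * bernstein f n k (expR (- Z z))).
Proof.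
move=> fa.
have mb n' k' j' : measurable_fun setT (fun x : R => x ^+ j' * bernstein f n' k' x).
  by apply: measurable_funM; [exact: measurable_funX|exact: measurable_bernstein].
have bb n' k' j' (x : R) : 0 <= x <= 1 -> `|x ^+ j' * bernstein f n' k' x| <= a.
  move=> x01; rewrite normrM; have /andP[x0 x1] := x01.
  apply: le_trans (bernstein_norm_le n' k' x01 fa).
  by rewrite ler_piMl// ger0_norm ?exprn_ge0// exprn_ile1.
have rec (x : R) n' k' j' : x ^+ j' * bernstein f n'.+1 k' x = x ^+ j'.+1 * bernstein f n' k'.+1 x +
    x ^+ j' * bernstein f n' k' x - x ^+ j'.+1 * bernstein f n' k' x.
  by rewrite /= exprS; ring.
elim: n k j => [|n IH] k j.
  have e d0 (S : measurableType d0) (p : probability S R) (Y : S -> R) :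
      measurable_fun setT Y -> (forall s, 0 <= Y s) ->
      \int[p]_s (expR (- Y s) ^+ j * f k) = f k * laplace p Y j%:R.
    move=> mY Y0; rewrite -expectationZ; last exact: integrable_laplace.
    by apply: eq_Rintegral => s _; rewrite -expRM_natl mulrN mulrC.
  rewrite /= e//; under eq_cvg do rewrite e//.
  by apply: cvgMr; exact: XZ.
have e d0 (S : measurableType d0) (p : probability S R) (Y : S -> R) :
    measurable_fun setT Y -> (forall s, 0 <= Y s) ->
    \int[p]_s (expR (- Y s) ^+ j * bernstein f n.+1 k (expR (- Y s))) =
    \int[p]_s (expR (- Y s) ^+ j.+1 * bernstein f n k.+1 (expR (- Y s))) +
    \int[p]_s (expR (- Y s) ^+ j * bernstein f n k (expR (- Y s))) -
    \int[p]_s (expR (- Y s) ^+ j.+1 * bernstein f n k (expR (- Y s))).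
  move=> mY Y0; have iY n' k' j' := bounded_int p mY Y0 (mb n' k' j') (bb n' k' j').
  rewrite -expectationD// -expectationB//; last exact: integrableDR.
  by apply: eq_Rintegral => s _; exact: rec.
rewrite e//; under eq_cvg do rewrite e//.
by apply: cvgB; [apply: cvgD|]; exact: IH.
Qed.

Lemma bounded_lipschitz_cvg (phi : R -> R) (a L : R) :
  measurable_fun setT phi -> (forall x, `|phi x| <= a) -> 0 <= L ->
  (forall u v, `|phi u - phi v| <= L * `|u - v|) ->
  \int[P N]_w phi (expR (- X N w)) @[N --> \oo] --> \int[Q]_z phi (expR (- Z z)).
Proof.
move=> mphi phia L0 hphi; apply/cvgrPdist_le => eps e0.
have [n [n0 hn]] : exists n, (0 < n)%N /\ L * Num.sqrt (n%:R^-1) <= eps / 3.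
  have h1 : L * Num.sqrt (n%:R^-1) @[n --> \oo] --> (0 : R).
    by rewrite -[X in _ --> X](mulr0 L); apply: cvgMr; exact: cvg_sqrtV.
  have /cvgr_le/(_ (eps / 3)) g := h1.
  apply: (@filter_ex _ \oo); near=> n; split; near: n; first by exists 1%N.
  by apply: g; rewrite divr_gt0.
pose f j := phi (j%:R / n%:R).
have fa j : `|f j| <= a by exact: phia.
have appr d0 (S : measurableType d0) (p : probability S R) (Y : S -> R) :
    measurable_fun setT Y -> (forall s, 0 <= Y s) ->
    `|\int[p]_s (expR (- Y s) ^+ 0 * bernstein f n 0 (expR (- Y s))) -
      \int[p]_s phi (expR (- Y s))| <= eps / 3.
  move=> mY Y0; rewrite -(Rintegral_prob_cst p (eps / 3)); apply: expectation_dist_le.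
  - apply: (bounded_int p (f := fun x => x ^+ 0 * bernstein f n 0 x) mY Y0 (a := a)) => [|x x01].
      by apply: measurable_funM; [exact: measurable_funX|exact: measurable_bernstein].
    by rewrite expr0 mul1r; exact: bernstein_norm_le.
  - exact: (bounded_int p mY Y0 mphi (fun x _ => phia x)).
  - exact: integrable_cstR.
  - move=> s; rewrite expr0 mul1r; apply: le_trans hn; apply: bernstein_lipschitz => //.
    by rewrite expR_ge0 -expR0 ler_expR oppr_le0 Y0.
have /cvgrPdist_le/(_ (eps / 3)) hB := @bernstein_cvg f a n 0 0 fa.
near=> N.
have h1 := appr _ _ (P N) (X N) (@mX N) (@X0 N).
have h2 := appr _ _ Q Z mZ Z0.
have h3 : `|\int[Q]_z (expR (- Z z) ^+ 0 * bernstein f n 0 (expR (- Z z))) -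
    \int[P N]_w (expR (- X N w) ^+ 0 * bernstein f n 0 (expR (- X N w)))| <= eps / 3.
  by near: N; apply: hB; rewrite divr_gt0.
move: h1 h2 h3; rewrite !ler_norml.
set u1 := \int[P N]_s phi _; set u2 := \int[Q]_s phi _; set u3 := Rintegral _ _ _; set u4 := Rintegral _ _ _.
by move: u1 u2 u3 u4 => u1 u2 u3 u4; lra.
Unshelve. all: by end_near. Qed.

End laplace_to_law.

(** * The minimum of two powers as a truncated Lipschitz function *)

Section min_power.
Context {R : realType}.
Implicit Types (b u v c : R).

Lemma min_dist_le (x y x' y' : R) :
  `|Num.min x y - Num.min x' y'| <= `|x - x'| + `|y - y'|.
Proof.
have := ler_norm (x - x'); have := ler_norm (- (x - x')); rewrite normrN.
have := ler_norm (y - y'); have := ler_norm (- (y - y')); rewrite normrN.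
by rewrite ler_norml; case: (leP x y) => h1; case: (leP x' y') => h2; lra.
Qed.

Lemma exprn_lipschitz b u v k : 1 <= b -> 0 <= u <= b -> 0 <= v <= b ->
  `|u ^+ k - v ^+ k| <= k%:R * b ^+ k * `|u - v|.
Proof.
move=> b1 /andP[u0 ub] /andP[v0 vb]; have b0 : 0 <= b by lra.
elim: k => [|k IH]; first by rewrite !expr0 subrr normr0 !mul0r.
have -> : u ^+ k.+1 - v ^+ k.+1 = u * (u ^+ k - v ^+ k) + (u - v) * v ^+ k by rewrite !exprS; ring.
apply: le_trans (ler_normD _ _) _; rewrite !normrM (ger0_norm u0) (ger0_norm (exprn_ge0 k v0)).
have -> : k.+1%:R * b ^+ k.+1 * `|u - v| = b * (k%:R * b ^+ k * `|u - v|) + `|u - v| * b ^+ k.+1.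
  by rewrite -natr1 exprS; ring.
apply: lerD; first exact: ler_pM.
apply: ler_wpM2l => //; apply: (@le_trans _ _ (b ^+ k)); first by apply: lerXn2r.
by rewrite exprS ler_peMl// exprn_ge0.
Qed.

(** Recovers min(u, b) from exp(-u). Clipping its argument to [exp(-b), 1] makes it Lipschitz on the
    whole line. *)
Definition clipped_log b (x : R) : R := - ln (Num.max (expR (- b)) (Num.min x 1)).

Let clipped_in b x : 0 <= b -> expR (- b) <= Num.max (expR (- b)) (Num.min x 1) <= 1.
Proof.
move=> b0; rewrite le_max lexx/= ge_max ge_min lexx orbT andbT.
by rewrite -expR0 ler_expR oppr_le0.
Qed.

Lemma clipped_log_itv b x : 0 <= b -> 0 <= clipped_log b x <= b.
Proof.
move=> b0; have /andP[h1 h2] := clipped_in x b0; rewrite /clipped_log.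
have p0 := lt_le_trans (expR_gt0 _) h1.
rewrite oppr_ge0 ln_le0//= lerNl -ler_expR lnK//.
Qed.

Lemma clipped_log_expR b u : 0 <= b -> 0 <= u -> clipped_log b (expR (- u)) = Num.min u b.
Proof.
move=> b0 u0; rewrite /clipped_log min_l; last by rewrite -expR0 ler_expR oppr_le0.
have -> : Num.max (expR (- b)) (expR (- u)) = expR (- Num.min u b).
  by case: (leP u b) => h; [rewrite max_r|rewrite max_l]; rewrite // ler_expR lerN2// ltW.
by rewrite expRK opprK.
Qed.

Lemma clipped_log_lipschitz b x y : 0 <= b ->
  `|clipped_log b x - clipped_log b y| <= expR b * `|x - y|.
Proof.
move=> b0; have /andP[x1 x2] := clipped_in x b0; have /andP[y1 y2] := clipped_in y b0.
rewrite /clipped_log; set p := Num.max _ _ in x1 x2 *; set r := Num.max _ _ in y1 y2 *.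
have pr : `|p - r| <= `|x - y|.
  rewrite /p /r; have := ler_norm (x - y); have := ler_norm (- (x - y)); rewrite normrN.
  rewrite ler_norml; have := expR_gt0 (- b); have : expR (- b) <= 1 by rewrite -expR0 ler_expR oppr_le0.
  case: (leP x 1) => h1; case: (leP y 1) => h2.
  - case: (leP (expR (- b)) x) => h3; case: (leP (expR (- b)) y) => h4; lra.
  - case: (leP (expR (- b)) x) => h3; case: (leP (expR (- b)) 1) => h4; lra.
  - case: (leP (expR (- b)) 1) => h3; case: (leP (expR (- b)) y) => h4; lra.
  - case: (leP (expR (- b)) 1) => h3; lra.
have e0 : 0 < expR (- b) by exact: expR_gt0.
have p0 : 0 < p := lt_le_trans e0 x1; have r0 : 0 < r := lt_le_trans e0 y1.
have half z w : expR (- b) <= w -> 0 < z -> ln z - ln w <= expR b * `|z - w|.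
  move=> hw z0; have w0 : 0 < w := lt_le_trans e0 hw.
  have -> : ln z - ln w = ln (z / w) by rewrite ln_div ?posrE.
  apply: le_trans (_ : ln (z / w) <= z / w - 1) _.
    by have := expR_ge1Dx (ln (z / w)); rewrite lnK ?posrE ?divr_gt0//; lra.
  have -> : z / w - 1 = w^-1 * (z - w) by field; rewrite gt_eqF.
  apply: (@le_trans _ _ (w^-1 * `|z - w|)).
    by apply: ler_wpM2l; [rewrite invr_ge0 ltW|exact: ler_norm].
  apply: ler_wpM2r => //.
  by rewrite -[leRHS]invrK -expRN lef_pV2 ?posrE.
apply: (@le_trans _ _ (expR b * `|p - r|)); last by rewrite ler_pM2l ?expR_gt0.
have := half p r y1 p0; have := half r p x1 r0; rewrite (distrC r p) ler_norml; lra.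
Qed.

Lemma measurable_clipped_log b : measurable_fun setT (clipped_log b).
Proof.
apply: measurableT_comp => //; apply: measurableT_comp; first exact: measurable_ln.
by apply: measurable_maxr => //; exact: measurable_minr.
Qed.

Variables (c1 c2 : R) (k1 k2 : nat).
Hypotheses (c10 : 0 <= c1) (c20 : 0 <= c2).

Definition min_power (l : R) : R := Num.min (c1 * l ^+ k1) (c2 * l ^+ k2).

Lemma measurable_min_power : measurable_fun setT min_power.
Proof.
by apply: measurable_minr; apply: measurable_funM => //; exact: measurable_funX.
Qed.

Lemma min_power_ge0 l : 0 <= l -> 0 <= min_power l.
Proof. by move=> l0; rewrite le_min !mulr_ge0// exprn_ge0. Qed.

Lemma min_power_le l : min_power l <= c1 * l ^+ k1.
Proof. by rewrite ge_min lexx. Qed.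

Lemma min_power_lipschitz b u v : 1 <= b -> 0 <= u <= b -> 0 <= v <= b ->
  `|min_power u - min_power v| <= (c1 * (k1%:R * b ^+ k1) + c2 * (k2%:R * b ^+ k2)) * `|u - v|.
Proof.
move=> b1 ub vb; apply: le_trans (min_dist_le _ _ _ _) _.
rewrite -!mulrBr !normrM (ger0_norm c10) (ger0_norm c20) [leRHS]mulrDl -!mulrA.
by apply: lerD; apply: ler_wpM2l => //; rewrite mulrA; exact: exprn_lipschitz.
Qed.

(** Beyond [b] both values lie between 0 and c1 l^k1, and there one extra power of l/b is
    affordable; this is Markov's inequality in disguise. *)
Lemma min_power_tail b l : 1 <= b -> 0 <= l ->
  `|min_power l - min_power (Num.min l b)| <= c1 / b * l ^+ k1.+1.
Proof.
move=> b1 l0; have b0 : 0 < b by lra.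
have t0 : 0 <= c1 / b * l ^+ k1.+1 by rewrite mulr_ge0 ?divr_ge0 ?exprn_ge0// ltW.
case: (leP l b) => lb; first by rewrite subrr normr0.
have h1 : c1 * l ^+ k1 <= c1 / b * l ^+ k1.+1.
  rewrite -mulrA; apply: ler_wpM2l => //; rewrite exprS mulrA ler_peMl ?exprn_ge0//.
  by rewrite ler_pdivlMl// mulr1 ltW.
have h2 : c1 * b ^+ k1 <= c1 * l ^+ k1.
  by apply: ler_wpM2l => //; apply: lerXn2r; rewrite ?nnegrE// ltW.
have := min_power_le l; have := min_power_le b; have := min_power_ge0 l0.
have := min_power_ge0 (ltW b0); rewrite ler_norml.
move: (min_power l) (min_power b) h1 h2 => m1 m2; lra.
Qed.

End min_power.

Section min_power_limit.
Context {R : realType} {d d' : measure_display}.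
Variables (T : nat -> measurableType d) (T' : measurableType d').
Variables (P : forall N, probability (T N) R) (Q : probability T' R).
Variables (X : forall N, T N -> R) (Z : T' -> R).
Arguments X : clear implicits.
Hypotheses (mX : forall N, measurable_fun setT (X N)) (mZ : measurable_fun setT Z).
Hypotheses (X0 : forall N w, 0 <= X N w) (Z0 : forall z, 0 <= Z z).
Hypothesis XZ : forall c, 0 <= c -> laplace (P N) (X N) c @[N --> \oo] --> laplace Q Z c.
Variables (c1 c2 : R) (k1 k2 : nat) (m : R).
Hypotheses (c10 : 0 <= c1) (c20 : 0 <= c2).
Hypothesis Xi : forall N k, (P N).-integrable setT (EFin \o (fun w => X N w ^+ k)).
Hypothesis Zi : forall k, Q.-integrable setT (EFin \o (fun z => Z z ^+ k)).
Hypothesis Xm : \int[P N]_w (X N w ^+ k1.+1) @[N --> \oo] --> m.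
Local Notation H := (min_power c1 c2 k1 k2).

Lemma integrable_min_power d0 (S : measurableType d0) (p : probability S R) (Y : S -> R) :
  measurable_fun setT Y -> (forall s, 0 <= Y s) ->
  p.-integrable setT (EFin \o (fun s => Y s ^+ k1)) ->
  p.-integrable setT (EFin \o (fun s => H (Y s))).
Proof.
move=> mY Y0 iY; apply: (ler_integrable (g := fun s => c1 * Y s ^+ k1)).
- exact: (measurableT_comp (measurable_min_power _ _ _ _)).
- by move=> s; rewrite ger0_norm ?min_power_ge0// min_power_le.
- exact: integrableZlR.
Qed.

(** Convergence of Laplace transforms handles bounded functions of exp(-X); the moment of order k1 +
    1, bounded along the sequence, supplies the uniform integrability that removes the
    truncation. *)
Theorem min_power_cvg :
  \int[P N]_w H (X N w) @[N --> \oo] --> \int[Q]_z H (Z z).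
Proof.
apply/cvgrPdist_le => eps e0.
pose m' := \int[Q]_z (Z z ^+ k1.+1).
(* Large enough for the truncation error to be at most eps / 3, both for large N and in the
   limit. *)
pose b := 1 + 3 * c1 * (`|m| + 1 + `|m'|) / eps.
have n0 : 0 <= 3 * c1 * (`|m| + 1 + `|m'|) / eps.
  apply: divr_ge0; last exact: ltW.
  by apply: mulr_ge0; [exact: mulr_ge0|rewrite !addr_ge0].
have b1 : 1 <= b by rewrite lerDl.
have b0 : 0 < b by lra.
have bE : c1 * (`|m| + 1 + `|m'|) <= eps / 3 * b.
  have -> : eps / 3 * b = eps / 3 + c1 * (`|m| + 1 + `|m'|) by rewrite /b; field; rewrite gt_eqF.
  by rewrite lerDr divr_ge0// ltW.
have tail d0 (S : measurableType d0) (p : probability S R) (Y : S -> R) :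
    measurable_fun setT Y -> (forall s, 0 <= Y s) ->
    (forall k, p.-integrable setT (EFin \o (fun s => Y s ^+ k))) ->
    \int[p]_s (Y s ^+ k1.+1) <= `|m| + 1 + `|m'| ->
    `|\int[p]_s H (Y s) - \int[p]_s H (Num.min (Y s) b)| <= eps / 3.
  move=> mY Y0 iY hY.
  apply: (@le_trans _ _ (\int[p]_s (c1 / b * Y s ^+ k1.+1))).
    apply: expectation_dist_le.
    - exact: integrable_min_power.
    - apply: (ler_integrable (g := fun s => c1 * Y s ^+ k1)); last exact: integrableZlR.
        apply: (measurableT_comp (measurable_min_power _ _ _ _)).
        exact: measurable_minr.
      move=> s; have mn0 : 0 <= Num.min (Y s) b by rewrite le_min Y0 ltW.
      rewrite ger0_norm ?min_power_ge0//; apply: le_trans (min_power_le _ _ _ _ _) _.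
      by apply: ler_wpM2l => //; apply: lerXn2r; rewrite ?nnegrE// ge_min lexx.
    - exact: integrableZlR.
    - by move=> s; exact: min_power_tail.
  rewrite expectationZ// mulrAC ler_pdivrMr//; apply: le_trans bE.
  by apply: ler_wpM2l.
pose phi x := H (clipped_log b x).
have mphi : measurable_fun setT phi.
  by apply: (measurableT_comp (measurable_min_power _ _ _ _)); exact: measurable_clipped_log.
have phiE l : 0 <= l -> phi (expR (- l)) = H (Num.min l b).
  by move=> l0; rewrite /phi clipped_log_expR// ltW.
have itv x : 0 <= clipped_log b x <= b by apply: clipped_log_itv; exact: ltW.
have phia x : `|phi x| <= c1 * b ^+ k1.
  have /andP[h1 h2] := itv x; rewrite ger0_norm ?min_power_ge0//.
  apply: le_trans (min_power_le _ _ _ _ _) _.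
  by apply: ler_wpM2l => //; apply: lerXn2r; rewrite ?nnegrE// ltW.
pose L := (c1 * (k1%:R * b ^+ k1) + c2 * (k2%:R * b ^+ k2)) * expR b.
have L0' : 0 <= c1 * (k1%:R * b ^+ k1) + c2 * (k2%:R * b ^+ k2).
  by rewrite addr_ge0// !mulr_ge0// exprn_ge0// ltW.
have L0 : 0 <= L by rewrite mulr_ge0// expR_ge0.
have philip x y : `|phi x - phi y| <= L * `|x - y|.
  apply: le_trans (min_power_lipschitz _ _ c10 c20 b1 (itv x) (itv y)) _.
  by rewrite /L -mulrA; apply: ler_wpM2l => //; apply: clipped_log_lipschitz; exact: ltW.
have /cvgrPdist_le/(_ (eps / 3)) hc := bounded_lipschitz_cvg mX mZ X0 Z0 XZ mphi phia L0 philip.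
have /cvgr_le/(_ (`|m| + 1)) hm := Xm.
near=> N.
have h1 : `|\int[Q]_z phi (expR (- Z z)) - \int[P N]_w phi (expR (- X N w))| <= eps / 3.
  by near: N; apply: hc; rewrite divr_gt0.
have XN : \int[P N]_w (X N w ^+ k1.+1) <= `|m| + 1.
  by near: N; apply: hm; have := ler_norm m; lra.
have h2 := tail _ _ (P N) (X N) (@mX N) (@X0 N) (Xi N) (le_trans XN (_ : _ <= _)).
have h3 := tail _ _ Q Z mZ Z0 Zi.
have eQ : \int[Q]_z phi (expR (- Z z)) = \int[Q]_z H (Num.min (Z z) b).
  by apply: eq_Rintegral => z _; rewrite phiE.
have eP : \int[P N]_w phi (expR (- X N w)) = \int[P N]_w H (Num.min (X N w) b).
  by apply: eq_Rintegral => z _; rewrite phiE.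
rewrite eQ eP in h1.
have {}h2 : `|\int[P N]_w H (X N w) - \int[P N]_w H (Num.min (X N w) b)| <= eps / 3.
  by apply: h2; rewrite lerDl.
have {}h3 : `|\int[Q]_z H (Z z) - \int[Q]_z H (Num.min (Z z) b)| <= eps / 3.
  by apply: h3; rewrite -/m'; have := ler_norm m'; have := normr_ge0 m; lra.
move: h1 h2 h3; rewrite !ler_norml.
set u1 := \int[P N]_s H (X N s); set u2 := \int[Q]_s H (Z s); set u3 := Rintegral _ _ _; set u4 := Rintegral _ _ _.
by move: u1 u2 u3 u4 => u1 u2 u3 u4; lra.
Unshelve. all: by end_near. Qed.

End min_power_limit.

(** * Gaussian tails *)

Section gaussian_tail.
Context {R : realType}.
Notation mu := (@lebesgue_measure R).
Local Notation gam := (gauss 1 : probability R R).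

Lemma ge0_integral_lebesgue_opp (f : R -> \bar R) :
  measurable_fun [set: R] f -> (forall x, 0 <= f x)%E ->
  (\int[mu]_x f (- x)%R = \int[mu]_x f x)%E.
Proof.
move=> mf f0.
pose g (x : measurableTypeR R) : measurableTypeR R := - (x : R).
have mg : measurable_fun [set: measurableTypeR R] g by exact: (@oppr_measurable R).
pose nu := measure_function_pushforward__canonical__measure_function_Measure mu mg.
have gX (X : set R) : measurable X -> mu X = nu X.
  move=> mX; apply: lebesgue_measure_unique => // _ [[u v] _ <-].
  rewrite /nu/= /pushforward.
  have -> : g @^-1` `]u, v] = `[(- v), (- u)[%classic.
    by apply/seteqP; split => x /=; rewrite !in_itv/= /g => /andP[h1 h2]; apply/andP; split; lra.
  rewrite !lebesgue_measure_itv/= !lte_fin ltrN2.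
  by case: ifPn => // _; rewrite -!EFinB; congr EFin; ring.
have -> : (\int[mu]_x f x = \int[nu]_x f x)%E.
  by apply: eq_measure_integral => A mA _; exact: gX.
by rewrite /nu ge0_integral_pushforward.
Qed.

Definition indicator_ge (a y : R) : \bar R := (if a <= y then 1 else 0)%:E.

Lemma measurable_indicator_ge a : measurable_fun [set: R] (indicator_ge a).
Proof.
apply/measurable_EFinP; apply: measurable_fun_ifT => //; exact: measurable_fun_ler.
Qed.

Lemma indicator_ge_ge0 a y : (0 <= indicator_ge a y)%E.
Proof. by rewrite /indicator_ge lee_fin; case: ifP. Qed.

Let n1 : (1 : R) != 0. Proof. exact: oner_neq0. Qed.

Lemma gauss_tail_opp (a : R) :
  (\int[gam]_y (if y < - a then 1 else 0)%:E = \int[gam]_y (if a < y then 1 else 0)%:E)%E.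
Proof.
have mlt (b : R) : measurable_fun [set: R] (fun y : R => (if b < y then 1 else 0 : R)%:E).
  by apply/measurable_EFinP; apply: measurable_fun_ifT => //; exact: measurable_fun_ltr.
have mgt (b : R) : measurable_fun [set: R] (fun y : R => (if y < b then 1 else 0 : R)%:E).
  by apply/measurable_EFinP; apply: measurable_fun_ifT => //; exact: measurable_fun_ltr.
rewrite !integral_gauss//; try by move=> y; rewrite lee_fin; case: ifP.
rewrite -[RHS]ge0_integral_lebesgue_opp.
- by apply: eq_integral => y _; rewrite !normal_pdf0E// sqrrN ltrNr.
- by apply: emeasurable_funM => //; apply/measurable_EFinP; exact: measurable_normal_pdf.
- by move=> y; rewrite mule_ge0// lee_fin ?normal_pdf_ge0//; case: ifP.
Qed.

(** The substitution y = sqrt 2 t turns the standard density into exp(-t^2) / sqrt pi. *)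
Lemma gauss_tail_erfc (a : R) :
  (\int[gam]_y indicator_ge a y = (erfc (a / Num.sqrt 2) / 2)%:E)%E.
Proof.
have s2 : (0 : R) < Num.sqrt 2 by rewrite sqrtr_gt0.
have mI := measurable_indicator_ge.
have mp : measurable_fun [set: R] (fun y : R => (normal_pdf 0 1 y)%:E).
  by apply/measurable_EFinP; exact: measurable_normal_pdf.
have me : measurable_fun [set: R] (fun t : R => (expR (- t ^+ 2))%:E).
  by apply/measurable_EFinP; apply: measurableT_comp => //; apply: measurableT_comp => //; exact: measurable_funX.
have ip : (Num.sqrt pi)^-1 = Num.sqrt 2 * normal_peak 1 :> R.
  rewrite /normal_peak expr1n mul1r -(mulr_natr pi) sqrtrM ?pi_ge0//.
  by field; rewrite !gt_eqF// sqrtr_gt0 pi_gt0.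
have h : (\int[gam]_y indicator_ge a y = (Num.sqrt pi)^-1%:E *
    \int[mu]_(t in `[(a / Num.sqrt 2)%R, +oo[) (expR (- t ^+ 2))%:E)%E.
  rewrite integral_gauss//; last exact: indicator_ge_ge0.
  have := @ge0_integral_lebesgue_affine R (Num.sqrt 2) 0 (fun y => indicator_ge a y * (normal_pdf 0 1 y)%:E)%E s2.
  have -> : (\int[mu]_x (indicator_ge a (Num.sqrt 2 * x + 0)%R * (normal_pdf 0 1 (Num.sqrt 2 * x + 0))%:E) =
     (normal_peak 1)%:E * \int[mu]_(t in `[(a / Num.sqrt 2)%R, +oo[) (expR (- t ^+ 2))%:E)%E.
    have mE : measurable_fun [set: R] ((fun t : R => (expR (- t ^+ 2))%:E) \_ `[(a / Num.sqrt 2)%R, +oo[).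
      by apply/(measurable_restrictT _ (measurable_itv _)); exact: measurable_funTS.
    rewrite [in RHS]integral_mkcond -ge0_integralZl//; last 2 first.
    - by move=> t _; rewrite patchE; case: ifP => _ //; rewrite lee_fin expR_ge0.
    - by rewrite lee_fin normal_peak_ge0.
    apply: eq_integral => t _; rewrite patchE addr0 normal_pdf0E// /indicator_ge.
    rewrite exprMn sqr_sqrtr// expr1n mem_setE in_itv/= andbT ler_pdivrMr// (mulrC t).
    case: ifP => _; last by rewrite mul0e mule0.
    by rewrite mul1e -EFinM; congr (_ * expR _)%:E; field.
  move=> H; rewrite ip EFinM -muleA H.
  - by rewrite muleA -EFinM divff ?gt_eqF// mul1e.
  - exact: emeasurable_funM.
  - by move=> y; rewrite mule_ge0 ?indicator_ge_ge0// lee_fin normal_pdf_ge0.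
rewrite h /erfc; set I := (\int[mu]_(t in _) _)%E.
have fin : I \is a fin_num.
  apply: integrable_fin_num => //.
  apply: (integrableS measurableT) => //; exact: integrableT_gauss.
rewrite /Rintegral -/I -(fineK fin) -EFinM; congr EFin.
by field; rewrite gt_eqF// sqrtr_gt0 pi_gt0.
Qed.

Lemma gauss_tail_strict (a : R) :
  (\int[gam]_y (if (a < y)%R then 1 else 0)%:E = \int[gam]_y indicator_ge a y)%E.
Proof.
have mI := measurable_indicator_ge a.
have mlt : measurable_fun [set: R] (fun y : R => (if (a < y)%R then 1 else 0 : R)%:E).
  by apply/measurable_EFinP; apply: measurable_fun_ifT => //; exact: measurable_fun_ltr.
have mp : measurable_fun [set: R] (fun y : R => (normal_pdf 0 1 y)%:E).
  by apply/measurable_EFinP; exact: measurable_normal_pdf.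
rewrite !integral_gauss//; last 2 first.
- exact: indicator_ge_ge0.
- by move=> y; rewrite lee_fin; case: ifP.
transitivity (\int[mu]_(y in `]a, +oo[) (normal_pdf 0 1 y)%:E)%E.
  rewrite [RHS]integral_mkcond; apply: eq_integral => y _.
  by rewrite patchE mem_setE in_itv/= andbT; case: ifP => _; rewrite ?mul1e ?mul0e.
rewrite integral_itv_obnd_cbnd; last by apply: measurable_funTS.
rewrite integral_mkcond; apply: eq_integral => y _.
by rewrite patchE mem_setE in_itv/= andbT /indicator_ge; case: ifP => _; rewrite ?mul1e ?mul0e.
Qed.

(** Density of N(t, 1) with respect to N(0, 1). *)
Definition shifted_density (t y : R) : R := expR (t * y - t ^+ 2 / 2).

Lemma shifted_density_le (t1 t2 y : R) : t1 < t2 ->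
  (shifted_density t1 y <= shifted_density t2 y) = ((t1 + t2) / 2 <= y).
Proof.
move=> t12; rewrite ler_expR -subr_ge0.
have -> : t2 * y - t2 ^+ 2 / 2 - (t1 * y - t1 ^+ 2 / 2) = (t2 - t1) * (y - (t1 + t2) / 2) by field.
by rewrite pmulr_rge0 ?subr_gt0// subr_ge0.
Qed.

(** The densities cross at the midpoint. On either side the smaller one integrates, after
    recentering, to a Gaussian tail at half the distance of the means, and each tail is half of an
    [erfc]. *)
Lemma integral_min_shifted_density (t1 t2 : R) : t1 < t2 ->
  (\int[gam]_y (Num.min (shifted_density t1 y) (shifted_density t2 y))%:E =
   (erfc ((t2 - t1) / 2 / Num.sqrt 2))%:E)%E.
Proof.
move=> t12; pose m := (t1 + t2) / 2.
have mlt (b : R) : measurable_fun [set: R] (fun y : R => (if (y < b)%R then 1 else 0 : R)%:E).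
  by apply/measurable_EFinP; apply: measurable_fun_ifT => //; exact: measurable_fun_ltr.
have lt0 (b y : R) : (0 <= (if (y < b)%R then 1 else 0 : R)%:E)%E by rewrite lee_fin; case: ifP.
have msd t : measurable_fun [set: R] (fun y : R => (shifted_density t y)%:E).
  by apply/measurable_EFinP; apply: measurableT_comp => //; apply: measurable_funB => //; exact: measurable_funM.
have sd0 t y : (0 <= (shifted_density t y)%:E)%E by rewrite lee_fin expR_ge0.
have shift t (f : R -> \bar R) : measurable_fun setT f -> (forall y, 0 <= f y)%E ->
    (\int[gam]_y (f y * (shifted_density t y)%:E) = \int[gam]_y f (y + t)%R)%E.
  move=> mf f0; apply: etrans _ (gauss_shift t n1 mf f0); apply: eq_integral => y _.
  by congr (_ * (expR _)%:E)%E; rewrite expr1n divr1 mulr1.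
transitivity (\int[gam]_y (indicator_ge m y * (shifted_density t1 y)%:E) +
    \int[gam]_y ((if (y < m)%R then 1 else 0)%:E * (shifted_density t2 y)%:E))%E.
  rewrite -ge0_integralD//.
  - apply: eq_integral => y _; rewrite /indicator_ge ltNge -(shifted_density_le y t12).
    by case: leP => _; rewrite /= ?mul1e ?mul0e ?adde0 ?add0e.
  - by move=> y _; rewrite mule_ge0 ?indicator_ge_ge0.
  - by apply: emeasurable_funM => //; exact: measurable_indicator_ge.
  - by move=> y _; rewrite mule_ge0.
  - exact: emeasurable_funM.
rewrite !shift//; [|exact: measurable_indicator_ge|exact: indicator_ge_ge0].
have -> : (\int[gam]_y indicator_ge m (y + t1)%R = \int[gam]_y indicator_ge ((t2 - t1) / 2) y)%E.
  apply: eq_integral => y _; rewrite /indicator_ge -lerBlDr; congr (if _ <= _ then _ else _)%:E.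
  by rewrite /m; field.
have -> : (\int[gam]_y (if (y + t2 < m)%R then 1 else 0)%:E =
    \int[gam]_y (if (y < - ((t2 - t1) / 2))%R then 1 else 0)%:E)%E.
  apply: eq_integral => y _; rewrite -ltrBrDr; congr (if _ < _ then _ else _)%:E.
  by rewrite /m; field.
by rewrite gauss_tail_opp gauss_tail_strict gauss_tail_erfc -EFinD; congr EFin; field.
Qed.

End gaussian_tail.

(** * The rank-k likelihood ratio *)

Section iid_existence.
Context {R : realType} (prior : probability R R).

Lemma iid_column_exists N k (muX : probability 'M[R]_(N, k) R) : (0 < k)%N ->
  iid_law prior muX -> exists mu : probability 'M[R]_(N, 1) R, iid_law prior mu.
Proof.
case: k muX => // k muX _ hmu.
pose g (X : 'M[R]_(N, k.+1)) : 'M[R]_(N, 1) := \matrix_(i, j) X i ord0.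
have mg : measurable_fun setT g.
  by apply: measurable_mxP => i j; under eq_fun do rewrite mxE; exact: measurable_mx_entry.
exists (image_law muX mg) => B mB; rewrite image_lawE.
pose B' i (j : 'I_k.+1) := if j == ord0 then B i ord0 else setT.
have -> : g @^-1` rect B = rect B'.
  apply/seteqP; split=> X /= h i j.
    by rewrite /B'; case: eqP => // ->; have := h i ord0; rewrite /g mxE.
  by have := h i ord0; rewrite /B' eqxx (ord1 j) /g mxE.
rewrite (hmu B'); last by move=> i j; rewrite /B'; case: ifP.
rewrite -(pair_bigA _ (fun i j => prior (B' i j)))/= -(pair_bigA _ (fun i j => prior (B i j)))/=.
apply: eq_bigr => i _; rewrite big_ord1 (bigD1 ord0)//= big1 ?mule1 /B' ?eqxx// => j /negbTE ->.
exact: probability_setT.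
Qed.

(** Replica computations require i.i.d. matrices with any number of columns. One column of the given
    matrix is extracted, and independent copies of it are concatenated. *)
Lemma iid_law_exists N k (muX : probability 'M[R]_(N, k) R) K : (0 < k)%N ->
  iid_law prior muX -> exists mu : probability 'M[R]_(N, K) R, iid_law prior mu.
Proof.
move=> k0 hmu; have [mu1 h1] := iid_column_exists k0 hmu.
elim: K => [|K [mu hK]]; last first.
  have h := @iid_row_mx R prior N 1 K mu1 mu h1 hK.
  by exists (image_law (mu1 \x mu)%E (@measurable_row_mx R N 1 K)); exact: h.
(* With no columns every rectangle is the whole space, so a constant matrix will do. *)
exists (image_law muX (measurable_cst (0 : 'M[R]_(N, 0)))) => B mB; rewrite image_lawE.
rewrite big_pred0; last by case=> i [].
have -> : (fun=> 0 : 'M[R]_(N, 0)) @^-1` rect B = [set: 'M[R]_(N, k)].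
  by apply/seteqP; split=> // X _ i [].
exact: probability_setT.
Qed.

Variables (q : R -> R) (mq : measurable_fun setT q) (qid : {ae prior, forall x, q x = x}).

Lemma prior_preimage (B : set R) : measurable B -> prior (q @^-1` B) = prior B.
Proof.
move=> mB.
have mqB : measurable (q @^-1` B) by rewrite -[X in measurable X]setTI; exact: mq.
have e E : measurable E -> (\int[prior]_x (\1_E x)%:E = prior E)%E.
  by move=> mE; rewrite integral_indic// setIT.
have mI (E : set R) : measurable E -> measurable_fun setT (fun x => (\1_E x)%:E).
  by move=> mE; apply/measurable_EFinP; exact: measurable_indic.
rewrite -(e _ mqB) -(e _ mB); apply: ae_eq_integral => //; [exact: mI|exact: mI|].
apply: filterS qid => x qx _; congr (_%:E).
by rewrite !indicE; congr (nat_of_bool _)%:R; apply/idP/idP; rewrite !inE /= qx.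
Qed.

(** As [q] is almost surely the identity, applying it entrywise does not change the law; this is
    where the original spike is exchanged for the bounded one. *)
Lemma integral_iid_map N k (muX : probability 'M[R]_(N, k) R) (f : 'M[R]_(N, k) -> \bar R) :
  iid_law prior muX -> measurable_fun setT f -> (forall X, 0 <= f X)%E ->
  (\int[muX]_X f X = \int[muX]_X f (map_mx q X))%E.
Proof.
move=> hmu mf f0.
have mg : measurable_fun setT (fun X : 'M[R]_(N, k) => map_mx q X).
  by apply: measurable_mxP => i j; under eq_fun do rewrite mxE; exact: (measurableT_comp mq (measurable_mx_entry i j)).
apply: (mx_transfer mg) => // B mB.
have -> : (fun X : 'M[R]_(N, k) => map_mx q X) @^-1` rect B = rect (fun i j => q @^-1` B i j).
  by apply/seteqP; split=> X /= h i j; have := h i j; rewrite mxE.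
rewrite (hmu (fun i j => q @^-1` B i j)); last first.
  by move=> i j; rewrite -[X in measurable X]setTI; exact: mq.
rewrite (hmu B)//; apply: eq_bigr => -[i j] _ /=; exact: prior_preimage.
Qed.

End iid_existence.

Section rank_k_density.
Context {R : realType} (lam w2 : R).
Hypothesis w20 : 0 < w2.
Variables (prior : probability R R) (q : R -> R) (B : R).
Hypotheses (B1 : 1 <= B) (mq : measurable_fun setT q) (qB : forall x, `|q x| <= B).
Hypothesis qid : {ae prior, forall x, q x = x}.
Variables (mu : forall N K, probability 'M[R]_(N, K) R) (G : forall N, probability 'M[R]_N R).
Hypotheses (hmu : forall N K, iid_law prior (mu N K)) (hG : forall N, wigner_law w2 (G N)).

(** Level [N] keeps all rows of each spike; overlap level 0 makes the weight trivial. *)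
Definition rank_lik k N : 'M[R]_N -> R :=
  replica_lik lam w2 q mu (K := k) (fun=> N) (fun=> 0%N).

Lemma spikes_full N k (X : 'M[R]_(N, k)) :
  spikes lam q (fun=> N) X = Num.sqrt (lam / N%:R) *: (map_mx q X *m (map_mx q X)^T).
Proof.
apply/matrixP => i j; rewrite summxE !mxE mulr_sumr; apply: eq_bigr => l _.
by rewrite !mxE !ltn_ord/= /qcol mulrA.
Qed.

Lemma overlaps_level0 N k (X : 'M[R]_(N, k)) : overlaps lam w2 q (fun=> 0%N) X = 0.
Proof.
apply: big1 => p _; apply: big1 => r _; rewrite !mxE.
by rewrite ltn0 !mul0r.
Qed.

Lemma spiked_wigner_density N k (nu : probability 'M[R]_N R) :
  spiked_wigner_law k lam w2 prior nu -> forall A, measurable A ->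
  (nu A = \int[G N]_(w in A) (rank_lik k w)%:E)%E.
Proof.
move=> /spiked_wigner_lawP[muX [mu0 [hX h0 hnu]]] A mA.
pose f (w : 'M[R]_N) : \bar R := (\1_A w)%:E.
have mf : measurable_fun setT f by apply/measurable_EFinP; exact: measurable_indic.
have f0 w : (0 <= f w)%E by rewrite lee_fin.
have mf2 : measurable_fun setT (fun XW : 'M[R]_(N, k) * 'M[R]_N => f (spiked_mx lam XW.1 XW.2)).
  apply: (measurableT_comp mf); exact: measurable_spiked_mx.
rewrite -[LHS](_ : (\int[nu]_w f w)%E = _); last by rewrite integral_indic// setIT.
rewrite hnu//.
transitivity (\int[G N]_w (f w * (rank_lik k w)%:E))%E; last first.
  rewrite [in RHS]integral_mkcond; apply: eq_integral => w _; rewrite /f.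
  by rewrite patchE indicE; case: ifP => _; rewrite ?mul1e ?mul0e.
have r := regular_spikes lam w20 B1 mq qB N (K := k) (fun=> N) (fun=> 0%N).
rewrite /rank_lik /replica_lik (integral_lik w20 (mu N k) r (@hG N) mf f0).
rewrite (eq_measure_integral (mu N k)); last first.
  by move=> E mE _; exact: (iid_law_unique hX (@hmu N k)).
rewrite [LHS](integral_iid_map mq qid (@hmu N k)); last 2 first.
- exact: (measurable_fun_fubini_tonelli_F _ mf2 (fun XW => f0 _)).
- by move=> X; apply: integral_ge0 => w _; exact: f0.
apply: eq_integral => X _; rewrite overlaps_level0 expR0 mul1e.
rewrite (eq_measure_integral (G N)); last first.
  by move=> E mE _; exact: (wigner_law_unique h0 (@hG N)).
by apply: eq_integral => w _; rewrite spikes_full addrC.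
Qed.

End rank_k_density.

Section rank_k_limit.
Context {R : realType} (lam w2 : R).
Hypotheses (lam0 : 0 < lam) (lam1 : lam < 1) (w20 : 0 < w2).
Variables (prior : probability R R) (q : R -> R) (B : R).
Hypotheses (B1 : 1 <= B) (mq : measurable_fun setT q) (qB : forall x, `|q x| <= B).
Hypothesis q1 : (\int[prior]_x (q x)%:E = 0)%E.
Hypothesis q2 : (\int[prior]_x (q x ^+ 2)%:E = 1)%E.
Variables (mu : forall N K, probability 'M[R]_(N, K) R) (G : forall N, probability 'M[R]_N R).
Hypotheses (hmu : forall N K, iid_law prior (mu N K)) (hG : forall N, wigner_law w2 (G N)).
Variable kmax : nat.
Hypothesis small : 4 * lam * (kmax ^ 2)%:R * B ^+ 4 < 1.

Local Notation V := (logV lam w2 1).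
Local Notation rk a := (@rank1 R lam w2 q mu a).
Local Notation rlik k := (@rank_lik R lam w2 q mu k).
Local Notation reps := (replicas lam w2 q mu).
Local Notation gam := (gauss 1 : probability R R).

Let Rcvg s f e := @replicas_Rcvg R lam w2 lam0 lam1 w20 prior q B B1 mq qB q1 q2 mu G hmu hG
  kmax small s f e.
Let Rint s f e N := @replicas_integrable R lam w2 w20 q B B1 mq qB mu G hG s f e N.
Let repM s s' f f' e e' :=
  @replicasM R lam w2 w20 prior q B B1 mq qB mu hmu s s' f f' e e'.

Lemma cvg_ratio1 : N%:R / N%:R @[N --> \oo] --> (1 : R).
Proof.
apply: (cvg_approx (b := fun=> 1) (e := fun=> 0)); [exact: cvg_cst|exact: cvg_cst|].
near=> N; rewrite divff ?subrr ?normr0// pnatr_eq0 -lt0n.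
by near: N; exists 1%N.
Unshelve. all: by end_near. Qed.

Lemma replicas_rank_lik k : reps (nseq k 1) (fun N w => rlik k w) 0.
Proof.
have c0 : (0%N)%:R / N%:R @[N --> \oo] --> (0 : R).
  by under eq_cvg do rewrite mul0r; exact: cvg_cst.
have := @replicas_level R lam w2 q mu k (fun N => N) (fun=> 0%N) 1 0
  (fun N => leqnn N) (fun=> leq0n _) cvg_ratio1 c0.
by rewrite logV0 mulr0.
Qed.

Lemma replicas_rank1_full k : reps (nseq k 1) (fun N w => rk N w ^+ k) (k%:R * (k%:R - 1) / 2 * V).
Proof. exact: (replicas_rank1X lam w20 B1 mq qB hmu (a := fun N => N) k (fun N => leqnn N) cvg_ratio1). Qed.

(** Inverse of the limiting k-th moment of the rank-one ratio. *)
Definition power_norm k : R := expR (- (k%:R * (k%:R - 1) / 2 * V)).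

(** After expansion the three limits are exp(k^2 V) times 1, 1/c and 1/c^2, weighted by 1, -2c and
    c^2. Only the overlaps inside each family differ, and [power_norm] compensates exactly for
    those. *)
Lemma rank_lik_power k : (k + k <= kmax)%N ->
  \int[G N]_w ((rlik k w - power_norm k * rk N w ^+ k) ^+ 2) @[N --> \oo] --> (0 : R).
Proof.
move=> kk; set c := power_norm k.
have r1 := repM (replicas_rank_lik k) (replicas_rank_lik k).
have r2 := repM (replicas_rank_lik k) (replicas_rank1_full k).
have r3 := repM (replicas_rank1_full k) (replicas_rank1_full k).
move: r1 r2 r3; rewrite !(sum_nseq2 k k 1 1 (fun u v => logV lam w2 (Num.min u v))) minxx => r1 r2 r3.
have e N : \int[G N]_w ((rlik k w - c * rk N w ^+ k) ^+ 2) = \int[G N]_w (rlik k w * rlik k w) +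
    (-2 * c) * \int[G N]_w (rlik k w * rk N w ^+ k) + c ^+ 2 * \int[G N]_w (rk N w ^+ k * rk N w ^+ k).
  have i1 := Rint N r1; have i2 := Rint N r2; have i3 := Rint N r3.
  rewrite -!expectationZ// -!expectationD//; do ?apply: integrableDR => //; do ?exact: integrableZlR.
  by apply: eq_Rintegral => w _; ring.
have sz : (size (nseq k (1%R : R) ++ nseq k 1%R) <= kmax)%N by rewrite size_cat !size_nseq.
have l1 := @Rcvg _ _ _ sz r1; have l2 := @Rcvg _ _ _ sz r2; have l3 := @Rcvg _ _ _ sz r3.
have z : expR (0 + 0 + k%:R * k%:R * V) + (-2 * c) * expR (0 + k%:R * (k%:R - 1) / 2 * V + k%:R * k%:R * V)
    + c ^+ 2 * expR (k%:R * (k%:R - 1) / 2 * V + k%:R * (k%:R - 1) / 2 * V + k%:R * k%:R * V) = 0.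
  rewrite /c /power_norm expRN !expRD expR0.
  by field; rewrite gt_eqF// expR_gt0.
rewrite -[X in _ --> X]z.
under eq_cvg do rewrite e.
by apply: cvgD; [apply: cvgD => //; exact: cvgMr|exact: cvgMr].
Qed.

Lemma power_norm_lgn k y : 0 <= V ->
  power_norm k * lgn V y ^+ k = shifted_density (k%:R * Num.sqrt V) y.
Proof.
move=> V0; rewrite /power_norm /lgn -expRM_natl -expRD /shifted_density exprMn sqr_sqrtr//.
by congr expR; field.
Qed.

Lemma min_rank_lik_cvg k1 k2 : (k1 < k2)%N -> (k2 + k2 <= kmax)%N -> (4 <= kmax)%N -> 0 <= V ->
  \int[G N]_w Num.min (rlik k1 w) (rlik k2 w) @[N --> \oo] -->
  \int[gam]_y Num.min (shifted_density (k1%:R * Num.sqrt V) y) (shifted_density (k2%:R * Num.sqrt V) y).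
Proof.
move=> k12 kk kmax4 V0.
have mX N : measurable_fun setT (rk N (N := N)) by exact: (measurable_rank1 lam w20 B1 mq qB).
have X0 N w : 0 <= rk N (N := N) w by exact: (rank1_ge0 lam w20 B1 mq qB).
have rL k N w : 0 <= rlik k (N := N) w by exact: (replicas_ge0 w20 B1 mq qB w (replicas_rank_lik k)).
have mL k N : measurable_fun setT (rlik k (N := N)).
  exact: (@replicas_measurable R lam w2 w20 q B B1 mq qB mu _ _ _ N (replicas_rank_lik k)).
have iL k N : (G N).-integrable setT (EFin \o rlik k (N := N)) := Rint N (replicas_rank_lik k).
have iX N k : (G N).-integrable setT (EFin \o (fun w => rk N w ^+ k)) := Rint N (replicas_rank1_full k).
have c0 k : 0 <= power_norm k by exact: expR_ge0.
pose H := min_power (power_norm k1) (power_norm k2) k1 k2.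
have -> : \int[gam]_y Num.min (shifted_density (k1%:R * Num.sqrt V) y) (shifted_density (k2%:R * Num.sqrt V) y)
    = \int[gam]_y H (lgn V y).
  by apply: eq_Rintegral => y _; rewrite /H /min_power !power_norm_lgn.
have k1kmax : (k1.+1 <= kmax)%N by rewrite (leq_trans k12)// (leq_trans _ kk)// leq_addr.
have Xm : \int[G N]_w (rk N w ^+ k1.+1) @[N --> \oo] --> expR (k1.+1%:R * (k1.+1%:R - 1) / 2 * V).
  by apply: Rcvg (replicas_rank1_full k1.+1); rewrite size_nseq.
have limH : \int[G N]_w H (rk N w) @[N --> \oo] --> \int[gam]_y H (lgn V y).
  apply: (@min_power_cvg R _ _ (fun N => 'M[R]_N) _ G gam (fun N => rk N (N := N)) (lgn V) mX
    (measurable_lgn V) X0 (lgn_ge0 V) _ (power_norm k1) (power_norm k2) k1 k2 _ (c0 k1) (c0 k2) iX _ Xm).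
  - by move=> c cc; exact: (laplace_limit lam0 lam1 w20 B1 mq qB q1 q2 hmu hG small kmax4 cc).
  - by move=> k; exact: integrable_lgnX.
have iH N : (G N).-integrable setT (EFin \o (fun w => H (rk N (N := N) w))).
  exact: (integrable_min_power k2 (c0 k1) (c0 k2) (mX N) (X0 N) (iX N k1)).
have iD k N : (G N).-integrable setT (EFin \o (fun w => (rlik k w - power_norm k * rk N w ^+ k) ^+ 2)).
  have r1 := repM (replicas_rank_lik k) (replicas_rank_lik k).
  have r2 := repM (replicas_rank_lik k) (replicas_rank1_full k).
  have r3 := repM (replicas_rank1_full k) (replicas_rank1_full k).
  have i1 := Rint N r1; have i2 := Rint N r2; have i3 := Rint N r3.
  rewrite (_ : (fun w => _) = fun w => rlik k w * rlik k w + (-2 * power_norm k) * (rlik k w * rk N w ^+ k) +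
    power_norm k ^+ 2 * (rk N w ^+ k * rk N w ^+ k)); last by apply/funext => w; ring.
  by apply: integrableDR; [apply: integrableDR => //|]; exact: integrableZlR.
apply/cvgrPdist_le => eps e0.
have /cvgrPdist_le/(_ (eps / 3)) g1 := limH.
have /cvgr_le/(_ ((eps / 3) ^+ 2)) g2 := rank_lik_power (leq_trans (leq_add (ltnW k12) (ltnW k12)) kk).
have /cvgr_le/(_ ((eps / 3) ^+ 2)) g3 := rank_lik_power kk.
have e3 : 0 < eps / 3 by rewrite divr_gt0.
near=> N.
have h1 : `|\int[gam]_y H (lgn V y) - \int[G N]_w H (rk N w)| <= eps / 3 by near: N; exact: g1.
have h2 : \int[G N]_w ((rlik k1 w - power_norm k1 * rk N w ^+ k1) ^+ 2) <= (eps / 3) ^+ 2.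
  by near: N; apply: g2; rewrite exprn_gt0.
have h3 : \int[G N]_w ((rlik k2 w - power_norm k2 * rk N w ^+ k2) ^+ 2) <= (eps / 3) ^+ 2.
  by near: N; apply: g3; rewrite exprn_gt0.
(* Passes from L^2 to L^1 by |z| <= z^2 / (2e) + e/2 with e = eps / 3. *)
pose D k (w : 'M[R]_N) := (2 * (eps / 3))^-1 * (rlik k w - power_norm k * rk N w ^+ k) ^+ 2.
have h4 : `|\int[G N]_w H (rk N w) - \int[G N]_w Num.min (rlik k1 w) (rlik k2 w)| <= 2 * (eps / 3).
  apply: (@le_trans _ _ (\int[G N]_w (D k1 w + D k2 w + eps / 3))).
    apply: expectation_dist_le => //.
    - apply: (ler_integrable _ _ (iL k1 N)); first exact: (measurable_minr (mL k1 N) (mL k2 N)).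
      by move=> w; rewrite ger0_norm; [rewrite ge_min lexx|rewrite le_min !rL].
    - by do ?apply: integrableDR; do ?apply: integrableZlR => //; exact: integrable_cstR.
    - move=> w; rewrite distrC; apply: le_trans (min_dist_le _ _ _ _) _.
      have am k : `|rlik k w - power_norm k * rk N w ^+ k| <= D k w + eps / 3 / 2.
        rewrite /D; set z := _ - _; rewrite -(real_normK (num_real z)).
        have -> : (2 * (eps / 3))^-1 * `|z| ^+ 2 + eps / 3 / 2 = (`|z| ^+ 2 + (eps / 3) ^+ 2) / (2 * (eps / 3)).
          by field; rewrite gt_eqF.
        rewrite ler_pdivlMr ?mulr_gt0//.
        by have := sqr_ge0 (`|z| - eps / 3); nra.
      have := am k1; have := am k2; lra.
  rewrite Rintegral_addc; last by apply: integrableDR; exact: integrableZlR.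
  rewrite expectationD ?expectationZ//; do ?exact: integrableZlR.
  have b u : u <= (eps / 3) ^+ 2 -> (2 * (eps / 3))^-1 * u <= eps / 3 / 2.
    move=> hu; rewrite ler_pdivrMl ?mulr_gt0//; apply: le_trans hu _.
    by rewrite le_eqVlt; apply/orP; left; apply/eqP; field.
  have := b _ h2; have := b _ h3; lra.
have := ler_normD (\int[gam]_y H (lgn V y) - \int[G N]_w H (rk N w))
  (\int[G N]_w H (rk N w) - \int[G N]_w Num.min (rlik k1 w) (rlik k2 w)).
rewrite addrA subrK; move: h1 h4.
set u1 := `|_|; set u2 := `|_|; set u3 := `|_|; move: u1 u2 u3 => u1 u2 u3; lra.
Unshelve. all: by end_near. Qed.

End rank_k_limit.

Theorem theorem3p4 (R : realType) (k1 k2 : nat) (prior : probability R R)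
    (hk : (k1 < k2)%N)
    (prior_centered : ('E_prior[fun x : R => x] = 0)%E)
    (prior_unit_var : ('V_prior[fun x : R => x] = 1)%E)
    (prior_bounded : bounded_set (support_of prior)) :
  exists lambda0 : R, 0 < lambda0 <= 1 /\
    forall (w2 lambda : R), 0 < w2 -> 0 < lambda < lambda0 ->
    forall (P1 P2 : forall N : nat, probability 'M[R]_N R),
      (forall N, spiked_wigner_law k1 lambda w2 prior (P1 N)) ->
      (forall N, spiked_wigner_law k2 lambda w2 prior (P2 N)) ->
      lrt_err (P1 N) (P2 N) @[N --> \oo] -->
        (erfc ((k2%:R - k1%:R) / 4 *
               Num.sqrt (- ln (1 - lambda) + (2 / w2 - 1) * lambda)))%:E.
Proof.
have [B [q [B1 [mq qB qid] q1 q2]]] := prior_clip prior_centered prior_unit_var prior_bounded.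
(* Four replicas for the Lindeberg moments, [k2 + k2] for the L^2 comparison at rank [k2]. *)
pose kmax := maxn 4 (k2 + k2).
have kmax4 : (4 <= kmax)%N by exact: leq_maxl.
have kmaxk : (k2 + k2 <= kmax)%N by exact: leq_maxr.
pose C : R := 4 * (kmax ^ 2)%:R * B ^+ 4.
have C1 : 1 <= C.
  have B41 : 1 <= B ^+ 4 by exact: exprn_ege1.
  have k21 : 1 <= (kmax ^ 2)%:R :> R by rewrite ler1n expn_gt0 (leq_trans _ kmax4).
  apply: mulr_ege1 => //; apply: mulr_ege1 => //; by rewrite ler1n.
have C0 : 0 < C := lt_le_trans ltr01 C1.
exists C^-1; split; first by rewrite invr_gt0 C0 invf_le1.
move=> w2 lam w20 /andP[lam0 lamC] P1 P2 hP1 hP2.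
have small : 4 * lam * (kmax ^ 2)%:R * B ^+ 4 < 1.
  rewrite (_ : 4 * lam * (kmax ^ 2)%:R * B ^+ 4 = lam * C); last by rewrite /C; ring.
  by rewrite -ltr_pdivlMr// mul1r.
have lam1 : lam < 1 by apply: lt_le_trans lamC _; rewrite invf_le1.
have k20 : (0 < k2)%N by exact: leq_ltn_trans hk.
(* The reference laws are extracted from a realization of the rank-[k2] model, which has at least
   one column since [k1 < k2]. *)
have exmu N K : exists m : probability 'M[R]_(N, K) R, iid_law prior m.
  have [muX [_ [hX _ _]]] := spiked_wigner_lawP (hP2 N).
  exact: iid_law_exists k20 hX.
have exG N : exists g : probability 'M[R]_N R, wigner_law w2 g.
  by have [_ [g [_ hg _]]] := spiked_wigner_lawP (hP2 N); exists g.
pose mu N K := projT1 (cid (exmu N K)).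
have hmu N K : iid_law prior (mu N K) := projT2 (cid (exmu N K)).
pose G N := projT1 (cid (exG N)).
have hG N : wigner_law w2 (G N) := projT2 (cid (exG N)).
pose V := logV lam w2 1.
have V0 : 0 < V.
  have := logV_increment_ge lam0 lam1 w20 (lexx 0) ler01 (lexx 1).
  by rewrite logV0 !subr0 mulr1; apply: lt_le_trans; exact: divr_gt0.
have mL k N : measurable_fun setT (@rank_lik R lam w2 q mu k N).
  exact: (measurable_replica_lik lam w20 B1 mq qB).
have L0 k N w : 0 < @rank_lik R lam w2 q mu k N w.
  have r := regular_spikes lam w20 B1 mq qB N (fun _ : 'I_k => N) (fun=> 0%N).
  exact: (lik_gt0 w20 (mu N k) r w).
have errE N : lrt_err (P1 N) (P2 N) =
    (\int[G N]_w (Num.min (@rank_lik R lam w2 q mu k1 N w) (@rank_lik R lam w2 q mu k2 N w))%:E)%E.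
  apply: lrt_err_min => //.
  - exact: mL.
  - exact: mL.
  - by move=> w; exact/ltW/L0.
  - exact: (spiked_wigner_density w20 B1 mq qB qid hmu hG (hP1 N)).
  - exact: (spiked_wigner_density w20 B1 mq qB qid hmu hG (hP2 N)).
have iL N : (G N).-integrable setT (EFin \o (fun w =>
    Num.min (@rank_lik R lam w2 q mu k1 N w) (@rank_lik R lam w2 q mu k2 N w))).
  apply: (ler_integrable (g := @rank_lik R lam w2 q mu k1 N)).
  - exact: (measurable_minr (mL k1 N) (mL k2 N)).
  - by move=> w; rewrite ger0_norm; [rewrite ge_min lexx|rewrite le_min !ltW].
  - exact: (replicas_integrable w20 B1 mq qB hG N (replicas_rank_lik lam w2 q mu k1)).
have lim := min_rank_lik_cvg lam0 lam1 w20 B1 mq qB q1 q2 hmu hG small hk kmaxk kmax4 (ltW V0).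
have sV : 0 < Num.sqrt V by rewrite sqrtr_gt0.
have t12 : k1%:R * Num.sqrt V < k2%:R * Num.sqrt V by rewrite ltr_pM2r// ltr_nat.
(* The factor 2 under the root turns the half-distance over sqrt 2 of the Gaussian tails into the
   quarter of the statement, as sqrt 2 / 4 = 1 / (2 sqrt 2). *)
have eV : - ln (1 - lam) + (2 / w2 - 1) * lam = 2 * V.
  by rewrite /V /logV mulr1; field; rewrite gt_eqF.
have limE : (k2%:R - k1%:R) / 4 * Num.sqrt (- ln (1 - lam) + (2 / w2 - 1) * lam) =
    (k2%:R * Num.sqrt V - k1%:R * Num.sqrt V) / 2 / Num.sqrt 2 :> R.
  have s2 : Num.sqrt 2 ^+ 2 = 2 :> R by rewrite sqr_sqrtr.
  have s20 : Num.sqrt 2 != 0 :> R by rewrite sqrtr_eq0 -ltNge.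
  rewrite eV sqrtrM// -mulrBl.
  have -> : (k2%:R - k1%:R) / 4 * (Num.sqrt 2 * Num.sqrt V) =
     (k2%:R - k1%:R) * Num.sqrt V / 2 / Num.sqrt 2 * (Num.sqrt 2 ^+ 2 / 2) :> R by field.
  by rewrite s2 divff ?pnatr_eq0// mulr1.
have lerr : \int[gauss 1]_y Num.min (shifted_density (k1%:R * Num.sqrt V) y)
    (shifted_density (k2%:R * Num.sqrt V) y) =
  erfc ((k2%:R - k1%:R) / 4 * Num.sqrt (- ln (1 - lam) + (2 / w2 - 1) * lam)).
  by rewrite limE /Rintegral integral_min_shifted_density.
rewrite -lerr; apply/fine_cvgP; split.
  by apply: nearW => N; rewrite errE -EFin_Rintegral.
rewrite (_ : fine \o _ = fun N => \int[G N]_w Num.min (@rank_lik R lam w2 q mu k1 N w) (@rank_lik R lam w2 q mu k2 N w))//.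
by apply/funext => N /=; rewrite errE -EFin_Rintegral.
Qed.
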